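(* Let $n\geq 2$ and let $\Omega\subset\mathbb{R}^n$ be a bounded domain. Then $\Omega$ is a $(BV, BV)$-extension domain if and only if it is a $(W^{1,1}, BV)$-extension domain.
   Context: For a domain $\Omega\subset\mathbb{R}^n$ and $1\leq p\leq\infty$, $W^{1,p}(\Omega)$ is the space of $u\in L^p(\Omega)$ whose distributional gradient lies in $L^p(\Omega;\mathbb{R}^n)$, with norm $\|u\|_{W^{1,p}(\Omega)}=\|u\|_{L^p(\Omega)}+\|\nabla u\|_{L^p(\Omega)}$. $BV(\Omega)$ is the space of $u\in L^1(\Omega)$ with total variation $\|Du\|(\Omega):=\sup\{\int_\Omega u\,\mathrm{div}\,\phi\,dx:\ \phi\in C^1_c(\Omega;\mathbb{R}^n),\ |\phi|\leq 1\}<\infty$, with norm $\|u\|_{BV(\Omega)}=\|u\|_{L^1(\Omega)}+\|Du\|(\Omega)$. A bounded domain $\Omega$ is a $(W^{1,1},BV)$-extension domain if there is an operator $E\colon W^{1,1}(\Omega)\to BV(\mathbb{R}^n)$ and a constant $C>1$ such that for every $u\in W^{1,1}(\Omega)$, $E(u)|_\Omega= u$ and $\|E(u)\|_{BV(\mathbb{R}^n)}\leq C\|u\|_{W^{1,1}(\Omega)}$; it is a $(BV,BV)$-extension domain if there is an operator $E\colon BV(\Omega)\to BV(\mathbb{R}^n)$ and $C>1$ such that for every $u\in BV(\Omega)$, $E(u)|_\Omega=u$ and $\|E(u)\|_{BV(\mathbb{R}^n)}\leq C\|u\|_{BV(\Omega)}$. *)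

(* Defs.v *)
From HB Require Import structures.
From mathcomp Require Import all_boot all_order all_algebra.
From mathcomp Require Import all_classical all_reals all_analysis.
Set Implicit Arguments. Unset Strict Implicit. Unset Printing Implicit Defensive.
Import Order.TTheory GRing.Theory Num.Theory.
Import numFieldNormedType.Exports.
Local Open Scope classical_set_scope.
Local Open Scope ring_scope.

Section Defs.
Variable R : realType.

(* Coordinates: a point of R^n is a row vector 'rV[R]_n (normed/topological
   structure from the library); n.-tuple R carries the library's product
   (Borel) sigma-algebra. *)
Definition rowT (n : nat) (t : n.-tuple R) : 'rV[R]_n := \row_i tnth t i.

(* n-dimensional Lebesgue integral of a function on R^n, as the iterated
   one-dimensional Lebesgue integral (Tonelli); used only for nonnegative
   product-measurable integrands. *)
Fixpoint iint (n : nat) : (n.-tuple R -> \bar R) -> \bar R :=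
  match n return (n.-tuple R -> \bar R) -> \bar R with
  | 0 => fun f => f [tuple]
  | m.+1 => fun f =>
      (\int[@lebesgue_measure R]_x iint (fun t : m.-tuple R => f (cons_tuple x t)))%E
  end.

Variable n : nat.

Definition Iplus (A : set 'rV[R]_n) (f : 'rV[R]_n -> \bar R) : \bar R :=
  iint (fun t => patch (fun=> 0%E) A f (rowT t)).

Definition Iint (A : set 'rV[R]_n) (f : 'rV[R]_n -> R) : \bar R :=
  (Iplus A (fun x => (Num.max (f x) 0)%:E) - Iplus A (fun x => (Num.max (- f x) 0)%:E))%E.

Definition ae_eq (A : set 'rV[R]_n) (f g : 'rV[R]_n -> R) : Prop :=
  Iplus A (fun x => ((f x != g x)%:R)%:E) = 0%E.

Definition L1norm (A : set 'rV[R]_n) (u : 'rV[R]_n -> R) : \bar R :=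
  Iplus A (fun x => `|u x|%:E).

Definition L1 (A : set 'rV[R]_n) (u : 'rV[R]_n -> R) : Prop :=
  measurable_fun (@rowT n @^-1` A) (u \o @rowT n) /\ (L1norm A u < +oo)%E.

Definition ev (i : 'I_n) : 'rV[R]_n := delta_mx 0 i.
Definition partial (i : 'I_n) (f : 'rV[R]_n -> R) : 'rV[R]_n -> R :=
  fun x => 'D_(ev i) f x.

Definition iter_partial (l : seq 'I_n) (f : 'rV[R]_n -> R) : 'rV[R]_n -> R :=
  foldr (fun i g => partial i g) f l.

Definition smooth (f : 'rV[R]_n -> R) : Prop :=
  forall l : seq 'I_n, continuous (iter_partial l f) /\
    forall i x, derivable (iter_partial l f) x (ev i).

Definition C1 (f : 'rV[R]_n -> R) : Prop :=
  continuous f /\ (forall i x, derivable f x (ev i)) /\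
  (forall i, continuous (partial i f)).

Definition csupp_in {V : zmodType} (A : set 'rV[R]_n) (f : 'rV[R]_n -> V) : Prop :=
  compact (closure [set x | f x != 0]) /\ closure [set x | f x != 0] `<=` A.

Definition comp (phi : 'rV[R]_n -> 'rV[R]_n) (i : 'I_n) : 'rV[R]_n -> R :=
  fun x => phi x 0 i.

Definition div (phi : 'rV[R]_n -> 'rV[R]_n) : 'rV[R]_n -> R :=
  fun x => \sum_(i < n) partial i (comp phi i) x.

Definition TV_test (A : set 'rV[R]_n) (phi : 'rV[R]_n -> 'rV[R]_n) : Prop :=
  (forall i, C1 (comp phi i)) /\ csupp_in A phi /\
  (forall x, \sum_(i < n) phi x 0 i ^+ 2 <= 1).

Definition TV (A : set 'rV[R]_n) (u : 'rV[R]_n -> R) : \bar R :=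
  ereal_sup [set Iint A (fun x => u x * div phi x) | phi in TV_test A].

Definition BV (A : set 'rV[R]_n) (u : 'rV[R]_n -> R) : Prop :=
  L1 A u /\ (TV A u < +oo)%E.

Definition BVnorm (A : set 'rV[R]_n) (u : 'rV[R]_n -> R) : \bar R :=
  (L1norm A u + TV A u)%E.

Definition weak_grad (A : set 'rV[R]_n) (u : 'rV[R]_n -> R)
    (g : 'rV[R]_n -> 'rV[R]_n) : Prop :=
  forall psi : 'rV[R]_n -> R, smooth psi -> csupp_in A psi ->
    forall i, Iint A (fun x => u x * partial i psi x) =
              (- Iint A (fun x => (comp g i x * psi x)%R))%E.

Definition W11 (A : set 'rV[R]_n) (u : 'rV[R]_n -> R) (g : 'rV[R]_n -> 'rV[R]_n) : Prop :=
  L1 A u /\ (forall i, L1 A (comp g i)) /\ weak_grad A u g.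

Definition W11norm (A : set 'rV[R]_n) (u : 'rV[R]_n -> R) (g : 'rV[R]_n -> 'rV[R]_n) : \bar R :=
  (L1norm A u + Iplus A (fun x => (Num.sqrt (\sum_(i < n) g x 0 i ^+ 2))%:E))%E.

Definition bounded_domain (A : set 'rV[R]_n) : Prop :=
  open A /\ connected A /\ A !=set0 /\ bounded_set A.

Definition W11_BV_extension_domain (A : set 'rV[R]_n) : Prop :=
  exists (E : ('rV[R]_n -> R) -> ('rV[R]_n -> R)) (C : R), 1 < C /\
    forall u g, W11 A u g ->
      BV setT (E u) /\ ae_eq A (E u) u /\
      (BVnorm setT (E u) <= C%:E * W11norm A u g)%E.

Definition BV_BV_extension_domain (A : set 'rV[R]_n) : Prop :=
  exists (E : ('rV[R]_n -> R) -> ('rV[R]_n -> R)) (C : R), 1 < C /\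
    forall u, BV A u ->
      BV setT (E u) /\ ae_eq A (E u) u /\
      (BVnorm setT (E u) <= C%:E * BVnorm A u)%E.

End Defs.

(* Main.v *)
Require Import Defs.
From HB Require Import structures.
From mathcomp Require Import all_boot all_order all_algebra.
From mathcomp Require Import all_classical all_reals all_analysis.
From mathcomp Require Import measurable_realfun.
From mathcomp Require Import ring lra.
Set Implicit Arguments. Unset Strict Implicit. Unset Printing Implicit Defensive.
Import Order.TTheory GRing.Theory Num.Theory.
Import numFieldNormedType.Exports.
Local Open Scope classical_set_scope.
Local Open Scope ring_scope.

(* The heart of the matter is a smoothing that does not change boundary values:
   for u in BV(Omega) with zero extension U and delta > 0 there is v in
   W^{1,1}(Omega) with ||u - v||_1 <= delta, ||grad v||_1 controlled by
   ||Du||(Omega) + delta, and such that the zero extension of u - v to R^n has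
   total variation controlled by the same quantity.  An extension of u is then
   E v + (u - v), where E extends W^{1,1} functions and u - v is extended by
   zero; delta = ||u||_1 makes the bound homogeneous.

   Take a partition of unity theta_k of Omega, theta_k living at distance about
   2^-k from the boundary, even kernels rho_k of radius at most 2^-k / 4, and
   v = sum_k (U theta_k) * rho_k.  Moving the mollification and the cutoff onto
   the test field phi, up to errors of size delta 2^-k coming from the
   commutators (U d theta_k) * rho_k - U d theta_k, turns the pairing of u - v
   with div phi into the pairing of U with the divergence of
   sum_k theta_k (phi - phi * rho_k).  That field has compact support in Omega
   and is bounded by 2 even when phi does not vanish on the boundary of Omega;
   the gradient of v is estimated by the same transposition.

   Conversely W^{1,1}(Omega) embeds in BV(Omega), so that a BV extension
   operator also extends W^{1,1} functions. *)

(** * Lebesgue measure on row vectors *)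

(** The derivatives of the [theta_k] blow up towards the boundary, so nothing bounds the sum of the
    [|U d theta_k|] in [L1], and these terms are never estimated on their own. In the pairing of
    [u - v] only the error of mollifying them appears, and the radius of [rho_k] is chosen after [u]
    to make that error at most [delta 2^-(k+1)]. In the gradient of [v] what remains of them is [U]
    times the derivative of the sum of the [theta_k], and this sum is locally constant. Hence it is
    enough that mollification converges in [L1], without any rate. The price is that the radii
    depend on [u], so the operator obtained need not be linear; an extension domain asks only for a
    bound. The norm of row vectors is the maximum norm, whereas [TV_test] and [W11norm] use the
    Euclidean length; working component by component brings powers of the dimension into the
    constants. *)

Definition rV_display : measure_display. Proof. exact: default_measure_display. Qed.

Section rV_measurable.
Variables (R : realType) (n : nat).

(** Carried over from tuples, because [L1] tests measurability after composition with [rowT]. That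
    the result is the Borel sigma-algebra is [measurable_rV_open]. *)
Definition rV_measurable : set (set 'rV[R]_n) :=
  [set A | measurable (@rowT R n @^-1` A)].

Lemma rV_measurable0 : rV_measurable set0.
Proof. by rewrite /rV_measurable /= preimage_set0. Qed.

Lemma rV_measurableC A : rV_measurable A -> rV_measurable (~` A).
Proof. by rewrite /rV_measurable /= preimage_setC => /measurableC. Qed.

Lemma rV_measurable_bigcup (F : (set 'rV[R]_n)^nat) :
  (forall i, rV_measurable (F i)) -> rV_measurable (\bigcup_i F i).
Proof.
by move=> mF; rewrite /rV_measurable /= preimage_bigcup; exact: bigcupT_measurable.
Qed.

HB.instance Definition _ := @isMeasurable.Build rV_display 'rV[R]_n
  rV_measurable rV_measurable0 rV_measurableC rV_measurable_bigcup.

End rV_measurable.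

Section rV_measurable_theory.
Variables (R : realType) (n : nat).
Implicit Types A : set 'rV[R]_n.

Lemma measurable_rV A : measurable A = measurable (@rowT R n @^-1` A).
Proof. by []. Qed.

Lemma measurable_rowT : measurable_fun setT (@rowT R n).
Proof. by move=> _ A mA; rewrite setTI. Qed.

Definition Trow (x : 'rV[R]_n) : n.-tuple R := [tuple x 0 i | i < n].

Lemma TrowK : cancel Trow (@rowT R n).
Proof. by move=> x; apply/rowP => i; rewrite mxE tnth_mktuple. Qed.

Lemma rowTK : cancel (@rowT R n) Trow.
Proof. by move=> t; apply/eq_from_tnth => i; rewrite tnth_mktuple mxE. Qed.

Lemma measurable_Trow : measurable_fun setT Trow.
Proof.
move=> _ A mA; rewrite setTI measurable_rV -comp_preimage.
by rewrite (_ : Trow \o _ = id) //; apply/funext => t; exact: rowTK.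
Qed.

Lemma measurable_fun_rowT d (T : sigmaRingType d) A (f : 'rV[R]_n -> T) :
  measurable_fun A f <-> measurable_fun (@rowT R n @^-1` A) (f \o @rowT R n).
Proof. by split=> mf mA Y mY; exact: mf. Qed.

Lemma measurable_coord (i : 'I_n) :
  measurable_fun setT (fun x : 'rV[R]_n => x 0 i).
Proof.
apply/measurable_fun_rowT; rewrite preimage_setT.
rewrite (_ : _ \o _ = (@tnth n R)^~ i); first exact: measurable_tnth.
by apply/funext => t /=; rewrite mxE.
Qed.

Lemma measurable_fun_rV d (T : measurableType d) (f : T -> 'rV[R]_n) :
  (forall i, measurable_fun setT (fun x => f x 0 i)) -> measurable_fun setT f.
Proof.
move=> mf; rewrite (_ : f = @rowT R n \o (Trow \o f)); last first.
  by apply/funext => x /=; rewrite TrowK.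
apply: measurableT_comp; first exact: measurable_rowT.
apply/(@measurable_fun_tnthP _ _ T R) => i.
rewrite (_ : _ \o _ = fun x => f x 0 i) //.
by apply/funext => x /=; rewrite tnth_mktuple.
Qed.

End rV_measurable_theory.

(** * The measure behind the iterated integral *)

Section iint_measure.
Variable R : realType.
Local Open Scope ereal_scope.

Lemma measurable_cons_tuple m : measurable_fun setT
  (fun p : measurableTypeR R * m.-tuple R => cons_tuple p.1 p.2 : m.+1.-tuple R).
Proof.
apply: (@measurable_cons _ _ (measurableTypeR R * m.-tuple R)%type R fst m snd).
  exact: measurable_fst.
exact: measurable_snd.
Qed.

Lemma pushforward_measure_exists d1 d2 (T1 : measurableType d1)
    (T2 : measurableType d2) (mu : {measure set T1 -> \bar R})
    (f : T1 -> T2) (g : T2 -> T1) :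
  sigma_finite setT mu -> measurable_fun setT f -> measurable_fun setT g -> cancel f g ->
  exists nu : {sigma_finite_measure set T2 -> \bar R},
    forall h : T2 -> \bar R, measurable_fun setT h -> (forall y, 0 <= h y) ->
      \int[nu]_y h y = \int[mu]_x h (f x).
Proof.
move=> [F FT mF] mf mg fK.
pose nuM : {measure set T2 -> \bar R} :=
  measure_function_pushforward__canonical__measure_function_Measure mu mf.
have nusf : sigma_finite setT nuM.
  exists (fun k => g @^-1` F k).
    by rewrite -preimage_bigcup -FT preimage_setT.
  move=> k; have [mFk Fkoo] := mF k; split.
    by rewrite -[X in measurable X]setTI; exact: mg.
  rewrite /nuM /= /pushforward /= -comp_preimage (_ : g \o f = id) //.
  by apply/funext => x /=; rewrite fK.
pose nu : {sigma_finite_measure set T2 -> \bar R} :=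
  HB.pack (Measure.sort nuM) nuM (Measure_isSigmaFinite.Build _ _ _ _ nusf).
exists nu => h mh h0.
transitivity (\int[nuM]_y h y); first exact: eq_measure_integral.
by rewrite ge0_integral_pushforward// preimage_setT.
Qed.

Lemma sigma_finite_product d1 d2 (T1 : measurableType d1)
    (T2 : measurableType d2) (m1 : {sigma_finite_measure set T1 -> \bar R})
    (m2 : {sigma_finite_measure set T2 -> \bar R}) :
  sigma_finite setT (m1 \x m2).
Proof.
have [F FT Foo] := sigma_finiteT m1; have [G GT Goo] := sigma_finiteT m2.
pose H k := if unpickle k is Some p then F p.1 `*` G p.2 else set0.
exists H.
  apply/esym; rewrite -subTset => -[x y] _.
  have [i _ Fix] : (\bigcup_i F i) x by rewrite -FT.
  have [j _ Gjy] : (\bigcup_j G j) y by rewrite -GT.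
  by exists (pickle (i, j)) => //; rewrite /H pickleK.
move=> k; rewrite /H; case: unpickle => [[i j]|] /=; last by rewrite measure0.
have [mFi Fioo] := Foo i; have [mGj Gjoo] := Goo j.
split; first exact: measurableX.
by rewrite product_measure1E// lte_mul_pinfty// ge0_fin_numE.
Qed.

(** By induction: the measure in dimension [n + 1] is the image of Lebesgue measure times the
    previous one under [cons_tuple], and Tonelli identifies its integral with the iterated one. In
    dimension [0] it is the Dirac mass at the empty tuple. *)
Lemma iint_measure_exists n :
  exists mu : {sigma_finite_measure set (n.-tuple R) -> \bar R},
    forall f : n.-tuple R -> \bar R,
      measurable_fun setT f -> (forall t, 0 <= f t) ->
      \int[mu]_t f t = iint f.
Proof.
elim: n => [|n [mu muE]].
  exists (@dirac _ (0.-tuple R) [tuple] R) => f mf f0.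
  by rewrite integral_dirac//= diracT mul1e.
have [|||t|nu nuE] := @pushforward_measure_exists _ _ _ _
    (product_measure1 (@lebesgue_measure R) mu) (fun p => cons_tuple p.1 p.2 : n.+1.-tuple R)
  (fun t => (thead t, [tuple of behead t])).
- exact: sigma_finite_product.
- exact: measurable_cons_tuple.
- apply/measurable_fun_pair => /=; first exact: (@measurable_tnth _ R n.+1 ord0).
  exact: measurable_behead.
- case: t => x t; congr pair; rewrite /thead ?(tnth_nth x)//=.
  exact/val_inj.
exists nu => f mf f0; rewrite nuE// fubini_tonelli1//=; last first.
  by apply: measurableT_comp => //; exact: measurable_cons_tuple.
apply: eq_integral => x _; rewrite /fubini_F/= muE//.
apply: measurableT_comp => //.
exact: (@measurable_cons _ _ (n.-tuple R) R (cst x)).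
Qed.

End iint_measure.

Section Leb.
Variables (R : realType) (n : nat).
Local Open Scope ereal_scope.

Lemma Leb_exists : exists mu : {sigma_finite_measure set 'rV[R]_n -> \bar R},
  forall f : 'rV[R]_n -> \bar R, measurable_fun setT f -> (forall t, 0 <= f t) ->
    \int[mu]_t f t = iint (f \o @rowT R n).
Proof.
have [mu muE] := iint_measure_exists R n.
have [||||nu nuE] := @pushforward_measure_exists _ _ _ _ _ mu (@rowT R n) (@Trow R n).
- exact: sigma_finiteT.
- exact: measurable_rowT.
- exact: measurable_Trow.
- exact: rowTK.
by exists nu => f mf f0; rewrite nuE// muE.
Qed.

(* [iint] is a mere functional; [Leb] is the measure on row vectors that represents it. *)
Definition Leb := projT1 (cid Leb_exists).

Lemma LebE (f : 'rV[R]_n -> \bar R) : measurable_fun setT f ->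
  (forall t, 0 <= f t) -> \int[Leb]_t f t = iint (f \o @rowT R n).
Proof. by move=> mf f0; rewrite /Leb; case: cid => mu /= ->. Qed.

End Leb.

Section iint_theory.
Variable R : realType.
Local Open Scope ereal_scope.

(** Translation and reflection in one substitution, which is the one that convolution uses. The
    image of Lebesgue measure gives half-open intervals their length, and uniqueness of Lebesgue
    measure concludes. *)
Lemma integral_reflect (a : R) (f : R -> \bar R) :
  measurable_fun setT f -> (forall x, 0 <= f x) ->
  \int[@lebesgue_measure R]_x f (a - x)%R = \int[@lebesgue_measure R]_x f x.
Proof.
move=> mf f0; pose phi := (fun x => a - x)%R : R -> measurableTypeR R.
have mphi : measurable_fun setT phi by exact: measurable_funB.
transitivity (\int[pushforward (@lebesgue_measure R) phi]_x f x).
  by rewrite ge0_integral_pushforward// preimage_setT.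
apply: eq_measure_integral => A mA _; apply/esym/lebesgue_measure_unique => //= _ [[c d]] _ <-.
rewrite /pushforward (_ : phi @^-1` _ = `[(a - d)%R, (a - c)%R[%classic); last first.
  apply/seteqP; split => x /=; rewrite /phi !in_itv/=; first by move=> ?; lra.
  by move=> ?; lra.
rewrite !lebesgue_measure_itv/= !lte_fin ltrD2l ltrN2.
by case: ifPn => // _; rewrite -!EFinD; congr EFin; ring.
Qed.

Lemma measurable_iint_cons n (f : n.+1.-tuple R -> \bar R) :
  measurable_fun setT f -> (forall t, 0 <= f t) ->
  measurable_fun (setT : set (measurableTypeR R))
    (fun x => iint (fun t : n.-tuple R => f (cons_tuple x t))).
Proof.
move=> mf f0; have [mu muE] := iint_measure_exists R n.
pose g := fun p : measurableTypeR R * n.-tuple R => f (cons_tuple p.1 p.2).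
have mg : measurable_fun setT g.
  by apply: measurableT_comp => //; exact: measurable_cons_tuple.
rewrite (_ : (fun x => _) = fubini_F mu g); last first.
  apply/funext => x; rewrite /fubini_F muE//; last by move=> t; exact: f0.
  by apply: measurableT_comp mg _; exact: measurable_pair1.
by apply: measurable_fun_fubini_tonelli_F => // p; exact: f0.
Qed.

Lemma measurable_cons_tupler n (x : R) :
  measurable_fun setT (fun t : n.-tuple R => cons_tuple x t).
Proof. exact: (@measurable_cons _ _ (n.-tuple R) R (cst x)). Qed.

Lemma iint_reflect n (a : n.-tuple R) (f : n.-tuple R -> \bar R) :
  measurable_fun setT f -> (forall t, 0 <= f t) ->
  iint (fun t => f [tuple (tnth a i - tnth t i)%R | i < n]) = iint f.
Proof.
elim: n a f => [a f _ _|n IH a f mf f0]; first by congr f; apply/eq_from_tnth => -[].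
case/tupleP: a => a0 a /=.
rewrite -[RHS](integral_reflect a0)//; last 2 first.
- exact: measurable_iint_cons.
- move=> x; have [mu <-] := iint_measure_exists R n => //.
    exact: integral_ge0.
  by apply: measurableT_comp => //; exact: measurable_cons_tupler.
apply: eq_integral => x _.
rewrite -[RHS](IH a)//; last first.
  by apply: measurableT_comp => //; exact: measurable_cons_tupler.
congr iint; apply/funext => t; congr f; apply/eq_from_tnth => i.
rewrite tnth_mktuple.
by case: (unliftP ord0 i) => [j|] -> //; rewrite !tnthS tnth_mktuple.
Qed.

(** Serves twice: for the volume of a ball and for the normalisation of a product kernel. *)
Lemma iint_prod n (h : R -> R) (c : R) : measurable_fun setT h ->
  (forall x, 0 <= h x)%R -> \int[@lebesgue_measure R]_x (h x)%:E = c%:E ->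
  iint (fun t : n.-tuple R => (\prod_(i < n) h (tnth t i))%:E) = (c ^+ n)%:E.
Proof.
move=> mh h0 hc.
have mprod m : measurable_fun setT (fun t : m.-tuple R => (\prod_(i < m) h (tnth t i))%R).
  apply: measurable_prod => i _; apply: measurableT_comp => //; exact: measurable_tnth.
have mprodE m : measurable_fun setT
    (fun t : m.-tuple R => (\prod_(i < m) h (tnth t i))%:E).
  by apply/measurable_EFinP; exact: mprod.
elim: n => [|n IH] /=; first by rewrite big_ord0 expr0.
under eq_integral => x _.
  under [X in iint X]eq_fun => t.
    rewrite big_ord_recl EFinM.
    under eq_bigr => i _ do rewrite tnthS.
    over.
  over.
rewrite exprS EFinM -hc -ge0_integralZr//=; last 3 first.
- exact/measurable_EFinP.
- by move=> x _; rewrite lee_fin.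
- rewrite lee_fin exprn_ge0// -lee_fin -hc; apply: integral_ge0 => x _.
  by rewrite lee_fin.
apply: eq_integral => x _; have [mu muE] := iint_measure_exists R n.
rewrite -IH -!muE//.
- rewrite -ge0_integralZl//; last first.
  - by rewrite lee_fin.
  - by move=> t _; rewrite lee_fin prodr_ge0.
  - exact: mprodE.
- by move=> t; rewrite lee_fin prodr_ge0.
- exact: (measurable_funeM (h x)%:E (mprodE n)).
- by move=> t; rewrite mule_ge0// lee_fin// prodr_ge0.
Qed.

End iint_theory.

(** * Open sets, balls and their volume *)

Section rV_borel.
Variables (R : realType) (n : nat).
Implicit Types A U : set 'rV[R]_n.

Lemma ball_rVE (x y : 'rV[R]_n) (e : R) :
  ball x e y <-> 0 < e /\ forall i, `|x 0 i - y 0 i| < e.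
Proof.
split=> [[e0 xy]|[e0 xy]]; split=> //; first by move=> i; exact: xy.
by move=> i j; rewrite (ord1 i); exact: xy.
Qed.

Lemma measurable_ball_rV (x : 'rV[R]_n) (e : R) : measurable (ball x e).
Proof.
have [e0|e0] := ltP 0 e; last first.
  rewrite (_ : ball x e = set0); first exact: measurable0.
  by apply/seteqP; split => // y /ball_rVE[]; rewrite ltNge e0.
rewrite -[ball x e]setCK; apply: measurableC.
rewrite (_ : ~` _ = \bigcup_(i : 'I_n) ~` ((fun y : 'rV[R]_n => y 0 i) @^-1` ball (x 0 i) e)).
  apply: countable_bigcupT_measurable => [|i]; first exact: countableP.
  apply: measurableC; rewrite -[X in measurable X]setTI.
  by apply: measurable_coord => //; exact: measurable_ball.
rewrite -setC_bigcap; congr (~` _); apply/seteqP; split => y.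
  by move=> /ball_rVE[_ xy] i _; exact: xy.
by move=> xy; apply/ball_rVE; split => // i; exact: xy.
Qed.

Lemma measurable_open_rV U : open U -> measurable U.
Proof.
move=> oU.
(* Balls with rational centre and radius [1 / (k + 1)]; those that do not fit into [U] are replaced
   by the empty set, so that the union runs over a fixed countable type. *)
pose B (p : 'rV[rat]_n * nat) : set 'rV[R]_n :=
  let b := ball (map_mx ratr p.1 : 'rV[R]_n) p.2.+1%:R^-1 in
  if `[< b `<=` U >] then b else set0.
have -> : U = \bigcup_p B p.
  apply/seteqP; split => [x Ux|x [[q k] _]]; last first.
    by rewrite /B; case: ifPn => // /asboolP; exact.
  have /nbhs_ballP[e /= e0 xeU] : nbhs x U by exact: open_nbhs_nbhs.
  pose k := Num.trunc (e^-1 * 2).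
  have ke : k.+1%:R^-1 < e / 2.
    rewrite invf_plt ?posrE//; last by rewrite divr_gt0.
    by rewrite invf_div mulrC truncnS_gt.
  have /choice[q xq] : forall i, exists q : rat, `|x 0 i - ratr q| < k.+1%:R^-1 :> R.
    move=> i; have k0 : 0 < k.+1%:R^-1 :> R by rewrite invr_gt0.
    move: (k.+1%:R^-1) k0 => d d0.
    have [|q] := @rat_in_itvoo R (x 0 i - d) (x 0 i + d).
      by lra.
    by rewrite in_itv/= => /andP[xq qx]; exists q; rewrite ltr_distl; apply/andP; split; lra.
  exists (\row_i q i, k) => //; rewrite /B/=.
  have Bx : ball (map_mx ratr (\row_i q i) : 'rV[R]_n) k.+1%:R^-1 x.
    by apply/ball_rVE; split=> // i; rewrite !mxE distrC.
  rewrite asboolT// => y By; apply: xeU.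
  rewrite (splitr e); apply: ball_triangle; [apply: ball_sym|];
    by [apply: le_ball Bx; exact: ltW|apply: le_ball By; exact: ltW].
apply: countable_bigcupT_measurable; first exact: countableP.
by move=> p; rewrite /B; case: ifPn => // _; exact: measurable_ball_rV.
Qed.

Lemma measurable_closed_rV A : closed A -> measurable A.
Proof.
move=> cA; rewrite -[A]setCK; apply: (@measurableC _ 'rV[R]_n).
by apply: measurable_open_rV; exact: closed_openC.
Qed.

Lemma measurable_fun_openP d (T : measurableType d) (D : set T) (f : T -> R) :
  (forall U : set R, open U -> measurable (D `&` f @^-1` U)) -> measurable_fun D f.
Proof.
move=> oU; apply: (measurability _ (RGenOpens.measurableE R)).
by move=> _ [_ [a [b ->] <-]]; apply: oU; exact: interval_open.
Qed.

Lemma continuous_measurable_rV (f : 'rV[R]_n -> R) :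
  continuous f -> measurable_fun setT f.
Proof.
move=> /continuousP cf; apply: measurable_fun_openP => U oU.
by rewrite setTI; apply: measurable_open_rV; exact: cf.
Qed.

End rV_borel.

Section Leb_theory.
Variables (R : realType) (n : nat).
Local Open Scope ereal_scope.
Local Notation mu := (@Leb R n).

Lemma integral_Leb_reflect (a : 'rV[R]_n) (f : 'rV[R]_n -> \bar R) :
  measurable_fun setT f -> (forall x, 0 <= f x) ->
  \int[mu]_x f (a - x)%R = \int[mu]_x f x.
Proof.
move=> mf f0.
have ma : measurable_fun setT (fun x : 'rV[R]_n => (a - x)%R).
  apply: measurable_fun_rV => i; under eq_fun do rewrite !mxE.
  by apply: measurable_funB => //; exact: measurable_coord.
rewrite !LebE//; last by apply: measurableT_comp.
rewrite -[RHS](iint_reflect (Trow a))//; last by move=> t; exact: f0.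
congr iint; apply/funext => t /=; congr f; apply/rowP => i.
by rewrite !mxE !tnth_mktuple.
Qed.

(** For the maximum norm the ball is a cube, and its indicator a product of indicators of
    intervals. *)
Lemma Leb_ball (r : R) : (0 < r)%R -> mu (ball 0%R r) = ((2 * r) ^+ n)%:E.
Proof.
move=> r0; pose h := \1_(ball (0 : R)%R r) : R -> R.
have mh : measurable_fun setT h by exact: measurable_indic (measurable_ball _ _).
have hc : \int[@lebesgue_measure R]_x (h x)%:E = (2 * r)%:E.
  rewrite integral_indic//; last exact: measurable_ball.
  by rewrite setIT; rewrite mulr_natl; exact: lebesgue_measure_ball (ltW r0).
rewrite -(iint_prod n mh _ hc)// -[ball 0%R r]setIT.
rewrite -integral_indic//; last exact: measurable_ball_rV.
rewrite LebE//; last first.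
  by apply/measurable_EFinP; exact: measurable_indic (measurable_ball_rV _ _).
congr iint; apply/funext => t /=; congr EFin; rewrite /h indicE.
case: (boolP (rowT t \in _)) => tr.
  rewrite big1// => i _; rewrite indicE mem_set//.
  by move: tr; rewrite inE => /ball_rVE[_ /(_ i)]; rewrite !mxE.
apply/esym/eqP; rewrite prodf_seq_eq0; apply/hasP => /=.
move: tr; rewrite notin_setE => /ball_rVE.
move=> /not_andP[//|/existsNP[i tri]].
exists i; first by rewrite mem_index_enum.
rewrite indicE pnatr_eq0 eqb0 notin_setE /ball/=.
by move: tri; rewrite !mxE.
Qed.

Lemma Leb_bounded (A : set 'rV[R]_n) : bounded_set A -> measurable A -> mu A < +oo.
Proof.
move=> [M [Mr AM]] mA; pose r := (`|M| + 2)%R.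
apply: (@le_lt_trans _ _ (mu (ball 0%R r))).
  apply: le_measure; rewrite ?inE//; first exact: measurable_ball_rV.
  move=> x Ax; rewrite mx_norm_ball /ball_/= sub0r normrN.
  apply: (@le_lt_trans _ _ (`|M| + 1)%R); last by rewrite /r ltrD2l; lra.
  by apply: (AM (`|M| + 1)%R) => //; rewrite (le_lt_trans (ler_norm _))// ltrDl.
by rewrite Leb_ball ?ltry// ltr_wpDl.
Qed.

End Leb_theory.

(** * Real-valued integrals *)

Section real_integrable.
Context d (T : measurableType d) (R : realType) (mu : {measure set T -> \bar R}).
Implicit Types f g : T -> R.

(** Integrals are taken over the whole space from here on; an integral over [A] becomes that of the
    zero extension [f \_ A], so that convolution and Fubini apply without domains. *)
Definition intR f := mu.-integrable setT (EFin \o f).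

Lemma intR_measurable f : intR f -> measurable_fun setT f.
Proof. by move=> /measurable_int/measurable_EFinP. Qed.

Lemma EFin_Rintegral f : intR f -> (\int[mu]_x (f x)%:E = (\int[mu]_x f x)%:E)%E.
Proof. by move=> intf; rewrite fineK//; exact: integrable_fin_num. Qed.

Lemma intR_le f g : measurable_fun setT f -> (forall x, `|f x| <= `|g x|) ->
  intR g -> intR f.
Proof.
move=> mf fg; apply: le_integrable => //; first exact/measurable_EFinP.
by move=> x _ /=; rewrite lee_fin.
Qed.

Lemma intR0 : intR (fun=> 0).
Proof. exact: integrable0. Qed.

Lemma intRD f g : intR f -> intR g -> intR (fun x => f x + g x).
Proof. by move=> intf intg; exact: (integrableD measurableT intf intg). Qed.

Lemma intRB f g : intR f -> intR g -> intR (fun x => f x - g x).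
Proof. by move=> intf intg; exact: (integrableB measurableT intf intg). Qed.

Lemma intRZ (c : R) f : intR f -> intR (fun x => c * f x).
Proof. by move=> intf; exact: (integrableZl measurableT c intf). Qed.

Lemma intR_norm f : intR f -> intR (fun x => `|f x|).
Proof. by move=> intf; exact: (integrable_norm intf). Qed.

Lemma intR_sum (I : Type) (s : seq I) (P : pred I) (F : I -> T -> R) :
  (forall i, P i -> intR (F i)) -> intR (fun x => \sum_(i <- s | P i) F i x).
Proof.
move=> intF; elim: s => [|i s IH].
  by under eq_fun do rewrite big_nil; exact: intR0.
under eq_fun do rewrite big_cons.
by case: (boolP (P i)) => [Pi|_] //; exact: intRD (intF _ Pi) IH.
Qed.

Lemma Rintegral_sum (I : Type) (s : seq I) (P : pred I) (F : I -> T -> R) :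
  (forall i, P i -> intR (F i)) ->
  \int[mu]_x (\sum_(i <- s | P i) F i x) = \sum_(i <- s | P i) \int[mu]_x F i x.
Proof.
move=> intF; elim: s => [|i s IH].
  under eq_Rintegral do rewrite big_nil.
  by rewrite Rintegral_cst// mul0r big_nil.
under eq_Rintegral do rewrite big_cons.
rewrite big_cons; case: ifPn => [Pi|_] //.
by rewrite RintegralD// ?IH//; [exact: intF|exact: intR_sum].
Qed.

Lemma intR_bdM f g (M : R) : intR f -> measurable_fun setT g ->
  (forall x, `|g x| <= M) -> intR (fun x => f x * g x).
Proof.
move=> intf mg gM; have mf := intR_measurable intf.
apply: (@intR_le _ (fun x => M * f x)); last exact: intRZ.
- exact: measurable_funM.
- move=> x; rewrite !normrM mulrC ler_wpM2r//.
  by rewrite (le_trans (gM x))// ler_norm.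
Qed.

Lemma le_RintegralT f g : intR f -> intR g -> (forall x, f x <= g x) ->
  \int[mu]_x f x <= \int[mu]_x g x.
Proof. by move=> intf intg fg; apply: le_Rintegral. Qed.

Lemma Rintegral_dominated (f_ : nat -> T -> R) f g :
  (forall n, measurable_fun setT (f_ n)) -> measurable_fun setT f ->
  (forall x, f_ ^~ x @ \oo --> f x) -> intR g ->
  (forall n x, `|f_ n x| <= g x) ->
  intR f /\ \int[mu]_x f_ n x @[n --> \oo] --> \int[mu]_x f x.
Proof.
move=> mf_ mf f_f intg f_g.
have [|||||intf _ cvf] := @dominated_convergence _ _ _ mu setT measurableT
  (fun n x => (f_ n x)%:E) (fun x => (f x)%:E) (fun x => (g x)%:E).
- by move=> n; exact/measurable_EFinP.
- exact/measurable_EFinP.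
- by apply: aeW => x _; apply: cvg_EFin; [exact: nearW|exact: f_f].
- exact: intg.
- by apply: aeW => x n _; rewrite /= lee_fin.
split => //; apply: fine_cvg; rewrite fineK//; last exact: integrable_fin_num.
Qed.

End real_integrable.

(** Dominated convergence speaks of sequences; this turns its conclusion into continuity. A failure
    of continuity would be witnessed by one point in each ball of radius [1 / (k + 1)]. *)
Lemma rV_seq_continuous (R : realType) n (F : 'rV[R]_n -> R) (x : 'rV[R]_n) :
  (forall w : nat -> 'rV[R]_n, w @ \oo --> x -> F (w k) @[k --> \oo] --> F x) ->
  {for x, continuous F}.
Proof.
move=> seqF; apply/(@cvgrPdist_lt _ _ _ (nbhs x)) => e e0; apply: contrapT => nF.
have {}nF : forall k : nat, exists y, ball x k.+1%:R^-1 y /\ e <= `|F x - F y|.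
  move=> k; apply: contrapT => nk; apply: nF.
  apply/nbhs_ballP; exists k.+1%:R^-1; first by rewrite /= invr_gt0.
  move=> y xy; rewrite ltNge; apply/negP => Fe; apply: nk.
  by exists y.
have [w /all_and2[xw Fw]] := choice nF.
have /seqF/cvgrPdist_lt/(_ e e0)[N _ /(_ N (leqnn N))] : w @ \oo --> x.
  apply/cvg_ballP => eps eps0; near=> k.
  apply: le_ball (xw k); apply/ltW.
  by near: k; exact: near_infty_natSinv_lt (PosNum eps0).
by rewrite /= ltNge Fw.
Unshelve. all: by end_near. Qed.

(** * C1 functions and convolution *)

Section C1_theory.
Variables (R : realType) (n : nat).
Local Notation V := 'rV[R]_n.
Implicit Types f g k : V -> R.

Lemma C1_cont f : C1 f -> continuous f. Proof. by case. Qed.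
Lemma C1_deriv f i x : C1 f -> derivable f x (ev R i). Proof. by case=> _ []. Qed.
Lemma C1_partial_cont f i : C1 f -> continuous (partial i f).
Proof. by case=> _ []. Qed.

Lemma partial_cst (c : R) i (x : V) : partial i (fun=> c) x = 0.
Proof. by rewrite /partial derive_cst. Qed.

Lemma C1_cst (c : R) : C1 (fun _ : V => c).
Proof.
split; [exact: cst_continuous|split=> [i x|i]].
  exact: derivable_cst.
rewrite (_ : partial i _ = fun=> 0); first exact: cst_continuous.
by apply/funext => x; rewrite partial_cst.
Qed.

Lemma partialD f g i x : C1 f -> C1 g ->
  partial i (fun y => f y + g y) x = partial i f x + partial i g x.
Proof. by move=> f1 g1; rewrite /partial deriveD//; exact: C1_deriv. Qed.

Lemma C1D f g : C1 f -> C1 g -> C1 (fun x => f x + g x).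
Proof.
move=> f1 g1; split; [|split=> [i x|i]].
- have := C1_cont f1; have := C1_cont g1 => cg cf x.
  exact: (continuousD (cf x) (cg x)).
- by apply: derivableD; exact: C1_deriv.
- rewrite (_ : partial i _ = fun x => partial i f x + partial i g x).
    have := C1_partial_cont (i:=i) f1; have := C1_partial_cont (i:=i) g1 => cg cf x.
    exact: (continuousD (cf x) (cg x)).
  by apply/funext => x; rewrite partialD.
Qed.

Lemma partialM f g i x : C1 f -> C1 g ->
  partial i (fun y => f y * g y) x = f x * partial i g x + partial i f x * g x.
Proof.
move=> f1 g1; rewrite /partial deriveM//; try exact: C1_deriv.
by rewrite /GRing.scale/= (mulrC (g x)).
Qed.

Lemma C1M f g : C1 f -> C1 g -> C1 (fun x => f x * g x).
Proof.
move=> f1 g1; split; [|split=> [i x|i]].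
- have := C1_cont f1; have := C1_cont g1 => cg cf x.
  exact: (continuousM (cf x) (cg x)).
- by apply: derivableM; exact: C1_deriv.
- rewrite (_ : partial i _ = fun x => f x * partial i g x + partial i f x * g x).
    have := C1_cont f1; have := C1_cont g1 => cg cf.
    have := C1_partial_cont (i:=i) f1; have := C1_partial_cont (i:=i) g1 => dg df x.
    exact: (continuousD (continuousM (cf x) (dg x)) (continuousM (df x) (cg x))).
  by apply/funext => x; rewrite partialM.
Qed.

Lemma C1Z (c : R) f : C1 f -> C1 (fun x => c * f x).
Proof. by move=> f1; apply: C1M => //; exact: C1_cst. Qed.

Lemma partialZ (c : R) f i x : C1 f ->
  partial i (fun y => c * f y) x = c * partial i f x.
Proof.
by move=> f1; rewrite partialM ?partial_cst ?mul0r ?addr0//; exact: C1_cst.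
Qed.

Lemma C1B f g : C1 f -> C1 g -> C1 (fun x => f x - g x).
Proof.
move=> f1 g1; rewrite (_ : (fun x => _) = fun x => f x + -1 * g x).
  by apply: C1D => //; exact: C1Z.
by apply/funext => x; congr (_ + _); rewrite mulN1r.
Qed.

Lemma partialB f g i x : C1 f -> C1 g ->
  partial i (fun y => f y - g y) x = partial i f x - partial i g x.
Proof.
move=> f1 g1; rewrite (_ : (fun y => _) = fun y => f y + -1 * g y).
  by rewrite partialD ?partialZ ?mulN1r//; exact: C1Z.
by apply/funext => y; congr (_ + _); rewrite mulN1r.
Qed.

Lemma C1_sum (I : Type) (s : seq I) (F : I -> V -> R) :
  (forall i, C1 (F i)) -> C1 (fun x => \sum_(i <- s) F i x).
Proof.
move=> F1; elim: s => [|i s IH].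
  by under eq_fun do rewrite big_nil; exact: C1_cst.
by under eq_fun do rewrite big_cons; exact: C1D.
Qed.

Lemma partial_sum (I : Type) (s : seq I) (F : I -> V -> R) j x :
  (forall i, C1 (F i)) ->
  partial j (fun y => \sum_(i <- s) F i y) x = \sum_(i <- s) partial j (F i) x.
Proof.
move=> F1; elim: s => [|i s IH].
  by under eq_fun do rewrite big_nil; rewrite big_nil partial_cst.
under eq_fun do rewrite big_cons.
by rewrite big_cons partialD ?IH//; exact: C1_sum.
Qed.

(** Equivalent to compact support by [bsupp_csupp], but stable under products and convolution by a
    mere norm estimate. *)
Definition bsupp (W : zmodType) (f : V -> W) :=
  exists M : R, forall x, f x != 0 -> `|x| <= M.

Lemma closed_norm_le (M : R) : closed [set x : V | `|x| <= M].
Proof.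
rewrite (_ : [set _ | _] = (fun x : V => `|x|) @^-1` [set t | t <= M]) //.
apply: preimage_closed => [x _|]; last exact: closed_le.
exact: norm_continuous.
Qed.

Lemma compact_norm_le (M : R) : compact [set x : V | `|x| <= M].
Proof.
apply: bounded_closed_compact; last exact: closed_norm_le.
exists M; split; first exact: num_real.
by move=> r Mr x /= /le_trans; apply; exact: ltW.
Qed.

Lemma closure_supp_le (W : zmodType) (f : V -> W) (M : R) :
  (forall x, f x != 0 -> `|x| <= M) ->
  forall x, closure [set x | f x != 0] x -> `|x| <= M.
Proof.
move=> fM x; rewrite closureEbigcap => /(_ [set x | `|x| <= M]); apply.
by split; [exact: closed_norm_le|exact: fM].
Qed.

Lemma bsupp_csupp (W : zmodType) (f : V -> W) : csupp_in setT f <-> bsupp f.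
Proof.
split=> [[/compact_bounded[M [Mr bM]] _]|[M fM]].
  exists (M + 1) => x fx; apply: (bM (M + 1)); first by rewrite ltrDl.
  exact: subset_closure.
split => //; apply: (@subclosed_compact _ _ [set x : V | `|x| <= M]).
- exact: closed_closure.
- exact: compact_norm_le.
- exact: closure_supp_le.
Qed.

Lemma continuous_bsupp_bounded f : continuous f -> bsupp f ->
  exists M : R, forall x, `|f x| <= M.
Proof.
move=> cf [r fr].
have /compact_bounded[M [Mr bM]] : compact (f @` [set x : V | `|x| <= r]).
  apply: continuous_compact; last exact: compact_norm_le.
  exact: continuous_subspaceT.
exists (`|M| + 1) => x; have [->|/fr fxr] := eqVneq (f x) 0.
  by rewrite normr0 addr_ge0.
apply: (bM (`|M| + 1)); last by exists x.
by rewrite (le_lt_trans (ler_norm _))// ltrDl.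
Qed.

Lemma partial_supp f i x : partial i f x != 0 -> closure [set x | f x != 0] x.
Proof.
apply: contra_neqP => /= nfx; rewrite /partial.
rewrite -(partial_cst 0 i x) /partial; apply: near_eq_derive.
move: nfx; rewrite /closure /= => /existsNP[B /not_implyP[xB /set0P/negP/negPn/eqP fB]].
apply: filterS xB => y By; apply/eqP/negPn/negP => fy.
by move: fB; rewrite predeqE => /(_ y)[/(_ (conj fy By))].
Qed.

Lemma bsupp_partial f i : bsupp f -> bsupp (partial i f).
Proof. by move=> [M fM]; exists M => x /partial_supp; exact: closure_supp_le. Qed.

Definition Cc1 f := C1 f /\ bsupp f.

Lemma Cc1_bounded f : Cc1 f -> exists M : R, forall x, `|f x| <= M.
Proof. by move=> [f1 bf]; apply: continuous_bsupp_bounded => //; exact: C1_cont. Qed.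

Lemma Cc1_partial_bounded f i : Cc1 f -> exists M : R, forall x, `|partial i f x| <= M.
Proof.
move=> [f1 bf]; apply: continuous_bsupp_bounded; last exact: bsupp_partial.
exact: C1_partial_cont.
Qed.

Lemma bsuppM f g : bsupp f -> bsupp (fun x => f x * g x).
Proof. by move=> [M fM]; exists M => x; rewrite mulf_eq0 negb_or => /andP[/fM]. Qed.

Lemma Cc1M f g : Cc1 f -> C1 g -> Cc1 (fun x => f x * g x).
Proof. by move=> [f1 bf] g1; split; [exact: C1M|exact: bsuppM]. Qed.

Local Notation mu := (@Leb R n).
Local Notation intV f := (@intR _ _ _ mu f).

Lemma intV_bsupp f (M : R) : measurable_fun setT f -> bsupp f ->
  (forall x, `|f x| <= M) -> intV f.
Proof.
move=> mf [r fr] fM; pose B := [set x : V | `|x| <= r].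
have mB : measurable B by apply: measurable_closed_rV; exact: closed_norm_le.
have muB : (mu B < +oo)%E.
  apply: Leb_bounded => //; exists r; split; first exact: num_real.
  by move=> s rs x /= /le_trans; apply; exact: ltW.
have : mu.-integrable B (EFin \o f).
  apply: measurable_bounded_integrable => //; first exact: measurable_funTS.
  by exists M; split; [exact: num_real|move=> s Ms x _ /=; rewrite (le_trans (fM x))// ltW].
move/(integrable_mkcond _ mB).1; rewrite restrict_EFin /intR.
congr (mu.-integrable _ (EFin \o _)); apply/funext => x; rewrite patchE.
case: ifPn => // xB; apply/esym/eqP; apply: contraNT xB => /fr.
by rewrite inE.
Qed.

Lemma intV_Cc1 f : Cc1 f -> intV f.
Proof.
move=> f1; have [M fM] := Cc1_bounded f1; case: f1 => f1 bf.
by apply: intV_bsupp fM => //; apply: continuous_measurable_rV; exact: C1_cont.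
Qed.

Lemma intV_partial f i : Cc1 f -> intV (partial i f).
Proof.
move=> f1; have [M fM] := Cc1_partial_bounded i f1; case: f1 => f1 bf.
apply: intV_bsupp fM; last exact: bsupp_partial.
by apply: continuous_measurable_rV; exact: C1_partial_cont.
Qed.

End C1_theory.

(** * Convolution with even kernels *)

Section convolution.
Variables (R : realType) (n : nat).
Local Notation V := 'rV[R]_n.
Local Notation mu := (@Leb R n).
Local Notation intV f := (@intR _ _ _ mu f).
Implicit Types f g h k rho : V -> R.

Lemma measurable_subV (a : V) : measurable_fun setT (fun x : V => a - x).
Proof.
apply: measurable_fun_rV => i; under eq_fun do rewrite !mxE.
by apply: measurable_funB => //; exact: measurable_coord.
Qed.

Lemma measurable_subVV : measurable_fun setT (fun p : V * V => p.1 - p.2).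
Proof.
apply: measurable_fun_rV => i; under eq_fun do rewrite !mxE.
apply: measurable_funB.
  exact: (measurableT_comp (measurable_coord i) measurable_fst).
exact: (measurableT_comp (measurable_coord i) measurable_snd).
Qed.

Lemma measurable_reflect (a : V) f : measurable_fun setT f ->
  measurable_fun setT (fun y : V => f (a - y)).
Proof. by move=> mf; apply: measurableT_comp => //; exact: measurable_subV. Qed.

Lemma Rintegral_reflect (a : V) f : measurable_fun setT f ->
  \int[mu]_y f (a - y) = \int[mu]_y f y.
Proof.
move=> /measurable_EFinP mf; congr fine; rewrite integralE [RHS]integralE.
congr (_ - _)%E.
  rewrite -[RHS](integral_Leb_reflect a); last 2 first.
    exact: measurable_funepos.
    by move=> x; exact: funepos_ge0.
  by apply: eq_integral => x _; rewrite !funeposE.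
  rewrite -[RHS](integral_Leb_reflect a); last 2 first.
  exact: measurable_funeneg.
  by move=> x; exact: funeneg_ge0.
by apply: eq_integral => x _; rewrite !funenegE.
Qed.

Lemma intV_reflect (a : V) f : intV f -> intV (fun y : V => f (a - y)).
Proof.
move=> intf; have mf := intR_measurable intf.
move/integrableP : intf => [_ foo]; apply/integrableP; split.
  by apply/measurable_EFinP; exact: measurable_reflect.
move: foo; rewrite -(integral_Leb_reflect a)//.
by apply: measurableT_comp => //; exact/measurable_EFinP.
Qed.

Definition conv f k : V -> R := fun x => \int[mu]_y (f y * k (x - y)).

Lemma intV_conv f k (M : R) x : intV f -> measurable_fun setT k ->
  (forall y, `|k y| <= M) -> intV (fun y => f y * k (x - y)).
Proof. by move=> intf mk kM; apply: intR_bdM => //; exact: measurable_reflect. Qed.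

Lemma convC f k x : measurable_fun setT f -> measurable_fun setT k ->
  conv f k x = conv k f x.
Proof.
move=> mf mk; rewrite /conv -(Rintegral_reflect x); last first.
  by apply: measurable_funM => //; exact: measurable_reflect.
by apply: eq_Rintegral => y _; rewrite subKr mulrC.
Qed.

Lemma continuous_conv f k (M : R) : intV f -> continuous k ->
  (forall y, `|k y| <= M) -> continuous (conv f k).
Proof.
move=> intf ck kM x; apply: rV_seq_continuous => w wx.
have mk := continuous_measurable_rV ck; have mf := intR_measurable intf.
have mfk z : measurable_fun setT (fun y => f y * k (z - y)).
  by apply: measurable_funM => //; exact: measurable_reflect.
have [|||||//] := @Rintegral_dominated _ _ _ mu (fun j y => f y * k (w j - y))
  (fun y => f y * k (x - y)) (fun y => `|M| * `|f y|).
- by move=> j; exact: mfk.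
- exact: mfk.
- move=> y; apply: cvgM; first exact: cvg_cst.
  have wy : w j - y @[j --> \oo] --> x - y by apply: cvgB => //; exact: cvg_cst.
  exact: (cvg_comp _ _ wy (ck (x - y))).
- by apply: intRZ; exact: intR_norm.
- move=> j y; rewrite normrM mulrC ler_wpM2r//.
  by rewrite (le_trans (kM _))// ler_norm.
Qed.

(** Differentiation under the integral has a single real parameter, so directional derivatives are
    first read along a line. *)
Lemma derivable_line k (x v : V) (t : R) : derivable k (t *: v + x) v ->
  derivable (fun s : R => k (s *: v + x)) t 1 /\
  'D_1 (fun s : R => k (s *: v + x)) t = 'D_v k (t *: v + x).
Proof.
move=> dk.
have E : (fun h : R => h^-1 *: (k ((h *: (1 : R) + t) *: v + x) - k (t *: v + x))) =
    fun h : R => h^-1 *: (k (h *: v + (t *: v + x)) - k (t *: v + x)).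
  by apply/funext => h; rewrite addrA scalerDl /GRing.scale/= mulr1.
by split; [rewrite /derivable E|rewrite /derive E].
Qed.

(** The derivative falls on [k], so that [f] need only be integrable: along the line in direction
    [i] the derivative of the integrand is dominated by [N |f y|]. *)
Lemma derive_conv f k (M N : R) i x : intV f -> C1 k ->
  (forall y, `|k y| <= M) -> (forall y, `|partial i k y| <= N) ->
  derivable (conv f k) x (ev R i) /\
  partial i (conv f k) x = conv f (partial i k) x.
Proof.
move=> intf k1 kM kN; have mf := intR_measurable intf.
have mk : measurable_fun setT k by apply: continuous_measurable_rV; exact: C1_cont.
pose F (t : R) y := f y * k (t *: ev R i + x - y).
have dF t y : derivable (F ^~ y) t 1 /\
    'D_1 (F ^~ y) t = f y * partial i k (t *: ev R i + x - y).
  have := @derivable_line k (x - y) (ev R i) t; rewrite addrA.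
  move=> /(_ (C1_deriv k1)) [dk Dk].
  have -> : F ^~ y = fun s => f y * k (s *: ev R i + (x - y)).
    by apply/funext => s; rewrite /F addrA.
  pose l := (fun s : R => k (s *: ev R i + (x - y))) : R -> R^o.
  change (derivable (f y *: l) t 1 /\ 'D_1 (f y *: l) t =
    f y * partial i k (t *: ev R i + x - y)).
  by split; [exact: derivableZ|rewrite deriveZ// Dk].
have H : h^-1 *: (conv f k (h *: ev R i + x) - conv f k x) @[h --> 0^'] -->
    conv f (partial i k) x.
  have -> : conv f (partial i k) x = \int[mu]_y partial1of2 F 0 y.
    apply: eq_Rintegral => y _; rewrite partial1of2E.
    by have [_ ->] := dF 0 y; rewrite scale0r add0r.
  have -> : (fun h : R => h^-1 *: (conv f k (h *: ev R i + x) - conv f k x)) =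
      fun h : R => h^-1 *: (\int[mu]_y F (h + 0) y - \int[mu]_y F 0 y).
    by apply/funext => h; rewrite /F addr0 scale0r add0r.
  apply: (@cvg_differentiation_under_integral R _ _ mu F setT measurableT 0 (-1) 1
    _ _ _ (fun y => `|N| * `|f y|)) => //.
  - by rewrite /= in_itv/= ltrN10 ltr01.
  - by move=> t _; exact: (intV_conv _ intf mk kM).
  - by move=> t y _ _; have [] := dF t y.
  - by apply: intRZ; exact: intR_norm.
  - move=> t y _ _; rewrite partial1of2E; have [_ ->] := dF t y.
    by rewrite normrM mulrC ler_wpM2r// (le_trans (kN _))// ler_norm.
split; first by apply/cvg_ex; exists (conv f (partial i k) x).
exact/cvg_lim.
Qed.

Lemma C1_conv f k : intV f -> Cc1 k -> C1 (conv f k).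
Proof.
move=> intf k1; have [M kM] := Cc1_bounded k1.
have kN i := Cc1_partial_bounded i k1; have [k1' _] := k1.
split; [|split=> [i x|i]].
- by apply: continuous_conv kM => //; exact: C1_cont.
- by have [N iN] := kN i; have [] := derive_conv x intf k1' kM iN.
- have [N iN] := kN i.
  have -> : partial i (conv f k) = conv f (partial i k).
    by apply/funext => x; have [] := derive_conv x intf k1' kM iN.
  by apply: continuous_conv iN => //; exact: C1_partial_cont.
Qed.

Lemma partial_conv f k i x : intV f -> Cc1 k ->
  partial i (conv f k) x = conv f (partial i k) x.
Proof.
move=> intf k1; have [M kM] := Cc1_bounded k1.
have [N iN] := Cc1_partial_bounded i k1; case: k1 => k1 _.
by have [] := derive_conv x intf k1 kM iN.
Qed.

Lemma conv_supp f k x : conv f k x != 0 -> exists y, f y != 0 /\ k (x - y) != 0.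
Proof.
apply: contra_neqP => /forallNP fk; rewrite /conv.
under eq_Rintegral => y _.
  rewrite (_ : f y * k (x - y) = 0); last first.
    have [->|fy] := eqVneq (f y) 0; first by rewrite mul0r.
    by have [->|ky] := eqVneq (k (x - y)) 0; [rewrite mulr0|case: (fk y)].
  over.
by rewrite Rintegral_cst// mul0r.
Qed.

Lemma bsupp_conv f k : bsupp f -> bsupp k -> bsupp (conv f k).
Proof.
move=> [M fM] [N kN]; exists (M + N) => x /conv_supp[y [/fM yM /kN xyN]].
by rewrite -(subrK y x) addrC (le_trans (ler_normD _ _))// lerD.
Qed.

(** Domination by a product of integrable functions gives integrability on the product space by
    Tonelli, and also integrability of every single section, so that the real-valued inner integrals
    carry no default value. *)
Lemma Fubini_real (F : V * V -> R) a b :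
  measurable_fun setT F -> intV a -> intV b ->
  (forall x y, `|F (x, y)| <= `|a x| * `|b y|) ->
  \int[mu]_x \int[mu]_y F (x, y) = \int[mu]_y \int[mu]_x F (x, y).
Proof.
move=> mF inta intb Fab.
have ma := intR_measurable inta; have mb := intR_measurable intb.
have intF : (mu \x mu)%E.-integrable setT (EFin \o F).
  apply/integrable12ltyP; first exact/measurable_EFinP.
  apply: (@le_lt_trans _ _ (\int[mu]_x (`|a x| * \int[mu]_y `|b y|)%:E)%E).
    apply: ge0_le_integral => //.
    - by move=> x _; exact: integral_ge0.
    - apply: (@measurable_fun_fubini_tonelli_F _ _ _ _ _ mu (fun p => `|(F p)%:E|%E)) => //.
      by apply/measurableT_comp => //; exact/measurable_EFinP.
    - apply/measurable_EFinP; apply: measurable_funM => //.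
      exact: measurableT_comp.
    - move=> x _; rewrite EFinM -EFin_Rintegral; last exact: intR_norm.
      rewrite -ge0_integralZl//; last first.
        by apply/measurable_EFinP; exact: measurableT_comp.
      apply: ge0_le_integral => //.
      + apply/measurable_EFinP/measurableT_comp => //.
        exact: (measurableT_comp mF (measurable_pair1 x)).
      + apply: measurable_funeM; apply/measurable_EFinP; exact: measurableT_comp.
      + by move=> y _; rewrite lee_fin.
  apply: integrable_lty => //.
  under eq_fun do rewrite mulrC.
  by apply: intRZ; exact: intR_norm.
rewrite /Rintegral; congr fine.
have Fx x : intV (fun y => F (x, y)).
  apply: (@intR_le _ _ _ _ _ (fun y => a x * b y)); last exact: intRZ.
  - exact: (measurableT_comp mF (measurable_pair1 x)).
  - by move=> y; rewrite normrM.
have Fy y : intV (fun x => F (x, y)).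
  apply: (@intR_le _ _ _ _ _ (fun x => b y * a x)); last exact: intRZ.
  - exact: (measurableT_comp mF (measurable_pair2 y)).
  - by move=> x; rewrite mulrC normrM.
transitivity (\int[mu]_x \int[mu]_y (F (x, y))%:E)%E.
  by apply: eq_integral => x _; rewrite EFin_Rintegral.
rewrite (Fubini intF).
by apply: eq_integral => y _; rewrite EFin_Rintegral.
Qed.

(** Evenness is included because it makes convolution with [rho] self-adjoint. Only [C1] regularity
    is required; smooth kernels come from [kernel_exists]. *)
Definition kernel (e : R) rho := [/\ Cc1 rho, forall x, 0 <= rho x,
  forall x, rho (- x) = rho x, forall x, rho x != 0 -> `|x| < e &
  \int[mu]_x rho x = 1].

Section kernel_theory.
Variables (e : R) (rho : V -> R) (krho : kernel e rho).

Let rho1 : Cc1 rho. Proof. by case: krho. Qed.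
Let rho0 x : 0 <= rho x. Proof. by case: krho. Qed.
Let rhoN x : rho (- x) = rho x. Proof. by case: krho. Qed.
Let mrho : measurable_fun setT rho.
Proof. by apply: continuous_measurable_rV; case: rho1 => /C1_cont. Qed.

Lemma kernelB x y : rho (x - y) = rho (y - x). Proof. by rewrite -rhoN opprB. Qed.

Lemma kernel_int x : \int[mu]_y rho (x - y) = 1.
Proof. by rewrite Rintegral_reflect//; case: krho. Qed.

Lemma kernel_intV x : intV (fun y => rho (x - y)).
Proof. by apply: intV_reflect; exact: intV_Cc1. Qed.

Lemma kernel_supp f x : conv f rho x != 0 -> exists y, f y != 0 /\ `|x - y| < e.
Proof.
move=> /conv_supp[y [fy xy]]; exists y; split => //.
by case: krho => _ _ _ + _; exact.
Qed.

Lemma conv_le f (M : R) x : intV f -> (forall y, `|f y| <= M) -> `|conv f rho x| <= M.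
Proof.
move=> intf fM; have [N rhoN'] := Cc1_bounded rho1.
have int1 := intV_conv x intf mrho rhoN'.
apply: (le_trans (le_normr_Rintegral _ _)) => //.
rewrite -[leRHS]mulr1 -(kernel_int x) -RintegralZl//; last exact: kernel_intV.
apply: le_RintegralT => [||y]; [exact: intR_norm|exact/intRZ/kernel_intV|].
by rewrite normrM (ger0_norm (rho0 _)) ler_wpM2r.
Qed.

(** Fubini, and [rho (x - y) = rho (y - x)]. Every transfer of a mollification onto a test function
    goes through this identity. *)
Lemma conv_adjoint f h : intV f -> intV h ->
  \int[mu]_x (conv f rho x * h x) = \int[mu]_y (f y * conv h rho y).
Proof.
move=> intf inth; have [N rN] := Cc1_bounded rho1.
have mf := intR_measurable intf; have mh := intR_measurable inth.
transitivity (\int[mu]_x \int[mu]_y (f y * rho (x - y) * h x)).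
  apply: eq_Rintegral => x _; rewrite -RintegralZr//.
  exact: (intV_conv x intf mrho rN).
transitivity (\int[mu]_y \int[mu]_x (f y * rho (x - y) * h x)); last first.
  apply: eq_Rintegral => y _; rewrite -RintegralZl//; last first.
    exact: (intV_conv y inth mrho rN).
  by apply: eq_Rintegral => x _; rewrite kernelB -mulrA (mulrC (h x)).
apply: (@Fubini_real (fun p => f p.2 * rho (p.1 - p.2) * h p.1) (fun x => N * h x) f) => //.
- apply: measurable_funM; last exact: (measurableT_comp mh measurable_fst).
  apply: measurable_funM; first exact: (measurableT_comp mf measurable_snd).
  exact: (measurableT_comp mrho measurable_subVV).
- exact: intRZ.
- move=> x y /=; rewrite !normrM (mulrC `|f y|) mulrAC ler_wpM2r// ler_wpM2r//.
  by rewrite (le_trans (rN _))// ler_norm.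
Qed.

(** Tonelli for [|f y| rho (x - y)], the kernel having mass one in either variable. *)
Lemma conv_L1 f : intV f -> intV (conv f rho) /\
  \int[mu]_x `|conv f rho x| <= \int[mu]_x `|f x|.
Proof.
move=> intf; have [N rN] := Cc1_bounded rho1.
have mf := intR_measurable intf.
have mc : measurable_fun setT (conv f rho).
  by apply: continuous_measurable_rV; apply: C1_cont; exact: C1_conv.
pose g := fun p : V * V => (`|f p.2| * rho (p.1 - p.2))%:E.
have mg : measurable_fun setT g.
  apply/measurable_EFinP; apply: measurable_funM.
    by apply: measurableT_comp => //; exact: (measurableT_comp mf measurable_snd).
  exact: (measurableT_comp mrho measurable_subVV).
have g0 p : (0 <= g p)%E by rewrite lee_fin mulr_ge0.
have le1 : (\int[mu]_x `|conv f rho x|%:E <= (\int[mu]_x `|f x|)%:E)%E.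
  rewrite -EFin_Rintegral; last exact: intR_norm.
  apply: (@le_trans _ _ (\int[mu]_x \int[mu]_y g (x, y))%E).
    apply: ge0_le_integral => //.
    - by apply/measurable_EFinP; exact: measurableT_comp.
    - exact: measurable_fun_fubini_tonelli_F.
    - move=> x _; rewrite /g/= EFin_Rintegral ?lee_fin; last first.
        by apply: (intV_conv x _ mrho rN); exact: intR_norm.
      apply: (le_trans (le_normr_Rintegral _ _)) => //.
        exact: (intV_conv x intf mrho rN).
      by under eq_Rintegral do rewrite normrM (ger0_norm (rho0 _)).
  rewrite (@fubini_tonelli _ _ _ _ _ mu mu g mg g0)/=; apply: ge0_le_integral => //.
  - by move=> y _; exact: integral_ge0.
  - exact: measurable_fun_fubini_tonelli_G.
  - by apply/measurable_EFinP; exact: measurableT_comp.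
  - move=> y _; rewrite /fubini_G/g/=.
    under eq_integral do rewrite kernelB EFinM.
    rewrite ge0_integralZl//.
    - rewrite EFin_Rintegral; last exact: kernel_intV.
      by rewrite kernel_int mule1.
    - by apply/measurable_EFinP; exact: measurable_reflect.
    - by move=> x _; rewrite lee_fin.
have intc : intV (conv f rho).
  apply/integrableP; split; first exact/measurable_EFinP.
  by apply: le_lt_trans le1 _; rewrite ltry.
split => //; rewrite -lee_fin -EFin_Rintegral//; exact: intR_norm.
Qed.

End kernel_theory.

End convolution.

(** * Smooth bumps and existence of kernels *)

Lemma is_derive_quadratic (R : realType) (F : R -> R) (a C : R) :
  (forall s, `|F s| <= C * (s - a) ^+ 2) -> is_derive a 1 F 0.
Proof.
move=> FC; have Fa : F a = 0.
  by apply/eqP; rewrite -normr_le0 (le_trans (FC a))// subrr expr0n/= mulr0.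
have cv : h^-1 *: (F (h *: 1 + a) - F a) @[h --> 0^'] --> (0 : R).
  apply/cvgrPdist_le => eps eps0.
  have C0 : 0 < `|C| + 1 by rewrite ltr_wpDl.
  exists (eps / (`|C| + 1)); first by rewrite /= divr_gt0.
  move=> h /=; rewrite sub0r normrN => he h0.
  rewrite Fa subr0 sub0r normrN normrM normfV.
  rewrite ler_pdivrMl ?normr_gt0//; apply: (le_trans (FC _)).
  rewrite addrK /GRing.scale/= mulr1 -real_normK ?num_real// expr2 mulrA mulrC.
  rewrite ler_wpM2l// -ler_pdivlMr ?normr_gt0//.
  have hn : 0 < `|h| by rewrite normr_gt0.
  rewrite ler_pdivlMr//; move: he; rewrite ltr_pdivlMr// => /ltW; apply: le_trans.
  by rewrite mulrC ler_wpM2l// (le_trans (ler_norm C))// lerDl.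
split; first by apply/cvg_ex; exists 0.
exact/cvg_lim.
Qed.

Section bump.
Variables (R : realType) (e : R).
Hypothesis e0 : 0 < e.
Implicit Types (p : {poly R}) (m : nat) (t : R).

Let Q : {poly R} := (e ^+ 2)%:P - 'X^2.

Let QE t : Q.[t] = e ^+ 2 - t ^+ 2.
Proof. by rewrite /Q !hornerE. Qed.

Let Q_gt0 t : `|t| < e -> 0 < Q.[t].
Proof.
by move=> te; rewrite QE subr_gt0 -(real_normK (num_real t)) ltr_sqr ?nnegrE// ltW.
Qed.

(* With [p = 1], [m = 0] this is the classical bump; the family is stable under
   differentiation, [bump' p m] being the numerator of the derivative. *)
Definition bump p m t : R :=
  if `|t| < e then p.[t] * Q.[t]^-1 ^+ m * expR (- Q.[t]^-1) else 0.

Definition bump' p m : {poly R} :=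
  p^`() * Q ^+ 2 + 'X *+ 2 * p * Q *+ m - 'X *+ 2 * p.

(* Quadratic decay at the two endpoints, where the derivative is then zero. *)
Lemma bump_le p m : exists C : R, forall t,
  `|bump p m t| <= C * (t - e) ^+ 2 /\ `|bump p m t| <= C * (t + e) ^+ 2.
Proof.
have [M pM] : exists M : R, forall t, `|t| < e -> `|p.[t]| <= M.
  have cp : compact (horner p @` `[(- e), e]).
    apply: continuous_compact; last exact: segment_compact.
    by apply: continuous_subspaceT => x; exact: continuous_horner.
  have [M [Mr bM]] := compact_bounded cp.
  exists (`|M| + 1) => t te; apply: (bM (`|M| + 1)).
    by rewrite (le_lt_trans (ler_norm _))// ltrDl.
  by exists t => //; rewrite /= in_itv/= -ler_norml ltW.
have M0 : 0 <= M by rewrite (le_trans _ (pM 0 _))// normr0.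
exists (M * (m.+2)`!%:R * (2 * e) ^+ 2) => t; rewrite /bump.
case: ifPn => te; last first.
  by rewrite normr0; split; rewrite mulr_ge0 ?sqr_ge0// mulr_ge0 ?sqr_ge0// mulr_ge0.
have q0 := Q_gt0 te; set q := Q.[t] in q0 *.
(* From [r^(m+2) / (m+2)! <= expR r] at [r = 1 / q] one gets [q^(-m) expR (- 1 / q) <= (m+2)! q^2].
   Then [q = (e - t)(e + t)], and whichever factor is not kept is at most [2 e]. *)
suff H : `|p.[t] * q^-1 ^+ m * expR (- q^-1)| <= M * (m.+2)`!%:R * q ^+ 2.
  have qE : q = (e - t) * (e + t) by rewrite /q QE; ring.
  move: te; rewrite ltr_norml => /andP[et te].
  split; apply: (le_trans H); rewrite -[leRHS]mulrA ler_wpM2l ?mulr_ge0// qE exprMn.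
    rewrite mulrC -(sqrrN (t - e)) opprB ler_wpM2r ?sqr_ge0// ler_sqr ?nnegrE; lra.
  rewrite (addrC t) ler_wpM2r ?sqr_ge0// ler_sqr ?nnegrE; lra.
set r := q^-1; have r0 : 0 < r by rewrite invr_gt0.
rewrite -!mulrA normrM ler_pM// ?pM//.
rewrite ger0_norm; last by rewrite mulr_ge0 ?expR_ge0// exprn_ge0// ltW.
rewrite expRN ler_pdivrMr ?expR_gt0//.
have -> : (m.+2)`!%:R * q ^+ 2 * expR r = (m.+2)`!%:R * expR r / r ^+ 2.
  by rewrite -exprVn invrK mulrAC.
rewrite ler_pdivlMr ?exprn_gt0//.
rewrite -exprD addn2 mulrC -ler_pdivrMr ?ltr0n ?fact_gt0//.
by apply: le_trans (expR_ge1Dxn m.+1 (ltW r0)); rewrite lerDr.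
Qed.

(** Three regimes: inside, the chain rule with [v = 1 / Q] and [v' = 2 t v^2], which raises the
    exponent by two; outside, the function is locally zero; at the two endpoints, the quadratic
    decay of [bump_le]. *)
Lemma bump_derive p m t : is_derive t 1 (bump p m) (bump (bump' p m) m.+2 t).
Proof.
have [te|te] := ltP `|t| e.
  have q0 := Q_gt0 te.
  pose v : R -> R := fun s => (Q.[s])^-1.
  have Dv : is_derive t (1 : R) v (t *+ 2 * v t ^+ 2).
    have DQ := is_derive_poly Q t.
    apply: (is_derive_eq (is_deriveV (lt0r_neq0 q0) DQ)).
    have -> : Q^`() = - ('X *+ 2) by rewrite /Q derivB derivC derivXn sub0r.
    by rewrite hornerN hornerMn hornerX /v -exprVn /GRing.scale/=; ring.
  have DE : is_derive t (1 : R) (fun s => expR (- v s)) (- (t *+ 2 * v t ^+ 2) * expR (- v t)).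
    apply: (is_derive_eq (is_derive1_comp (is_derive_expR _) (is_deriveN Dv))).
    by rewrite mulrC.
  pose G : R -> R := fun s => p.[s] * v s ^+ m * expR (- v s).
  have DG : is_derive t (1 : R) G (bump (bump' p m) m.+2 t).
    have Dp := is_derive_poly p t.
    have DX : is_derive t (1 : R) (fun s => v s ^+ m)
        ((m%:R * v t ^+ m.-1) * (t *+ 2 * v t ^+ 2)).
      rewrite (_ : (fun s => _) = v ^+ m); first exact: is_deriveX.
      by apply/funext => s; rewrite exprfctE.
    apply: (is_derive_eq (is_deriveM (is_deriveM Dp DX) DE)).
    have bE : (bump' p m).[t] =
        p^`().[t] * Q.[t] ^+ 2 + t *+ 2 * p.[t] * Q.[t] *+ m - t *+ 2 * p.[t].
      rewrite /bump' hornerD hornerN hornerD hornerM horner_exp hornerMn.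
      by rewrite !hornerM hornerMn hornerX.
    transitivity (p.[t] * v t ^+ m * (- (t *+ 2 * v t ^+ 2) * expR (- v t)) +
      expR (- v t) * (p.[t] * (m%:R * v t ^+ m.-1 * (t *+ 2 * v t ^+ 2)) +
      v t ^+ m * p^`().[t])) => //.
    rewrite /bump te bE -/(v t).
    (* For [m = 0] the truncated exponent [m.-1] does no harm, since both sides carry the factor
       [m%:R]. *)
    have vm : m%:R * v t ^+ m.-1 * v t = m%:R * v t ^+ m.
      by case: m {DX G bE} => [|m]; rewrite ?mul0r// -mulrA -exprSr.
    have Qv : Q.[t] * v t = 1 by rewrite /v mulfV// lt0r_neq0.
    move: vm Qv; rewrite -(addn2 m) exprD.
    move: (v t) (v t ^+ m) (v t ^+ m.-1) Q.[t] p.[t] p^`().[t] (expR _) => w A B q P P' E vm Qv.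
    transitivity (P' * (q * w) ^+ 2 * A * E + t *+ 2 * P * (q * w) * (m%:R * A) * w * E
      - t *+ 2 * P * w ^+ 2 * A * E).
      by rewrite -vm Qv; ring.
    by rewrite -(mulr_natl _ m); ring.
  apply: near_eq_is_derive DG.
  have : t \in `](- e), e[ by rewrite in_itv/= -ltr_norml.
  move/near_in_itvoo; apply: filterS => s; rewrite in_itv/= -ltr_norml => se.
  by rewrite /bump se.
have -> : bump (bump' p m) m.+2 t = 0 by rewrite /bump ltNge te.
have [C bC] := bump_le p m.
have [tE|tNe] := eqVneq `|t| e.
  have [t0|t0] := leP 0 t.
    apply: (@is_derive_quadratic _ _ _ C) => s.
      have <- : e = t by rewrite -tE ger0_norm.
    by have [] := bC s.
  apply: (@is_derive_quadratic _ _ _ C) => s.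
  have -> : t = - e by rewrite -tE ltr0_norm// opprK.
  by rewrite opprK; have [] := bC s.
have {te tNe} te : e < `|t| by rewrite lt_neqAle eq_sym tNe.
apply: (near_eq_is_derive _ (is_derive_cst 0 t 1)).
have : nbhs t [set s | e < `|s|].
  apply: open_nbhs_nbhs; split => //.
  apply: (@open_comp _ _ (fun s : R => `|s|) [set s | e < s]); last exact: open_gt.
  by move=> x _; exact: norm_continuous.
apply: filterS => s /= es; by rewrite /bump ltNge (ltW es).
Qed.

Lemma continuous_bump p m : continuous (bump p m).
Proof.
move=> t; apply: differentiable_continuous; apply/derivable1_diffP.
by have [] := bump_derive p m t.
Qed.

Lemma bump_supp p m t : bump p m t != 0 -> `|t| < e.
Proof. by rewrite /bump; case: ifPn => // _; rewrite eqxx. Qed.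

Lemma bump1_ge0 t : 0 <= bump 1 0 t.
Proof.
rewrite /bump; case: ifPn => // _.
by rewrite hornerC expr0 !mul1r expR_ge0.
Qed.

Lemma bump1N t : bump 1 0 (- t) = bump 1 0 t.
Proof. by rewrite /bump normrN !hornerC !QE sqrrN. Qed.

Lemma bump1_le1 t : bump 1 0 t <= 1.
Proof.
rewrite /bump; case: ifPn => // te; rewrite hornerC expr0 !mul1r.
by rewrite -expR0 ler_expR lerNl oppr0 invr_ge0 ltW// Q_gt0.
Qed.

Lemma bump1_integral : exists c : R,
  0 < c /\ (\int[@lebesgue_measure R]_t (bump 1 0 t)%:E = c%:E)%E.
Proof.
have mb : measurable_fun setT (bump 1 0).
  by apply: continuous_measurable_fun; exact: continuous_bump.
have mbe : measurable_fun (setT : set (measurableTypeR R)) (fun t => (bump 1 0 t)%:E).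
  exact/measurable_EFinP.
pose I := (\int[@lebesgue_measure R]_t (bump 1 0 t)%:E)%E.
have Iub : (I < +oo)%E.
  apply: (@le_lt_trans _ _ (\int[@lebesgue_measure R]_t (\1_(ball (0 : R) e) t)%:E)%E).
    apply: ge0_le_integral => //.
    - by move=> t _; rewrite lee_fin bump1_ge0.
    - by apply/measurable_EFinP; exact: measurable_indic (measurable_ball _ _).
    - move=> t _; rewrite lee_fin indicE; have [bt|/bump_supp te] := eqVneq (bump 1 0 t) 0.
        by rewrite bt.
      by rewrite mem_set ?bump1_le1// /ball/= sub0r normrN.
  rewrite integral_indic//; last exact: measurable_ball.
  rewrite setIT; apply: le_lt_trans (ltry (e *+ 2)).
  rewrite le_eqVlt; apply/orP; left; apply/eqP.
  exact: lebesgue_measure_ball (ltW e0).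
(* [d] is the value of the bump at [e / 2] and a lower bound for it on the ball of half the radius;
   this makes the integral positive, hence usable as a normalising constant. *)
pose d := expR (- (e ^+ 2 - (e / 2) ^+ 2)^-1).
have Ilb : ((d * (e / 2 *+ 2))%:E <= I)%E.
  have e20 : 0 < e / 2 by rewrite divr_gt0.
  have <- : (\int[@lebesgue_measure R]_t (d%:E * (\1_(ball (0 : R) (e / 2)) t)%:E) =
      (d * (e / 2 *+ 2))%:E)%E.
    rewrite ge0_integralZl//; last 2 first.
    - by apply/measurable_EFinP; exact: measurable_indic (measurable_ball _ _).
    - by rewrite lee_fin expR_ge0.
    rewrite integral_indic//; last exact: measurable_ball.
    rewrite setIT EFinM; congr (_ * _)%E.
    exact: lebesgue_measure_ball (ltW e20).
  apply: ge0_le_integral => //.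
  - by move=> t _; rewrite mule_ge0// lee_fin expR_ge0.
  - apply: measurable_funeM; apply/measurable_EFinP.
    exact: measurable_indic (measurable_ball _ _).
  - move=> t _; rewrite -EFinM lee_fin indicE.
    case: (boolP (t \in _)) => [|_]; last by rewrite mulr0 bump1_ge0.
    rewrite inE /ball/= sub0r normrN mulr1 => te2.
    have te : `|t| < e by rewrite (lt_trans te2)// ltr_pdivrMr// ltr_pMr// ltr1n.
    have q0 := Q_gt0 te.
    rewrite /bump te hornerC expr0 !mul1r ler_expR lerN2 QE.
    rewrite lef_pV2 ?posrE//; last 2 first.
    - by rewrite -QE.
    - by rewrite subr_gt0 ltr_sqr ?nnegrE ?ltW// ltr_pdivrMr// ltr_pMr// ltr1n.
    rewrite lerD2l lerN2 -(real_normK (num_real t)) ler_sqr ?nnegrE//; exact: ltW.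
have Ifin : I \is a fin_num.
  by rewrite ge0_fin_numE//; apply: integral_ge0 => t _; rewrite lee_fin bump1_ge0.
exists (fine I); split; last by rewrite fineK.
rewrite -lte_fin fineK//; apply: lt_le_trans Ilb.
by rewrite lte_fin mulr_gt0 ?expR_gt0// mulrn_wgt0// divr_gt0.
Qed.

End bump.

Section smooth_product.
Variables (R : realType) (n : nat).
Local Notation V := 'rV[R]_n.

Definition prodV (h : 'I_n -> R -> R) : V -> R := fun x => \prod_j h j (x 0 j).

Lemma continuous_prodV h : (forall j, continuous (h j)) -> continuous (prodV h).
Proof.
move=> ch; rewrite /prodV; elim: (index_enum _) => [|j s IH].
  by under eq_fun do rewrite big_nil; exact: cst_continuous.
under eq_fun do rewrite big_cons.
have chj : continuous (fun x : V => h j (x 0 j)).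
  by move=> x; apply: (continuous_comp (@coord_continuous _ _ _ 0 j x)); exact: ch.
by move=> x; exact: (continuousM (chj x) (IH x)).
Qed.

(** Along [ev i] only the factor with index [i] moves; the product [c] of the others is constant. *)
Lemma derive_prodV (h : 'I_n -> R -> R) (i : 'I_n) (x : V) :
  derivable (h i) (x 0 i) 1 ->
  derivable (prodV h) x (ev R i) /\
  partial i (prodV h) x = prodV (fun j => if j == i then (h i)^`()%classic else h j) x.
Proof.
move=> dh; pose c := \prod_(j | j != i) h j (x 0 j).
have E (t : R) : prodV h (t *: ev R i + x) = h i (t *: 1 + x 0 i) * c.
  rewrite /prodV (bigD1 i)//= !mxE !eqxx mulr1 /GRing.scale/= mulr1; congr (_ * _).
  by apply: eq_bigr => j ji; rewrite !mxE (negbTE ji) andbF mulr0 add0r.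
have E0 : prodV h x = h i (x 0 i) * c.
  by have := E 0; rewrite !scale0r !add0r.
have cv : t^-1 *: (prodV h (t *: ev R i + x) - prodV h x) @[t --> 0^'] -->
    (h i)^`()%classic (x 0 i) * c.
  have -> : (fun t : R => t^-1 *: (prodV h (t *: ev R i + x) - prodV h x)) =
      fun t => (t^-1 *: (h i (t *: 1 + x 0 i) - h i (x 0 i))) * c.
    by apply/funext => t; rewrite E E0 -mulrBl scalerAl.
  by apply: cvgMl; rewrite derive1E; exact: dh.
have -> : prodV (fun j => if j == i then (h i)^`()%classic else h j) x =
    (h i)^`()%classic (x 0 i) * c.
  rewrite /prodV (bigD1 i)//= eqxx; congr (_ * _).
  by apply: eq_bigr => j ji; rewrite (negbTE ji).
split; first by apply/cvg_ex; eexists; exact: cv.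
exact/cvg_lim.
Qed.

(** A partial derivative differentiates one factor and keeps the others, so products with factors in
    a class closed under differentiation are again such products. Smoothness then follows for all
    orders at once. *)
Lemma smooth_prodV (Q : set (R -> R)) :
  (forall h, Q h -> (forall t, derivable h t 1) /\ Q h^`()%classic) ->
  forall h : 'I_n -> R -> R, (forall j, Q (h j)) -> smooth (prodV h).
Proof.
move=> Qd; have Qc h : Q h -> continuous h.
  by move=> /Qd[dh _] t; apply/differentiable_continuous/derivable1_diffP.
have ip l h : (forall j, Q (h j)) -> exists2 h', (forall j, Q (h' j)) &
    iter_partial l (prodV h) = prodV h'.
  move=> Qh; elim: l => [|i l [h' Qh' E]]; first by exists h.
  exists (fun j => if j == i then (h' i)^`()%classic else h' j).
    by move=> j; case: ifPn => // _; have [] := Qd _ (Qh' i).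
  rewrite /= -/(iter_partial l _) E; apply/funext => x.
  by have [] := @derive_prodV h' i x; [have [] := Qd _ (Qh' i)|].
move=> h Qh l; have [h' Qh' ->] := ip l h Qh; split.
  by apply: continuous_prodV => j; exact: Qc.
move=> i x; have [] := @derive_prodV h' i x => //.
by have [] := Qd _ (Qh' i).
Qed.

Lemma smooth_C1 (f : V -> R) : smooth f -> C1 f.
Proof.
move=> sf; split; [by have [] := sf [::]|split=> [i x|i]].
  by have [_] := sf [::]; exact.
by have [] := sf [:: i].
Qed.

End smooth_product.

Section kernel_exists.
Variables (R : realType) (n : nat).
Local Notation V := 'rV[R]_n.
Local Notation mu := (@Leb R n).

Lemma norm_rV_lt (x : V) (e : R) : 0 < e -> (forall i, `|x 0 i| < e) -> `|x| < e.
Proof.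
move=> e0 xe; have : ball (0 : V) e x.
  by apply/ball_rVE; split => // i; rewrite mxE sub0r normrN.
by rewrite mx_norm_ball /ball_/= sub0r normrN.
Qed.

Lemma smoothZ (c : R) (f : V -> R) : smooth f -> smooth (fun x => c * f x).
Proof.
move=> sf; have E l : iter_partial l (fun x => c * f x) =
    fun x => c * iter_partial l f x.
  elim: l => // i l IH; rewrite /= -!/(iter_partial l _) IH.
  apply/funext => x; rewrite /partial; have [_ dl] := sf l.
  exact: (deriveZ c (dl i x)).
move=> l; rewrite E; have [cl dl] := sf l; split.
  by move=> x; have cc := @cst_continuous V R c x; exact: (continuousM cc (cl x)).
by move=> i x; exact: (derivableZ (dl i x)).
Qed.

(** A product of one-dimensional bumps fits both the iterated integral, which factors into [c ^+ n],
    and the maximum norm, whose balls are products of intervals. *)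
Lemma kernel_exists (e : R) : 0 < e ->
  exists rho : V -> R, smooth rho /\ kernel e rho.
Proof.
move=> e0; have [c [c0 bc]] := bump1_integral e0.
pose h (j : 'I_n) := bump e 1 0.
pose rho : V -> R := fun x => (c ^+ n)^-1 * prodV h x.
have srho : smooth rho.
  apply: smoothZ; apply: (@smooth_prodV _ _ [set g | exists p m, g = bump e p m]).
    move=> _ [p [m ->]]; split=> [t|]; first by have [] := bump_derive e0 p m t.
    exists (bump' e p m), m.+2; apply/funext => t; rewrite derive1E.
    by have [_ ->] := bump_derive e0 p m t.
  by move=> j; exists 1, 0%N.
have h0 (x : V) : 0 <= prodV h x by apply: prodr_ge0 => j _; exact: bump1_ge0.
have rhosupp x : rho x != 0 -> `|x| < e.
  rewrite mulf_eq0 negb_or => /andP[_]; rewrite /prodV prodf_seq_neq0 => /allP hx.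
  apply: norm_rV_lt => // i; apply: (@bump_supp _ e 1 0).
  by have := hx i; rewrite mem_index_enum => /(_ isT).
exists rho; split => //; split.
- split; first exact: smooth_C1.
  by exists e => x /rhosupp/ltW.
- by move=> x; rewrite mulr_ge0// invr_ge0 exprn_ge0// ltW.
- move=> x; rewrite /rho /prodV; congr (_ * _); apply: eq_bigr => j _.
  by rewrite mxE /h bump1N.
- exact: rhosupp.
- have mh : measurable_fun setT (prodV h).
    apply: continuous_measurable_rV; apply: continuous_prodV => j.
    exact: continuous_bump.
  rewrite /Rintegral; under eq_integral do rewrite EFinM.
  rewrite ge0_integralZl//; last 3 first.
  + exact/measurable_EFinP.
  + by move=> x _; rewrite lee_fin.
  + by rewrite lee_fin invr_ge0 exprn_ge0// ltW.
  rewrite LebE; last 2 first.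
  + exact/measurable_EFinP.
  + by move=> x; rewrite lee_fin.
  rewrite (_ : _ \o _ = fun t => (\prod_(i < n) bump e 1 0 (tnth t i))%:E); last first.
    by apply/funext => t /=; congr EFin; apply: eq_bigr => i _; rewrite mxE.
  rewrite (@iint_prod _ _ _ c)//=.
  + by rewrite mulVf// expf_neq0// lt0r_neq0.
  + by apply: continuous_measurable_fun; exact: continuous_bump.
  + by move=> t; exact: bump1_ge0.
Qed.

End kernel_exists.

(** * Mollification in L1 *)

Section mollification_L1.
Variables (R : realType) (n : nat).
Local Notation V := 'rV[R]_n.
Local Notation mu := (@Leb R n).
Local Notation intV f := (@intR _ _ _ mu f).
Implicit Types f g rho : V -> R.

(** Uniform over all kernels of small radius, rather than along a fixed sequence, so that a single
    kernel can serve finitely many functions. *)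
Definition mollifiable f := forall eta : R, 0 < eta ->
  exists e0 : R, 0 < e0 /\ forall e rho, e <= e0 -> kernel e rho ->
    \int[mu]_x `|conv f rho x - f x| <= eta.

Lemma intV_convB e rho f : kernel e rho -> intV f ->
  intV (fun x => `|conv f rho x - f x|).
Proof.
move=> krho intf; apply: intR_norm; apply: intRB => //.
by have [] := conv_L1 krho intf.
Qed.

Lemma convD e rho f g x : kernel e rho -> intV f -> intV g ->
  conv (fun y => f y + g y) rho x = conv f rho x + conv g rho x.
Proof.
move=> krho intf intg; have [r1 _ _ _ _] := krho; have [N rN] := Cc1_bounded r1.
have mr : measurable_fun setT rho.
  by apply: continuous_measurable_rV; case: r1 => /C1_cont.
rewrite /conv -RintegralD//; [|exact: (intV_conv x intf mr rN)|exact: (intV_conv x intg mr rN)].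
by apply: eq_Rintegral => y _; rewrite mulrDl.
Qed.

Lemma convZ e rho (c : R) f x : kernel e rho -> intV f ->
  conv (fun y => c * f y) rho x = c * conv f rho x.
Proof.
move=> krho intf; have [r1 _ _ _ _] := krho; have [N rN] := Cc1_bounded r1.
have mr : measurable_fun setT rho.
  by apply: continuous_measurable_rV; case: r1 => /C1_cont.
rewrite /conv -RintegralZl//; last exact: (intV_conv x intf mr rN).
by apply: eq_Rintegral => y _; rewrite mulrA.
Qed.

Lemma mollifiableD f g : intV f -> intV g -> mollifiable f -> mollifiable g ->
  mollifiable (fun x => f x + g x).
Proof.
move=> intf intg af ag eta eta0; have eta2 : 0 < eta / 2 by rewrite divr_gt0.
have [e1 [e10 H1]] := af _ eta2; have [e2 [e20 H2]] := ag _ eta2.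
exists (Num.min e1 e2); split; first by rewrite lt_min e10.
move=> e rho; rewrite le_min => /andP[ee1 ee2] krho.
rewrite (splitr eta); apply: le_trans (lerD (H1 _ _ ee1 krho) (H2 _ _ ee2 krho)).
rewrite -RintegralD//; [|exact: intV_convB krho intf|exact: intV_convB krho intg].
apply: le_RintegralT => [||x].
- exact: intV_convB krho (intRD intf intg).
- by apply: intRD; [exact: intV_convB krho intf|exact: intV_convB krho intg].
- rewrite (convD x krho)// opprD addrACA; exact: ler_normD.
Qed.

Lemma mollifiableZ (c : R) f : intV f -> mollifiable f ->
  mollifiable (fun x => c * f x).
Proof.
move=> intf af eta eta0; have c0 : 0 < `|c| + 1 by rewrite ltr_wpDl.
have [|e1 [e10 H1]] := af (eta / (`|c| + 1)); first by rewrite divr_gt0.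
exists e1; split => // e rho ee1 krho.
have -> : \int[mu]_x `|conv (fun x0 => c * f x0) rho x - c * f x| =
    `|c| * \int[mu]_x `|conv f rho x - f x|.
  rewrite -RintegralZl//; last exact: intV_convB krho intf.
  by apply: eq_Rintegral => x _; rewrite (convZ c x krho)// -mulrBr normrM.
apply: (@le_trans _ _ ((`|c| + 1) * \int[mu]_x `|conv f rho x - f x|)).
  by rewrite ler_wpM2r ?Rintegral_ge0// lerDl.
rewrite mulrC -ler_pdivlMr//; exact: (H1 _ _ ee1 krho).
Qed.

Lemma mollifiable0 : mollifiable (fun=> 0).
Proof.
move=> eta eta0; exists 1; split => // e rho _ krho.
have -> : \int[mu]_x `|conv (fun=> 0) rho x - 0| = \int[mu]_(x in setT) (0 : R).
  apply: eq_Rintegral => x _; rewrite subr0.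
  have -> : conv (fun=> 0) rho x = \int[mu]_(x in setT) (0 : R).
    by apply: eq_Rintegral => y _; rewrite mul0r.
  by rewrite Rintegral_cst// mul0r normr0.
by rewrite Rintegral_cst// mul0r ltW.
Qed.

Lemma mollifiable_sum (I : eqType) (s : seq I) (F : I -> V -> R) :
  (forall i, intV (F i)) -> (forall i, mollifiable (F i)) ->
  mollifiable (fun x => \sum_(i <- s) F i x).
Proof.
move=> intF aF; elim: s => [|i s IH].
  by under eq_fun do rewrite big_nil; exact: mollifiable0.
under eq_fun do rewrite big_cons.
by apply: mollifiableD => //; exact: intR_sum.
Qed.

(** An argument in three parts, two of which are the distance of [f] to [g]: mollification does not
    increase it, by [conv_L1]. *)
Lemma mollifiable_lim f : intV f ->
  (forall eta : R, 0 < eta -> exists g, [/\ intV g, mollifiable g &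
    \int[mu]_x `|f x - g x| <= eta]) -> mollifiable f.
Proof.
move=> intf fg eta eta0; have eta3 : 0 < eta / 3 by rewrite divr_gt0.
have [g [intg ag fgle]] := fg _ eta3; have [e1 [e10 H1]] := ag _ eta3.
exists e1; split => // e rho ee1 krho.
have intfg : intV (fun x => f x - g x) by exact: intRB.
have [intc cle] := conv_L1 krho intfg.
have -> : eta = eta / 3 + (eta / 3 + eta / 3) by field.
apply: le_trans (lerD (le_trans cle fgle) (lerD (H1 _ _ ee1 krho) fgle)).
rewrite -RintegralD//; last 2 first.
- exact: intV_convB krho intg.
- exact: intR_norm.
rewrite -RintegralD//; last 2 first.
- exact: intR_norm.
- by apply: intRD; [exact: intV_convB krho intg|exact: intR_norm].
apply: le_RintegralT => [||x].
- exact: intV_convB krho intf.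
- apply: intRD; first exact: intR_norm.
  by apply: intRD; [exact: intV_convB krho intg|exact: intR_norm].
have -> : conv f rho x - f x =
    conv (fun y => f y - g y) rho x + ((conv g rho x - g x) - (f x - g x)).
  have -> : conv f rho x = conv (fun y => (f y - g y) + g y) rho x.
    by congr (conv _ rho x); apply/funext => y; rewrite subrK.
  by rewrite (convD x krho)//; ring.
apply: (le_trans (ler_normD _ _)); rewrite lerD2l.
by apply: (le_trans (ler_normB _ _)).
Qed.

Lemma mollifiable_dominated (f_ : nat -> V -> R) f g :
  (forall k, measurable_fun setT (f_ k)) -> (forall k, mollifiable (f_ k)) ->
  measurable_fun setT f -> (forall x, f_ ^~ x @ \oo --> f x) -> intV g ->
  (forall k x, `|f_ k x| <= g x) -> (forall x, `|f x| <= g x) -> mollifiable f.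
Proof.
move=> mf_ af_ mf f_f intg f_g fg.
have g0 x : 0 <= g x by rewrite (le_trans _ (fg x)).
have intf : intV f.
  by apply: (intR_le mf _ intg) => x; rewrite (ger0_norm (g0 x)).
have intf_ k : intV (f_ k).
  by apply: (intR_le (mf_ k) _ intg) => x; rewrite (ger0_norm (g0 x)).
apply: mollifiable_lim => // eta eta0.
have [|||||_ cvf] := @Rintegral_dominated _ _ _ mu (fun k x => `|f x - f_ k x|)
  (fun=> 0) (fun x => g x + g x).
- by move=> k; apply: measurableT_comp => //; exact: measurable_funB.
- exact: measurable_cst.
- move=> x; rewrite -[X in _ --> X](normr0 R) -(subrr (f x)).
  by apply: cvg_norm; apply: cvgB => //; exact: cvg_cst.
- exact: intRD.
- by move=> k x; rewrite normr_id (le_trans (ler_normB _ _))// lerD.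
move: cvf; rewrite Rintegral_cst// mul0r => /cvgr0Pnorm_le/(_ _ eta0)[k _ kle].
exists (f_ k); split => //.
by rewrite (le_trans (ler_norm _))// kle/=.
Qed.

(** The coordinates of [Trow] are continuous. The purpose is to have the open sets as a generating
    family, closed under intersection, for the Dynkin argument below. *)
Lemma measurable_rV_open : @measurable _ V = <<s [set U : set V | open U] >>.
Proof.
apply/seteqP; split => A; last first.
  by apply: smallest_sub; [exact: sigma_algebra_measurable|exact: measurable_open_rV].
pose T' := g_sigma_algebraType [set U : set V | open U].
move=> mA.
have mT : measurable_fun (setT : set T') (@Trow R n : T' -> n.-tuple R).
  apply/(@measurable_fun_tnthP _ _ T' R) => i.
  apply: measurable_fun_openP => U oU; rewrite setTI.
  apply: sub_sigma_algebra => /=.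
  rewrite (_ : _ @^-1` _ = (fun x : V => x 0 i) @^-1` U); last first.
    by apply/seteqP; split => x /=; rewrite tnth_mktuple.
  by apply: open_comp => // x _; exact: coord_continuous.
have := mT measurableT (@rowT R n @^-1` A) mA; rewrite setTI -comp_preimage.
by rewrite (_ : rowT (n:=n) \o _ = id)//; apply/funext => x /=; exact: TrowK.
Qed.

Lemma intV_indic (A : set V) (M : R) : measurable A -> A `<=` ball 0 M -> intV \1_A.
Proof.
move=> mA AM; apply: (@intV_bsupp _ _ _ 1).
- exact: measurable_indic.
- exists M => x; rewrite indicE; case: (boolP (x \in A)) => [|_]; last by rewrite eqxx.
  rewrite inE => /AM; rewrite mx_norm_ball /ball_/= sub0r normrN => xM _.
  exact: ltW.
- by move=> x; rewrite indicE; case: (x \in A); rewrite ?normr0 ?normr1.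
Qed.

(** At a point of [U] the mollified indicator is eventually [1], so the deficit inside [U] tends to
    zero by dominated convergence. Outside nothing is known pointwise, but mollification does not
    increase the mass, so the excess outside is at most the deficit inside. Arguing by contradiction
    yields the sequence of kernels that dominated convergence asks for. *)
Lemma mollifiable_open (U : set V) (M : R) : open U -> U `<=` ball 0 M ->
  mollifiable \1_U.
Proof.
move=> oU UM eta eta0; apply: contrapT => nH.
have mU := measurable_open_rV oU; have intU := intV_indic mU UM.
have {nH} : forall k, exists p : R * (V -> R),
    [/\ p.1 <= k.+1%:R^-1, kernel p.1 p.2 & eta < \int[mu]_x `|conv \1_U p.2 x - \1_U x|].
  move=> k; apply: contrapT => nk; apply: nH; exists k.+1%:R^-1; split.
    by rewrite invr_gt0.
  move=> e rho ek krho; rewrite leNgt; apply/negP => lt; apply: nk.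
  by exists (e, rho).
move=> /choice[p /all_and3[pk kp petaH]].
pose a k := conv \1_U (p k).2.
have inta k : intV (a k) by have [] := conv_L1 (kp k) intU.
have a01 k x : 0 <= a k x <= 1.
  have [_ r0 _ _ _] := kp k; apply/andP; split.
    by apply: Rintegral_ge0 => y _; rewrite mulr_ge0// indicE.
  rewrite (le_trans (ler_norm _))//; apply: (conv_le (kp k)) => // y.
  by rewrite indicE; case: (y \in U); rewrite ?normr0 ?normr1.
have U01 x : \1_U x = 0 :> R \/ \1_U x = 1 :> R.
  by rewrite indicE; case: (x \in U); [right|left].
pose h k x := \1_U x * (1 - a k x).
have inth k : intV (h k).
  apply: (intR_bdM (M := 1)) => // [|x].
    by apply: measurable_funB => //; exact: intR_measurable (inta k).
  by have /andP[a0 a1] := a01 k x; rewrite ger0_norm ?subr_ge0// gerBl.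
have Hle k : \int[mu]_x `|a k x - \1_U x| <= 2 * \int[mu]_x h k x.
  (* As [0 <= a k <= 1], the modulus equals [a k - 1_U] plus twice the deficit [h k]; the integral
     of [a k - 1_U] is not positive. *)
  have -> : \int[mu]_x `|a k x - \1_U x| =
      \int[mu]_x (a k x - \1_U x) + 2 * \int[mu]_x h k x.
    rewrite -(RintegralZl 2 measurableT (inth k)) -RintegralD//; last 2 first.
    - exact: intRB.
    - exact: intRZ.
    apply: eq_Rintegral => x _; rewrite /h.
    have /andP[a0 a1] := a01 k x; case: (U01 x) => ->.
      by rewrite subr0 ger0_norm//; ring.
    by rewrite ler0_norm ?subr_le0//; ring.
  rewrite gerDr (RintegralB measurableT (inta k) intU) subr_le0.
  have [_] := conv_L1 (kp k) intU.
  have E (q : V -> R) : (forall x, 0 <= q x) -> \int[mu]_x `|q x| = \int[mu]_x q x.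
    by move=> q0; apply: eq_Rintegral => x _; rewrite ger0_norm.
  rewrite E; last by move=> x; have /andP[] := a01 k x.
  by rewrite E // => x; case: (U01 x) => ->.
have [|||||_] := @Rintegral_dominated _ _ _ mu h (fun=> 0) \1_U.
- by move=> k; exact: intR_measurable (inth k).
- exact: measurable_cst.
- move=> x; rewrite /h; case: (pselect (U x)) => [Ux|nUx]; last first.
    by rewrite indicE memNset//; under eq_fun do rewrite mul0r; exact: cvg_cst.
  have /nbhs_ballP[r /= r0 xrU] : nbhs x U by exact: open_nbhs_nbhs.
  apply: cvg_near_cst; near=> k.
  suff -> : a k x = 1 by rewrite subrr mulr0.
  have [_ _ _ rs _] := kp k; rewrite -(kernel_int (kp k) x).
  apply: eq_Rintegral => y _; have [->|/rs xy] := eqVneq ((p k).2 (x - y)) 0.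
    by rewrite mulr0.
  rewrite indicE mem_set ?mul1r//; apply: xrU.
  rewrite mx_norm_ball /ball_/=; apply: (lt_le_trans xy).
  apply: (le_trans (pk k)); apply: ltW.
  by near: k; exact: near_infty_natSinv_lt (PosNum r0).
- exact: intU.
- move=> k x; have /andP[a0 a1] := a01 k x; rewrite /h normrM.
  rewrite (ger0_norm (x := \1_U x)); last by case: (U01 x) => ->.
  rewrite -[leRHS]mulr1 ler_wpM2l//.
  by rewrite ger0_norm ?subr_ge0// gerBl.
rewrite Rintegral_cst// mul0r => /cvgr0Pnorm_lt/(_ (eta / 2)).
case; first by rewrite divr_gt0.
move=> k _ /(_ k (leqnn k)) /= hk.
have := petaH k; rewrite ltNge => /negP; apply.
apply: (le_trans (Hle k)); rewrite mulrC -ler_pdivlMr//.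
by rewrite (le_trans (ler_norm _))// ltW.
Unshelve. all: by end_near. Qed.

Lemma indic_add (A B C : set V) : (forall x, C x <-> A x \/ B x) ->
  (forall x, A x -> ~ B x) -> \1_C = (fun x => \1_A x + \1_B x) :> (V -> R).
Proof.
move=> CAB AB; apply/funext => x; rewrite !indicE.
case: (pselect (C x)) => [Cx|nCx].
  rewrite (mem_set Cx); case: ((CAB x).1 Cx) => [Ax|Bx].
    by rewrite (mem_set Ax) (memNset (AB _ Ax)) addr0.
  by rewrite (mem_set Bx) memNset ?add0r// => /AB.
rewrite !memNset ?addr0// => ?; apply: nCx; apply/CAB; [by right|by left].
Qed.

(** Dynkin induction from the open sets. Intersecting with a fixed ball keeps complements and
    countable unions integrable. *)
Lemma mollifiable_indic_ball (A : set V) (M : R) : measurable A ->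
  mollifiable \1_(A `&` ball 0 M).
Proof.
pose B : set V := ball 0 M; rewrite -/B.
have mB : measurable B by exact: measurable_ball_rV.
have oB : open B by exact: ball_open.
have intAB A' : measurable A' -> intV \1_(A' `&` B).
  by move=> mA'; apply: (intV_indic (M := M)); [exact: measurableI|move=> x []].
have intB : intV \1_B by rewrite -[B]setTI; exact: intAB.
have aB : mollifiable \1_B by exact: (@mollifiable_open _ M).
rewrite measurable_rV_open => mA.
apply: (@dynkin_induction _ V [set U | open U] (fun A => mollifiable \1_(A `&` B))
  measurable_rV_open _ _ _ _ _ _ mA).
- by move=> U W oU oW; exact: openI.
- by rewrite setTI.
- move=> U oU /=; apply: (@mollifiable_open _ M); last by move=> x [].
  exact: openI.
- move=> S mS aS.
  have -> : \1_(~` S `&` B) = (fun x => \1_B x + -1 * \1_(S `&` B) x) :> (V -> R).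
    rewrite (@indic_add (~` S `&` B) (S `&` B) B).
    - by apply/funext => x; rewrite mulN1r addrK.
    - move=> x; split => [Bx|[[]|[]]//].
      by case: (pselect (S x)); [right|left].
    - by move=> x [nSx _] [].
  apply: mollifiableD => //; first exact: (intRZ _ (intAB _ mS)).
  by apply: mollifiableZ => //; exact: intAB.
- move=> F mF tF aF; pose U k := [set x | exists2 i, (i < k)%N & F i x].
  have mU k : measurable (U k).
    rewrite (_ : U k = \bigcup_(i in [set i | (i < k)%N]) F i).
      exact: bigcup_measurable.
    by apply/seteqP; split => x [i ? ?]; exists i.
  have aU k : mollifiable \1_(U k `&` B).
    elim: k => [|k IH].
      have -> : \1_(U 0%N `&` B) = (fun=> 0) :> (V -> R).
        by apply/funext => x; rewrite indicE memNset// => -[[]].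
      exact: mollifiable0.
    rewrite (@indic_add (U k `&` B) (F k `&` B)).
    - by apply: mollifiableD => //; exact: intAB.
    - move=> x; split => [[[i + Fix] Bx]|[[[i ik Fix] Bx]|[Fkx Bx]]].
      + rewrite ltnS leq_eqVlt => /predU1P[<-|ik]; first by right.
        by left; split => //; exists i.
      + by split => //; exists i => //; exact: ltnW.
      + by split => //; exists k.
    - move=> x [[i ik Fix] _] [Fkx _]; have := tF i k Logic.I Logic.I.
      by move=> /(_ (ex_intro _ x (conj Fix Fkx))) ikE; rewrite ikE ltnn in ik.
  apply: (@mollifiable_dominated (fun k => \1_(U k `&` B)) _ \1_B) => //.
  + by move=> k; apply: measurable_indic; exact: measurableI.
  + by apply: measurable_indic; apply: measurableI => //; exact: bigcup_measurable.
  + move=> x; case: (pselect ((\bigcup_k F k) x)) => [[i _ Fix]|nFx].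
      apply: cvg_near_cst; exists i.+1 => // k /= ik; rewrite !indicE.
      by rewrite !in_setI (mem_set (A := U k)) ?(mem_set (A := \bigcup_k F k))//; exists i.
    apply: cvg_near_cst; apply: nearW => k; rewrite !indicE !memNset//.
      by move=> [].
    by move=> [[i _ Fix] _]; apply: nFx; exists i.
  + by move=> k x; rewrite indicI normrM !indicE; do 2!case: (_ \in _);
       rewrite ?normr1 ?normr0 ?mulr0 ?mul0r ?mulr1.
  + by move=> x; rewrite indicI normrM !indicE; do 2!case: (_ \in _);
       rewrite ?normr1 ?normr0 ?mulr0 ?mul0r ?mulr1.
Qed.

Lemma mollifiable_indic (A : set V) : measurable A -> intV \1_A -> mollifiable \1_A.
Proof.
move=> mA intA.
apply: (@mollifiable_dominated (fun k => \1_(A `&` ball 0 k%:R)) _ \1_A) => //.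
- by move=> k; apply: measurable_indic; apply: measurableI => //; exact: measurable_ball_rV.
- by move=> k; exact: mollifiable_indic_ball.
- move=> x; apply: cvg_near_cst; near=> k.
  rewrite indicI /=; rewrite [X in _ * X]indicE mem_set ?mulr1//.
  rewrite mx_norm_ball /ball_/= sub0r normrN.
  by near: k; exact: nbhs_infty_gtr.
- by move=> k x; rewrite indicI normrM !indicE; do 2!case: (_ \in _);
     rewrite ?normr1 ?normr0 ?mulr0 ?mul0r ?mulr1.
- by move=> x; rewrite indicE; case: (_ \in _); rewrite ?normr1 ?normr0.
Unshelve. all: by end_near. Qed.

Import HBSimple.

Lemma mollifiable_intV f : intV f -> mollifiable f.
Proof.
move=> intf; apply: mollifiable_lim => // eta eta0.
have [g [intg gf gle]] := approximation_sfun_integrable measurableT intf.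
have intfg k : intV (fun x => `|f x - g k x|).
  by apply: intR_norm; apply: intRB => //; exact: intg.
have /fine_cvgP[_ /cvgr0Pnorm_lt/(_ eta eta0)[k _ /(_ k (leqnn k)) /= kle]] := gle.
exists (g k); split.
- exact: intg.
- have -> : (g k : V -> R) = fun x =>
    \sum_(y <- finmap.enum_fset (fset_set (range (g k)))) (y * \1_(g k @^-1` [set y]) x).
    by apply/funext => x; rewrite {1}(fimfunE (g k)) fsbig_finite.
  have my y : measurable (g k @^-1` [set y]).
    by rewrite -[X in measurable X]setTI; apply: measurable_funPT.
  have inty y : intV (fun x => y * \1_(g k @^-1` [set y]) x).
    apply: (@intR_le _ _ _ _ _ (g k)); last exact: intg.
    - by apply: measurable_funM => //; exact: measurable_indic.
    - move=> x; rewrite indicE; case: (boolP (x \in _)) => [|_].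
        by rewrite inE /= => ->; rewrite mulr1.
      by rewrite mulr0 normr0.
  (* The value [0] is treated apart: its level set may have infinite measure, whereas for [y != 0]
     integrability of the simple function passes to the level set. *)
  apply: mollifiable_sum => // y; have [->|y0] := eqVneq y 0.
    rewrite (_ : (fun x => _) = fun=> 0); first exact: mollifiable0.
    by apply/funext => x; rewrite mul0r.
  have int1 : intV \1_(g k @^-1` [set y]).
    have := intRZ y^-1 (inty y).
    by congr (intR mu _); apply/funext => x; rewrite mulKf.
  by apply: mollifiableZ => //; exact: mollifiable_indic.
- apply: (le_trans _ (ltW kle)).
  by rewrite (_ : fine _ = \int[mu]_x `|f x - g k x|) ?ler_norm.
Qed.

End mollification_L1.

(** * Total variation and weak gradients *)

Section interior_sets.
Variables (R : realType) (n : nat).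
Local Notation V := 'rV[R]_n.
Implicit Types (A K : set V).

Lemma ballE (x y : V) (r : R) : ball x r y = (`|x - y| < r) :> Prop.
Proof. by rewrite mx_norm_ball. Qed.

(** For [r > 0], the points at distance at least [r] from the complement. The sets are closed
    because balls are open, and compact when [A] is bounded; all supports inside [A] are measured by
    them. *)
Definition inner A (r : R) : set V := [set x | ball x r `<=` A].

Lemma inner_sub A r : 0 < r -> inner A r `<=` A.
Proof. by move=> r0 x; apply; exact: ballxx. Qed.

Lemma inner_le A r s : s <= r -> inner A r `<=` inner A s.
Proof. by move=> sr x Ax y xy; apply: Ax; exact: le_ball xy. Qed.

Lemma inner_shift A r s (x y : V) : inner A r x -> `|x - y| <= s ->
  inner A (r - s) y.
Proof.
move=> Ax xy z yz; apply: Ax; move: yz; rewrite !ballE => yz.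
by rewrite -(subrKA y) (le_lt_trans (ler_normD _ _))//; lra.
Qed.

Lemma closed_inner A r : closed (inner A r).
Proof.
rewrite (_ : inner A r = ~` \bigcup_(y in ~` A) ball y r).
  by apply: open_closedC; apply: bigcup_open => y _; exact: ball_open.
apply/seteqP; split => x /=.
  by move=> Ax [y nAy yx]; apply: nAy; apply: Ax; exact: ball_sym.
move=> nx y xy; apply: contrapT => nAy; apply: nx; exists y => //.
exact: ball_sym.
Qed.

Lemma measurable_inner A r : measurable (inner A r).
Proof. by apply: measurable_closed_rV; exact: closed_inner. Qed.

Lemma compact_inner A r : bounded_set A -> 0 < r -> compact (inner A r).
Proof.
move=> [M [Mr AM]] r0; apply: bounded_closed_compact; last exact: closed_inner.
by exists M; split => // s Ms x /(inner_sub r0); exact: AM.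
Qed.

Lemma open_inner A x : open A -> A x -> exists2 r : R, 0 < r & inner A r x.
Proof.
move=> oA Ax; have /nbhs_ballP[r /= r0 xr] : nbhs x A by exact: open_nbhs_nbhs.
by exists r.
Qed.

(** Otherwise points of [K] ever closer to the complement would cluster at a point of [K], around
    which a whole ball lies in [A]. *)
Lemma compact_sub_inner A K : open A -> compact K -> K `<=` A ->
  exists2 r : R, 0 < r & K `<=` inner A r.
Proof.
move=> oA cK KA; apply: contrapT => nr.
have : forall k : nat, exists x, K x /\ ~ inner A k.+1%:R^-1 x.
  move=> k; apply: contrapT => nx; apply: nr; exists k.+1%:R^-1.
    by rewrite invr_gt0.
  by move=> x Kx; apply: contrapT => nix; apply: nx; exists x.
move=> /choice[w /all_and2[Kw nw]].
have [|x [Kx clx]] := cK (w @ \oo) _; first by exists 0%N => // k _; exact: Kw.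
have [r r0 xr] := open_inner oA (KA _ Kx).
have r20 : 0 < r / 2 by rewrite divr_gt0.
have [N _ HN] := near_infty_natSinv_lt (PosNum r20).
have [|y [[k Nk <-] xwk]] := clx
  [set w k | k in [set k | (N <= k)%N]] (ball x (r / 2)) _ (nbhsx_ballx _ _ r20).
  by exists N => // k Nk; exists k.
apply: (nw k); apply: (inner_le (r := r - r / 2)).
  by rewrite {1}(splitr r) addrK ltW//; exact: HN.
by apply: inner_shift xr _; move: xwk; rewrite ballE => /ltW.
Qed.

Lemma csupp_inner (W : zmodType) A r (f : V -> W) : bounded_set A -> 0 < r ->
  (forall x, f x != 0 -> inner A r x) -> csupp_in A f.
Proof.
move=> bA r0 fr.
have clr : closure [set x | f x != 0] `<=` inner A r.
  move=> x; rewrite closureEbigcap => /(_ (inner A r)); apply.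
  by split; [exact: closed_inner|move=> y /= /fr].
split; last by move=> x /clr; exact: inner_sub.
apply: (subclosed_compact _ (compact_inner bA r0) clr).
exact: closed_closure.
Qed.

Lemma csupp_innerP (W : zmodType) A (f : V -> W) : open A -> csupp_in A f ->
  exists2 r : R, 0 < r & forall x, closure [set x | f x != 0] x -> inner A r x.
Proof. by move=> oA [cf fA]; have [r r0 fr] := compact_sub_inner oA cf fA; exists r. Qed.

Lemma csupp_bsupp (W : zmodType) A (f : V -> W) : csupp_in A f -> bsupp f.
Proof. by move=> [cf _]; apply/bsupp_csupp; split. Qed.

End interior_sets.

Section Defs_integrals.
Variables (R : realType) (n : nat).
Local Notation V := 'rV[R]_n.
Local Notation mu := (@Leb R n).
Local Notation intV f := (@intR _ _ _ mu f).
Implicit Types (A : set V) (f u : V -> R).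

Lemma IplusE A f : (forall x, 0 <= f x) -> measurable_fun setT (f \_ A) ->
  Iplus A (fun x => (f x)%:E) = (\int[mu]_x ((f \_ A) x)%:E)%E.
Proof.
move=> f0 mf; rewrite LebE; last 2 first.
- exact/measurable_EFinP.
- by move=> x; rewrite lee_fin patchE; case: ifPn.
congr iint; apply/funext => t /=; rewrite !patchE.
by case: ifPn.
Qed.

(** Integrability keeps the difference in [Iint] from being [+oo - +oo], whose value is only a
    convention. *)
Lemma IintE A f : intV (f \_ A) -> Iint A f = (\int[mu]_x (f \_ A) x)%:E.
Proof.
move=> intf; have mf := intR_measurable intf.
pose fp x := Num.max ((f \_ A) x) 0; pose fm x := Num.max (- (f \_ A) x) 0.
have mfp : measurable_fun setT fp by exact: measurable_maxr.
have mfm : measurable_fun setT fm.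
  by apply: measurable_maxr => //; exact: measurableT_comp.
have intp : intV fp.
  apply: (intR_le mfp _ intf) => x; rewrite /fp; case: (leP ((f \_ A) x) 0) => h //.
  by rewrite normr0.
have intm : intV fm.
  apply: (intR_le mfm _ intf) => x; rewrite /fm; case: (leP (- (f \_ A) x) 0) => h //.
    by rewrite normr0.
  by rewrite normrN.
have Ep : (fun x => Num.max (f x) 0) \_ A = fp.
  by apply/funext => x; rewrite /fp !patchE; case: ifPn => // _; rewrite maxxx.
have Em : (fun x => Num.max (- f x) 0) \_ A = fm.
  apply/funext => x; rewrite /fm !patchE; case: ifPn => // _.
  by rewrite oppr0 maxxx.
rewrite /Iint !IplusE; rewrite ?Ep ?Em//; last 2 first.
- by move=> x; rewrite le_max lexx orbT.
- by move=> x; rewrite le_max lexx orbT.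
rewrite !EFin_Rintegral// -EFinB -RintegralB//; congr EFin.
apply: eq_Rintegral => x _; rewrite /fp /fm.
case: (leP ((f \_ A) x) 0) => h.
  by rewrite max_l ?oppr_ge0// opprK add0r.
by rewrite max_r ?subr0// oppr_le0 ltW.
Qed.

Lemma L1_intV A u : measurable A -> L1 A u <-> intV (u \_ A).
Proof.
move=> mA; have mE : measurable_fun (@rowT R n @^-1` A) (u \o @rowT R n) <->
    measurable_fun setT (u \_ A).
  rewrite -measurable_fun_rowT; exact: measurable_restrictT.
have nE : (fun x => `|u x|) \_ A = fun x => `|(u \_ A) x|.
  by apply/funext => x; rewrite !patchE; case: ifPn; rewrite ?normr0.
have LE : measurable_fun setT (u \_ A) ->
    L1norm A u = (\int[mu]_x `|((u \_ A) x)%:E|)%E.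
  move=> mu'; rewrite /L1norm IplusE//; last first.
    by rewrite nE; exact: measurableT_comp.
  by apply: eq_integral => x _; rewrite nE.
split=> [[/mE mu' foo]|/integrableP[/measurable_EFinP mu' foo]].
  apply/integrableP; split; first exact/measurable_EFinP.
  by rewrite -LE.
by split; [exact/mE|rewrite LE].
Qed.

Lemma L1normE A u : intV (u \_ A) -> L1norm A u = (\int[mu]_x `|(u \_ A) x|)%:E.
Proof.
move=> intu; have nE : (fun x => `|u x|) \_ A = fun x => `|(u \_ A) x|.
  by apply/funext => x; rewrite !patchE; case: ifPn; rewrite ?normr0.
rewrite /L1norm IplusE//; last first.
  by rewrite nE; apply: measurableT_comp => //; exact: intR_measurable intu.
by rewrite nE EFin_Rintegral//; exact: intR_norm.
Qed.

Lemma patch_mulr A f g : (fun x => f x * g x) \_ A = fun x => (f \_ A) x * g x.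
Proof. by apply/funext => x; rewrite !patchE; case: ifPn => // _; rewrite mul0r. Qed.

Lemma divE (phi : V -> V) : (forall i, Cc1 (Defs.comp phi i)) ->
  continuous (div phi) /\ exists M : R, forall x, `|div phi x| <= M.
Proof.
move=> phi1; split.
  rewrite /div; elim: (index_enum _) => [|i s IH].
    by under eq_fun do rewrite big_nil; exact: cst_continuous.
  under eq_fun do rewrite big_cons.
  have c1 : continuous (partial i (Defs.comp phi i)).
    by apply: C1_partial_cont; case: (phi1 i).
  by move=> x; exact: (continuousD (c1 x) (IH x)).
have [M HM] := choice (fun i => Cc1_partial_bounded i (phi1 i)).
exists (\sum_(i < n) M i) => x; apply: (le_trans (ler_norm_sum _ _ _)).
exact: ler_sum.
Qed.

Lemma TV_test_Cc1 A phi i : TV_test A phi -> Cc1 (Defs.comp phi i).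
Proof.
move=> [phi1 [sphi _]]; split; first exact: phi1.
have [M HM] := csupp_bsupp sphi; exists M => x px; apply: HM.
by apply: contra_neq px => px; rewrite /Defs.comp px mxE.
Qed.

Lemma TV_test_le1 A phi i x : TV_test A phi -> `|Defs.comp phi i x| <= 1.
Proof.
move=> [_ [_ /(_ x) phi1]]; rewrite -(@ler_pXn2r _ 2) ?nnegrE// expr1n real_normK ?num_real//.
  by apply: le_trans phi1; rewrite (bigD1 i)//= lerDl sumr_ge0// => j _; exact: sqr_ge0.
Qed.

Lemma intV_divM A phi u : TV_test A phi -> intV u -> intV (fun x => u x * div phi x).
Proof.
move=> tphi intu; have [cd [M dM]] := divE (fun i => TV_test_Cc1 i tphi).
by apply: intR_bdM dM => //; exact: continuous_measurable_rV.
Qed.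

Lemma TV_leP A u (t : R) : intV (u \_ A) ->
  (TV A u <= t%:E)%E <->
  forall phi, TV_test A phi -> \int[mu]_x ((u \_ A) x * div phi x) <= t.
Proof.
move=> intu; have E phi : TV_test A phi -> Iint A (fun x => u x * div phi x) =
    (\int[mu]_x ((u \_ A) x * div phi x))%:E.
  by move=> tphi; rewrite IintE patch_mulr//; exact: intV_divM tphi intu.
split=> [tv phi tphi|tv].
  by rewrite -lee_fin -E//; apply: le_trans tv; apply: ereal_sup_ubound; exists phi.
by apply: ge_ereal_sup => _ [phi tphi <-]; rewrite E// lee_fin; exact: tv.
Qed.

Lemma TV_ge0 A u : (0 <= TV A u)%E.
Proof.
apply: ereal_sup_ubound; exists (fun=> 0).
  split; [|split].
  - move=> i; rewrite (_ : Defs.comp _ i = fun=> 0); first exact: C1_cst.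
    by apply/funext => x; rewrite /Defs.comp mxE.
  - rewrite /csupp_in (_ : [set x | _] = set0).
      by rewrite closure0; split => //; exact: compact0.
    by apply/seteqP; split => // x /=; rewrite eqxx.
  - by move=> x; rewrite big1// => i _; rewrite mxE expr0n.
have -> : (fun x => u x * div (fun=> 0) x) = fun=> 0.
  apply/funext => x; rewrite /div big1 ?mulr0// => i _.
  rewrite (_ : Defs.comp _ i = fun=> 0) ?partial_cst//.
  by apply/funext => y; rewrite /Defs.comp mxE.
rewrite IintE; last first.
  by rewrite (_ : _ \_ A = fun=> 0); [exact: intR0|apply/funext => x; rewrite patchE; case: ifPn].
have -> : (fun=> 0) \_ A = (fun=> 0) :> (V -> R).
  by apply/funext => x; rewrite patchE; case: ifPn.
by rewrite Rintegral_cst// mul0r.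
Qed.

(** The fields constructed later are bounded component by component, whereas [TV_test] bounds the
    Euclidean length. Division by [n M] is a crude way to meet it, and the origin of the factors
    [n%:R] in front of [t]. *)
Lemma TV_scaled_test A (U : V -> R) (t M : R) (Phi : V -> V) :
  (0 < n)%N -> intV U -> 0 < M ->
  (forall phi, TV_test A phi -> \int[mu]_x (U x * div phi x) <= t) ->
  (forall i, C1 (Defs.comp Phi i)) -> csupp_in A Phi ->
  (forall i x, `|Defs.comp Phi i x| <= M) ->
  \int[mu]_x (U x * div Phi x) <= n%:R * M * t.
Proof.
move=> n0 intU M0 tv Phi1 sPhi PhiM.
have nM0 : 0 < n%:R * M by rewrite mulr_gt0// ltr0n.
pose phi x := (n%:R * M)^-1 *: Phi x : V.
have phiE i : Defs.comp phi i = fun x => (n%:R * M)^-1 * Defs.comp Phi i x.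
  by apply/funext => x; rewrite /Defs.comp mxE.
have tphi : TV_test A phi.
  split; [|split].
  - by move=> i; rewrite phiE; exact: C1Z.
  - rewrite /csupp_in (_ : [set x | phi x != 0] = [set x | Phi x != 0]) //.
    apply/seteqP; split => x /=; by rewrite scaler_eq0 invr_eq0 (gt_eqF nM0).
  - move=> x; apply: (@le_trans _ _ (\sum_(i < n) n%:R^-1)); last first.
      by rewrite sumr_const card_ord -(mulr_natl n%:R^-1 n) divff// pnatr_eq0 -lt0n.
    apply: ler_sum => i _; rewrite mxE exprMn.
    have PM : Phi x 0 i ^+ 2 <= M ^+ 2.
      by rewrite -real_normK ?num_real// ler_sqr ?nnegrE ?(ltW M0)//; exact: PhiM.
    apply: (le_trans (ler_wpM2l (sqr_ge0 _) PM)).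
    rewrite invfM exprMn -mulrA -exprMn mulVf ?gt_eqF// expr1n mulr1.
    by rewrite expr2 ler_piMr ?invr_ge0// invf_le1 ?ltr0n// ler1n.
have intd : intV (fun x => U x * div Phi x).
  have [|cd [N dN]] := @divE Phi.
    move=> i; split => //; have [N HN] := csupp_bsupp sPhi; exists N => x px.
    by apply: HN; apply: contra_neq px => px; rewrite /Defs.comp px mxE.
  by apply: intR_bdM dN => //; exact: continuous_measurable_rV.
rewrite mulrC -ler_pdivrMr//; apply: le_trans (tv _ tphi).
rewrite mulrC -RintegralZl//.
rewrite le_eqVlt; apply/orP; left; apply/eqP; apply: eq_Rintegral => x _.
rewrite mulrCA /div mulr_sumr; congr (_ * _); apply: eq_bigr => i _.
by rewrite phiE partialZ.
Qed.

End Defs_integrals.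

(** * Moving derivatives across a convolution *)

Section convolution_derivatives.
Variables (R : realType) (n : nat).
Local Notation V := 'rV[R]_n.
Local Notation mu := (@Leb R n).
Local Notation intV f := (@intR _ _ _ mu f).
Implicit Types f g h rho psi sigma : V -> R.

Lemma Cc1_measurable f : Cc1 f -> measurable_fun setT f.
Proof. by move=> [/C1_cont cf _]; exact: continuous_measurable_rV. Qed.

Lemma partial_measurable f i : Cc1 f -> measurable_fun setT (partial i f).
Proof. by move=> f1; exact: intR_measurable (intV_partial i f1). Qed.

(** Convolution commutes, so the derivative can be placed on either factor: here on [psi], in
    [partial_conv] on the kernel. *)
Lemma conv_partial psi rho i : Cc1 psi -> Cc1 rho ->
  partial i (conv psi rho) = conv (partial i psi) rho.
Proof.
move=> p1 r1; have -> : conv psi rho = conv rho psi.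
  by apply/funext => x; apply: convC; exact: Cc1_measurable.
apply/funext => x; rewrite partial_conv//; last exact: intV_Cc1.
by apply: convC; [exact: Cc1_measurable|exact: partial_measurable].
Qed.

Lemma partial_odd rho i x : (forall y, rho (- y) = rho y) -> C1 rho ->
  partial i rho (- x) = - partial i rho x.
Proof.
move=> rN r1; pose L (s : R) := rho (s *: ev R i + x).
have line z : derivable (fun s : R => rho (s *: ev R i + z)) 0 1 /\
    'D_1 (fun s : R => rho (s *: ev R i + z)) 0 = partial i rho z.
  have := @derivable_line _ _ rho z (ev R i) 0; rewrite scale0r add0r; apply.
  exact: (C1_deriv r1).
have [_ <-] := line (- x); have [dL DL] := line x.
have -> : (fun s : R => rho (s *: ev R i - x)) = L \o -%R.
  by apply/funext => s; rewrite /L /= -rN opprD opprK scaleNr.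
have HL : is_derive (- 0 : R) 1 L (partial i rho x).
  by rewrite oppr0 -DL; exact: derivableP.
have [_ ->] := is_derive1_comp HL (is_deriveN (is_derive_id (0 : R) 1)).
by rewrite mulrN1.
Qed.

(** As for [conv_adjoint]; the sign appears because the derivative of an even kernel is odd. *)
Lemma conv_adjoint_partial e rho f sigma i : kernel e rho -> intV f -> intV sigma ->
  \int[mu]_x (conv f (partial i rho) x * sigma x) =
  - \int[mu]_y (f y * conv sigma (partial i rho) y).
Proof.
move=> krho intf ints; have [r1 _ rN _ _] := krho; have [r1' _] := r1.
have mdr := partial_measurable i r1; have [N rNb] := Cc1_partial_bounded i r1.
have mf := intR_measurable intf; have ms := intR_measurable ints.
transitivity (\int[mu]_x \int[mu]_y (f y * partial i rho (x - y) * sigma x)).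
  apply: eq_Rintegral => x _; rewrite -RintegralZr//.
  exact: (intV_conv x intf mdr rNb).
transitivity (\int[mu]_y \int[mu]_x (f y * partial i rho (x - y) * sigma x)); last first.
  rewrite -mulN1r -RintegralZl//; last first.
    have [M sM] : exists M : R, forall y, `|conv sigma (partial i rho) y| <= M.
      exists (N * \int[mu]_x `|sigma x|) => y.
      apply: (le_trans (le_normr_Rintegral _ _)) => //.
        exact: (intV_conv y ints mdr rNb).
      rewrite -RintegralZl//; last exact: intR_norm.
      apply: le_RintegralT => [||x].
      - by apply: intR_norm; exact: (intV_conv y ints mdr rNb).
      - by apply: intRZ; exact: intR_norm.
      - by rewrite normrM mulrC ler_wpM2r.
    apply: (intR_bdM intf _ sM).
    apply: continuous_measurable_rV; apply: (continuous_conv ints _ rNb).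
    exact: C1_partial_cont.
  apply: eq_Rintegral => y _; rewrite mulN1r -mulrN -mulN1r.
  rewrite -RintegralZl//; last exact: (intV_conv y ints mdr rNb).
  rewrite -RintegralZl//; last by apply: intRZ; exact: (intV_conv y ints mdr rNb).
  apply: eq_Rintegral => x _.
  by rewrite -(opprB y x) partial_odd//; ring.
apply: (@Fubini_real _ _ (fun p => f p.2 * partial i rho (p.1 - p.2) * sigma p.1)
  (fun x => N * sigma x) f) => //.
- apply: measurable_funM; last exact: (measurableT_comp ms measurable_fst).
  apply: measurable_funM; first exact: (measurableT_comp mf measurable_snd).
  by apply: measurableT_comp mdr _; exact: measurable_subVV.
- exact: intRZ.
- move=> x y /=; rewrite !normrM (mulrC `|f y|) mulrAC ler_wpM2r// ler_wpM2r//.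
  by rewrite (le_trans (rNb _))// ler_norm.
Qed.

(** No one-dimensional integration by parts is involved: the kernel is moved onto [psi], the
    derivative from [psi] onto the kernel, and the kernel back, its odd derivative giving the
    sign. *)
Lemma conv_ibp e rho f psi i : kernel e rho -> intV f -> Cc1 psi ->
  \int[mu]_x (conv f rho x * partial i psi x) =
  - \int[mu]_x (partial i (conv f rho) x * psi x).
Proof.
move=> krho intf p1; have [r1 _ _ _ _] := krho; have intp := intV_Cc1 p1.
rewrite (conv_adjoint krho intf (intV_partial i p1)) -conv_partial//.
have -> : partial i (conv f rho) = conv f (partial i rho).
  by apply/funext => x; rewrite partial_conv.
rewrite (conv_adjoint_partial i krho intf intp) opprK.
by apply: eq_Rintegral => y _; rewrite partial_conv.
Qed.

Lemma smooth_conv f rho : intV f -> smooth rho -> bsupp rho -> smooth (conv f rho).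
Proof.
move=> intf sr br.
have br' l : bsupp (iter_partial l rho).
  by elim: l => // i l IH; exact: bsupp_partial.
have r1 l : Cc1 (iter_partial l rho).
  split => //; split; [by have [] := sr l|split=> [i x|i]].
    by have [_] := sr l; exact.
  by have [] := sr (i :: l).
have E l : iter_partial l (conv f rho) = conv f (iter_partial l rho).
  elim: l => // i l IH; rewrite /= -!/(iter_partial l _) IH.
  by apply/funext => x; rewrite partial_conv.
move=> l; rewrite E; have [c1 [d1 _]] := C1_conv intf (r1 l).
by split => // i x; exact: d1.
Qed.

Lemma Rintegral_bd_le f g (M : R) : intV f -> measurable_fun setT g ->
  (forall x, `|g x| <= M) -> `|\int[mu]_x (f x * g x)| <= M * \int[mu]_x `|f x|.
Proof.
move=> intf mg gM; have intfg := intR_bdM intf mg gM.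
apply: (le_trans (le_normr_Rintegral _ _)) => //.
rewrite -RintegralZl//; last exact: intR_norm.
apply: le_RintegralT => [||x]; [exact: intR_norm|exact/intRZ/intR_norm|].
by rewrite normrM mulrC ler_wpM2r.
Qed.

End convolution_derivatives.

(** * Weak gradients bound the total variation *)

Section weak_gradient_TV.
Variables (R : realType) (n : nat) (A : set 'rV[R]_n).
Hypotheses (oA : open A) (bA : bounded_set A).
Local Notation V := 'rV[R]_n.
Local Notation mu := (@Leb R n).
Local Notation intV f := (@intR _ _ _ mu f).

(* Mollification is self-adjoint, so L1 convergence of the mollified [u] and
   [g] replaces any uniform convergence of the mollified test function. *)
Lemma weak_grad_C1 (u : V -> R) (g : V -> V) (psi : V -> R) i :
  intV (u \_ A) -> intV (Defs.comp g i \_ A) -> weak_grad A u g ->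
  C1 psi -> csupp_in A psi ->
  \int[mu]_x ((u \_ A) x * partial i psi x) =
  - \int[mu]_x ((Defs.comp g i \_ A) x * psi x).
Proof.
set U := u \_ A; set G := Defs.comp g i \_ A.
move=> intU intG ug p1 sp; have bp := csupp_bsupp sp.
have pc : Cc1 psi by [].
have [M pM] := Cc1_bounded pc; have [N pN] := Cc1_partial_bounded i pc.
have [r r0 sr] := csupp_innerP oA sp.
apply/eqP; rewrite -subr_eq0 opprK -normr_le0; apply/ler_addgt0Pr => eps eps0.
rewrite add0r; pose K := `|M| + `|N| + 1.
have K0 : 0 < K by rewrite ltr_wpDl// addr_ge0.
have epsK : 0 < eps / K / 2 by rewrite !divr_gt0.
have [e1 [e10 H1]] := mollifiable_intV intU epsK.
have [e2 [e20 H2]] := mollifiable_intV intG epsK.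
(* [r / 2] keeps the mollified [psi] supported in [A]; [e1] and [e2] make both [L1] errors at most
   [eps / K / 2], where [K] dominates the bounds of [psi] and of its derivative. *)
pose e := Num.min (r / 2) (Num.min e1 e2).
have e0 : 0 < e by rewrite !lt_min e10 e20 divr_gt0.
have [rho [srho krho]] := @kernel_exists R n e e0.
have [r1 _ _ _ _] := krho; have [_ br] := r1.
have intp := intV_Cc1 pc.
have spr : csupp_in A (conv psi rho).
  apply: (@csupp_inner _ _ _ _ (r / 2)) => //; first by rewrite divr_gt0.
  move=> x /(kernel_supp krho)[y [py xy]].
  rewrite (_ : r / 2 = r - r / 2); last by lra.
  apply: (@inner_shift _ _ _ _ _ y); first by apply: sr; exact: subset_closure.
  by rewrite distrC ltW// (lt_le_trans xy)// ge_min lexx.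
have := ug _ (smooth_conv intp srho br) spr i.
have dconv : partial i (conv psi rho) = conv (partial i psi) rho by exact: conv_partial.
have cbd : forall x, `|conv psi rho x| <= M by move=> x; exact: (conv_le krho).
have dbd : forall x, `|partial i (conv psi rho) x| <= N.
  by move=> x; rewrite dconv; apply: (conv_le krho) => //; exact: intV_partial.
have cC1 : Cc1 (conv psi rho) by split; [exact: C1_conv|exact: bsupp_conv].
rewrite !IintE; last 2 first.
- by rewrite patch_mulr; apply: intR_bdM cbd => //; exact: Cc1_measurable.
- by rewrite patch_mulr; apply: intR_bdM dbd => //; exact: partial_measurable.
rewrite !patch_mulr -EFinN => -[]; rewrite -/U -/G dconv.
rewrite -(conv_adjoint krho intU (intV_partial i pc)) -(conv_adjoint krho intG intp).
move=> E.
have [intUr _] := conv_L1 krho intU; have [intGr _] := conv_L1 krho intG.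
have mp := Cc1_measurable pc; have mdp := partial_measurable i pc.
have -> : \int[mu]_x (U x * partial i psi x) + \int[mu]_x (G x * psi x) =
    (- \int[mu]_x ((conv U rho x - U x) * partial i psi x)) -
    (\int[mu]_x ((conv G rho x - G x) * psi x)).
  under [X in _ = - X - _]eq_Rintegral do rewrite mulrBl.
  under [X in _ = _ - X]eq_Rintegral do rewrite mulrBl.
  rewrite !RintegralB//; try by [apply: intR_bdM pN|apply: intR_bdM pM].
  by rewrite E; ring.
have B1 := Rintegral_bd_le (intRB intUr intU) mdp pN.
have B2 := Rintegral_bd_le (intRB intGr intG) mp pM.
apply: (le_trans (ler_normB _ _)); rewrite normrN.
have L1 : \int[mu]_x `|conv U rho x - U x| <= eps / K / 2.
  by apply: (H1 e) => //; rewrite !ge_min lexx orbT.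
have L2 : \int[mu]_x `|conv G rho x - G x| <= eps / K / 2.
  by apply: (H2 e) => //; rewrite !ge_min lexx !orbT.
have N0 : 0 <= N by rewrite (le_trans _ (pN 0)).
have M0 : 0 <= M by rewrite (le_trans _ (pM 0)).
apply: (le_trans (lerD (le_trans B1 (ler_wpM2l N0 L1)) (le_trans B2 (ler_wpM2l M0 L2)))).
rewrite -mulrDl -ler_pdivlMr//.
have -> : eps / (eps / K / 2) = K * 2 by field; rewrite !lt0r_neq0.
rewrite /K !ger0_norm//; lra.
Qed.

(** Trades the Euclidean length in [W11norm] for the components, in both directions. *)
Lemma grad_norm_intV (g : V -> V) :
  let S := (fun x => Num.sqrt (\sum_(i < n) g x 0 i ^+ 2)) \_ A in
  (forall i, intV (Defs.comp g i \_ A)) ->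
  [/\ intV S, forall i x, `|(Defs.comp g i \_ A) x| <= S x &
    forall x, S x <= \sum_(i < n) `|(Defs.comp g i \_ A) x|].
Proof.
move=> /= intG; pose S x := Num.sqrt (\sum_(i < n) g x 0 i ^+ 2).
have SE x : (S \_ A) x = Num.sqrt (\sum_(i < n) (Defs.comp g i \_ A) x ^+ 2).
  rewrite patchE; case: ifPn => xA.
    by congr Num.sqrt; apply: eq_bigr => i _; rewrite patchE xA.
  by rewrite big1 ?sqrtr0// => i _; rewrite patchE (negbTE xA) expr0n.
have GS i x : `|(Defs.comp g i \_ A) x| <= (S \_ A) x.
  rewrite SE -sqrtr_sqr ler_sqrt; last by apply: sumr_ge0 => j _; exact: sqr_ge0.
  by rewrite (bigD1 i)//= lerDl sumr_ge0// => j _; exact: sqr_ge0.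
have mS : measurable_fun setT (S \_ A).
  have -> : S \_ A = fun x => Num.sqrt (\sum_(i < n) (Defs.comp g i \_ A) x ^+ 2).
    by apply/funext => x; exact: SE.
  apply: measurableT_comp; first by apply: continuous_measurable_fun; exact: sqrt_continuous.
  apply: measurable_sum => i; apply: measurable_funX.
  exact: intR_measurable (intG i).
have SG x : (S \_ A) x <= \sum_(i < n) `|(Defs.comp g i \_ A) x|.
  rewrite SE -[leRHS]ger0_norm ?sumr_ge0// -sqrtr_sqr ler_wsqrtr//.
  have [] : 0 <= \sum_(i < n) `|(Defs.comp g i \_ A) x| /\
      \sum_(i < n) (Defs.comp g i \_ A) x ^+ 2 <=
      (\sum_(i < n) `|(Defs.comp g i \_ A) x|) ^+ 2; last by [].
  elim/big_ind2 : _ => [|a b c d [a0 ba] [c0 dc]|i _].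
  - by rewrite expr0n.
  - split; first exact: addr_ge0.
    rewrite sqrrD (le_trans (lerD ba dc))// addrAC lerDl mulrn_wge0// mulr_ge0//.
  - by rewrite real_normK ?num_real.
split => //.
have intsum : intV (fun x => \sum_(i < n) `|(Defs.comp g i \_ A) x|).
  by apply: intR_sum => i _; exact: intR_norm.
apply: (intR_le mS _ intsum) => x; rewrite !ger0_norm//; first exact: sumr_ge0.
by rewrite SE sqrtr_ge0.
Qed.

(** Each component of the gradient is paired separately with a component of the field, of modulus at
    most one; summing over the components costs the factor [n]. *)
Lemma W11_TV (u : V -> R) (g : V -> V) : W11 A u g ->
  (TV A u <= n%:R%:E * Iplus A (fun x => (Num.sqrt (\sum_(i < n) g x 0 i ^+ 2))%:E))%E.
Proof.
move=> [/(L1_intV _ (measurable_open_rV oA)) intU [intg ug]].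
have intG i : intV (Defs.comp g i \_ A).
  by apply/L1_intV; [exact: measurable_open_rV|exact: intg].
pose S x := Num.sqrt (\sum_(i < n) g x 0 i ^+ 2).
have [intS GS _] := grad_norm_intV intG.
rewrite -/S in intS GS.
rewrite IplusE//; last exact: intR_measurable intS.
rewrite EFin_Rintegral// -EFinM; apply/TV_leP => // phi tphi.
have [_ [sphi _]] := tphi.
have phi1 i := TV_test_Cc1 i tphi.
have cphi i : csupp_in A (Defs.comp phi i).
  have [r r0 sr] := csupp_innerP oA sphi.
  apply: (csupp_inner bA r0) => x px; apply: sr; apply: subset_closure => /=.
  by apply: contra_neq px => px; rewrite /Defs.comp px mxE.
have -> : \int[mu]_x ((u \_ A) x * div phi x) =
    \sum_(i < n) - \int[mu]_x ((Defs.comp g i \_ A) x * Defs.comp phi i x).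
  rewrite /div; under eq_Rintegral do rewrite mulr_sumr.
  rewrite Rintegral_sum => [|i _]; last first.
    have [M dM] := Cc1_partial_bounded i (phi1 i).
    by apply: intR_bdM dM => //; exact: partial_measurable.
  apply: eq_bigr => i _; apply: weak_grad_C1 => //.
  by have [] := phi1 i.
apply: (@le_trans _ _ (\sum_(i < n) \int[mu]_x (S \_ A) x)); last first.
  by rewrite sumr_const card_ord mulr_natl.
apply: ler_sum => i _; apply: (le_trans (ler_norm _)); rewrite normrN.
apply: (le_trans (Rintegral_bd_le (intG i) _ (fun x => TV_test_le1 i x tphi))).
  exact: Cc1_measurable.
by rewrite mul1r; apply: le_RintegralT => //; exact: intR_norm.
Qed.

End weak_gradient_TV.

(** * Smoothing up to the boundary *)

Section partition_of_unity.
Variables (R : realType) (n : nat) (A : set 'rV[R]_n).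
Hypotheses (oA : open A) (bA : bounded_set A).
Local Notation V := 'rV[R]_n.
Local Notation mu := (@Leb R n).
Local Notation intV f := (@intR _ _ _ mu f).

Definition rad (k : nat) : R := 2^-1 ^+ k.

Lemma rad_gt0 k : 0 < rad k. Proof. by rewrite exprn_gt0. Qed.

Lemma radS k : rad k = 2 * rad k.+1.
Proof. by rewrite /rad exprS mulrA mulfV ?mul1r. Qed.

Lemma rad_le k l : (k <= l)%N -> rad l <= rad k.
Proof. by move=> kl; rewrite ler_wiXn2l// invf_le1// ler1n. Qed.

Lemma rad_lt (e : R) : 0 < e -> exists k, rad k < e.
Proof.
move=> e0; have /cvgr0Pnorm_lt/(_ e e0)[k _ /(_ k (leqnn k))] : rad k @[k --> \oo] --> 0.
  by apply: cvg_expr; rewrite ger0_norm ?invf_lt1 ?ltr1n// invr_ge0.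
by exists k; rewrite (le_lt_trans (ler_norm _)).
Qed.

Lemma inner_lin (c d : R) k x : d <= c -> inner A (c * rad k) x -> inner A (d * rad k) x.
Proof. by move=> dc; apply: inner_le; rewrite ler_wpM2r// ltW// rad_gt0. Qed.

Lemma inner_rad_le (c : R) k l x : (k <= l)%N -> 0 <= c ->
  inner A (c * rad k) x -> inner A (c * rad l) x.
Proof. by move=> kl c0; apply: inner_le; rewrite ler_wpM2l// rad_le. Qed.

(** The indicator of [inner A (rad k)] mollified at radius [rad k / 4], whence [3/4 = 1 - 1/4] and
    [5/4 = 1 + 1/4]. *)
Lemma cutoff_exists : exists chi : nat -> V -> R, forall k,
  [/\ C1 (chi k), forall x, 0 <= chi k x <= 1,
    forall x, chi k x != 0 -> inner A (3 / 4 * rad k) x &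
    forall x, inner A (5 / 4 * rad k) x -> chi k x = 1].
Proof.
have r4 k : 0 < rad k / 4 by rewrite divr_gt0// rad_gt0.
have [rho krho] := choice (fun k => @kernel_exists R n (rad k / 4) (r4 k)).
have intI k : intV \1_(inner A (rad k)).
  have [M [Mr AM]] := bA.
  apply: (intV_indic (M := `|M| + 2)); first exact: measurable_inner.
  move=> x /(inner_sub (rad_gt0 k)) Ax; rewrite ballE sub0r normrN.
  apply: (@le_lt_trans _ _ (`|M| + 1)); last by rewrite ltrD2l; lra.
  by apply: (AM (`|M| + 1)) => //; rewrite (le_lt_trans (ler_norm _))// ltrDl.
exists (fun k => conv \1_(inner A (rad k)) (rho k)) => k.
have [_ kr] := krho k; have [r1 r0 _ rs _] := kr.
have I01 y : `|\1_(inner A (rad k)) y| <= 1 :> R.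
  by rewrite indicE; case: (y \in _); rewrite ?normr0 ?normr1.
split.
- exact: C1_conv.
- move=> x; apply/andP; split.
    by apply: Rintegral_ge0 => y _; rewrite mulr_ge0// indicE.
  by rewrite (le_trans (ler_norm _))//; apply: (conv_le kr).
- move=> x /(kernel_supp kr)[y [Iy xy]].
  rewrite (_ : 3 / 4 * rad k = rad k - rad k / 4); last by field.
  apply: (@inner_shift _ _ _ _ _ y); last by rewrite distrC ltW.
  by apply: contrapT => nI; move: Iy; rewrite indicE memNset// eqxx.
- move=> x Ix; rewrite -(kernel_int kr x); apply: eq_Rintegral => y _.
  have [->|/rs xy] := eqVneq (rho k (x - y)) 0; first by rewrite mulr0.
  rewrite indicE mem_set ?mul1r//.
  rewrite (_ : rad k = 5 / 4 * rad k - rad k / 4); last by field.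
  by apply: inner_shift Ix _; exact: ltW.
Qed.

(** [theta k] is the difference of consecutive cutoffs, so the sums telescope. It is nonnegative
    because [chi k.+1] is [1] wherever [chi k] is not zero: [3/4 rad k = 3/2 rad k.+1] exceeds
    [5/4 rad k.+1]. It vanishes at depth [5/2 rad k], that is [5/4 rad k.-1], since both cutoffs are
    [1] there. *)
Lemma partition_exists : exists theta : nat -> V -> R,
  [/\ forall k, C1 (theta k),
    forall k x, 0 <= theta k x,
    forall N x, \sum_(k < N) theta k x <= 1,
    forall k x, theta k x != 0 -> inner A (3 / 4 * rad k) x &
    (forall k x, (0 < k)%N -> inner A (5 / 2 * rad k) x -> theta k x = 0) /\
    (forall N x, inner A (5 / 4 * rad N) x -> \sum_(k < N.+1) theta k x = 1)].
Proof.
have [chi Hchi] := cutoff_exists.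
pose theta k x := if k is k'.+1 then chi k x - chi k' x else chi 0%N x.
have sumE N x : \sum_(k < N.+1) theta k x = chi N x.
  elim: N => [|N IH]; first by rewrite big_ord1.
  by rewrite big_ord_recr/= IH addrC subrK.
have chiS k x : chi k x != 0 -> chi k.+1 x = 1.
  have [_ _ + _] := Hchi k; move=> /[apply] Ix.
  have [_ _ _] := Hchi k.+1; apply.
  apply: (@inner_lin (3 / 2)); first by lra.
  by rewrite (_ : 3 / 2 * rad k.+1 = 3 / 4 * rad k)// (radS k); field.
exists theta; split.
- case=> [|k]; first by have [] := Hchi 0%N.
  by apply: C1B; [have [] := Hchi k.+1|have [] := Hchi k].
- case=> [|k] x; first by have [_ /(_ x)/andP[]] := Hchi 0%N.
  rewrite /theta subr_ge0; have [->|/chiS ->] := eqVneq (chi k x) 0.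
    by have [_ /(_ x)/andP[]] := Hchi k.+1.
  by have [_ /(_ x)/andP[]] := Hchi k.
- case=> [|N] x; first by rewrite big_ord0.
  by rewrite sumE; have [_ /(_ x)/andP[]] := Hchi N.
- case=> [|k] x; first by have [_ _ + _] := Hchi 0%N; exact.
  rewrite /theta; have [c0|c0 _] := eqVneq (chi k x) 0.
    by rewrite c0 subr0; have [_ _ + _] := Hchi k.+1; exact.
  have [_ _ + _] := Hchi k; move=> /(_ x c0); rewrite radS => Ix.
  apply: (@inner_lin (3 / 2)); first by lra.
  by rewrite (_ : 3 / 2 * rad k.+1 = 3 / 4 * (2 * rad k.+1))//; field.
- split=> [[//|k] x _ Ix|N x Ix]; last by rewrite sumE; have [_ _ _] := Hchi N; exact.
  have c1 : chi k x = 1.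
    have [_ _ _] := Hchi k; apply.
    by rewrite (_ : 5 / 4 * rad k = 5 / 2 * rad k.+1)// (radS k); field.
  by rewrite /theta c1 chiS ?subrr// c1 oner_neq0.
Qed.

End partition_of_unity.

(** * Series of functions that are finite sums at each point *)

Section monotone_limits.
Context d (T : measurableType d) (R : realType) (mu : {measure set T -> \bar R}).

(** Monotone convergence in which the uniform bound [C] also yields the integrability of the
    limit. *)
Lemma intR_monotone (g_ : nat -> T -> R) (g : T -> R) (C : R) :
  (forall k x, 0 <= g_ k x) -> (forall x, nondecreasing_seq (g_ ^~ x)) ->
  (forall x, g_ ^~ x @ \oo --> g x) ->
  (forall k, intR mu (g_ k)) -> (forall k, \int[mu]_x g_ k x <= C) ->
  intR mu g /\ \int[mu]_x g x <= C.
Proof.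
move=> g0 nd gcvg intg leC.
have mg : measurable_fun setT g.
  apply: (@measurable_fun_cvg _ _ _ _ g_) => [k|x _]; last exact: gcvg.
  exact: intR_measurable (intg k).
have gg0 x : 0 <= g x.
  rewrite -(cvg_lim _ (gcvg x))//.
  by apply: limr_ge; [apply: cvgP (gcvg x)|exact: nearW].
have gE x : limn (fun k => (g_ k x)%:E) = (g x)%:E.
  by apply/cvg_lim => //; apply: cvg_EFin; [exact: nearW|exact: gcvg].
have := @cvg_monotone_convergence _ _ _ mu setT measurableT (fun k x => (g_ k x)%:E).
move=> cvI.
have leI : (\int[mu]_x (g x)%:E <= C%:E)%E.
  have -> : (\int[mu]_x (g x)%:E = \int[mu]_x limn (fun k => (g_ k x)%:E))%E.
    by apply: eq_integral => x _; rewrite gE.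
  have {}cvI : (\int[mu]_x (g_ k x)%:E @[k --> \oo] -->
      \int[mu]_x limn (fun k => (g_ k x)%:E))%E.
    apply: cvI => [k|k x _|x _ k l kl].
    - by apply/measurable_EFinP; exact: intR_measurable (intg k).
    - by rewrite lee_fin.
    - by rewrite lee_fin; exact: nd.
  rewrite -(cvg_lim _ cvI)//; apply: lime_le; first exact: cvgP cvI.
  by apply: nearW => k; rewrite EFin_Rintegral// lee_fin.
have intG : intR mu g.
  apply/integrableP; split; first exact/measurable_EFinP.
  apply: le_lt_trans (ltry C); apply: le_trans leI.
  rewrite le_eqVlt; apply/orP; left; apply/eqP; apply: eq_integral => x _.
  by rewrite /= ger0_norm.
by split => //; rewrite -lee_fin -EFin_Rintegral.
Qed.

(* [limn] is junk without convergence; below the terms vanish eventually at each point. *)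
Definition ser (F : nat -> T -> R) (x : T) : R := limn (fun m => \sum_(k < m) F k x).

Lemma ser_cvg (F : nat -> T -> R) N x : (forall k, (N <= k)%N -> F k x = 0) ->
  (fun m => \sum_(k < m) F k x) @ \oo --> \sum_(k < N) F k x.
Proof.
move=> F0; apply: cvg_near_cst; exists N => // m /= Nm.
rewrite -!(big_mkord xpredT (fun k => F k x)) (big_cat_nat (n := N))//=.
by rewrite [X in _ + X]big_nat_cond [X in _ + X]big1 ?addr0// => k /andP[/andP[Nk _] _]; exact: F0.
Qed.

Lemma serE (F : nat -> T -> R) N x : (forall k, (N <= k)%N -> F k x = 0) ->
  ser F x = \sum_(k < N) F k x.
Proof. by move=> F0; apply/cvg_lim => //; exact: ser_cvg. Qed.

Lemma measurable_ser (F : nat -> T -> R) :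
  (forall k, measurable_fun setT (F k)) ->
  (forall x, exists N, forall k, (N <= k)%N -> F k x = 0) ->
  measurable_fun setT (ser F).
Proof.
move=> mF F0; apply: (@measurable_fun_cvg _ _ _ _ (fun m x => \sum_(k < m) F k x)).
  by move=> m; apply: measurable_sum => k; exact: mF.
by move=> x _; have [N FN] := F0 x; rewrite (serE FN); exact: ser_cvg.
Qed.

(** The series of absolute values is integrable by monotone convergence and dominates all partial
    sums, so dominated convergence gives the rest, including the passage to the limit in pairings
    with bounded functions. *)
Lemma ser_L1 (F : nat -> T -> R) (c : nat -> R) (C : R) :
  (forall x, exists N, forall k, (N <= k)%N -> F k x = 0) ->
  (forall k, intR mu (F k)) -> (forall k, \int[mu]_x `|F k x| <= c k) ->
  (forall m, \sum_(k < m) c k <= C) ->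
  [/\ intR mu (ser F), \int[mu]_x `|ser F x| <= C &
    forall (h : T -> R) (M : R), measurable_fun setT h -> (forall x, `|h x| <= M) ->
      (\sum_(k < m) \int[mu]_x (F k x * h x)) @[m --> \oo] --> \int[mu]_x (ser F x * h x)].
Proof.
move=> F0 intF Fc cC; pose a k x : R := `|F k x|.
have a0 x : exists N, forall k, (N <= k)%N -> a k x = 0.
  by have [N FN] := F0 x; exists N => k Nk; rewrite /a FN ?normr0.
have acvg x : (fun m => \sum_(k < m) a k x) @ \oo --> ser a x.
  by have [N aN] := a0 x; rewrite (serE aN); exact: ser_cvg.
have Fcvg x : (fun m => \sum_(k < m) F k x) @ \oo --> ser F x.
  by have [N FN] := F0 x; rewrite (serE FN); exact: ser_cvg.
have nd x : nondecreasing_seq (fun m => \sum_(k < m) a k x).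
  by apply/nondecreasing_seqP => m; rewrite big_ord_recr/= lerDl normr_ge0.
have inta k : intR mu (a k) by exact: intR_norm.
have [intS SC] : intR mu (ser a) /\ \int[mu]_x ser a x <= C.
  apply: (@intR_monotone (fun m x => \sum_(k < m) a k x)) => //.
  - by move=> m x; apply: sumr_ge0 => k _; exact: normr_ge0.
  - by move=> m; apply: intR_sum.
  - move=> m; rewrite Rintegral_sum//; apply: le_trans (cC m).
    by apply: ler_sum => k _; exact: Fc.
have mF k : measurable_fun setT (F k) by exact: intR_measurable (intF k).
have PS m x : `|\sum_(k < m) F k x| <= ser a x.
  apply: (le_trans (ler_norm_sum _ _ _)); rewrite -(cvg_lim _ (acvg x))//.
  by apply: nondecreasing_cvgn_le; [exact: nd|exact: cvgP (acvg x)].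
have mP m : measurable_fun setT (fun x => \sum_(k < m) F k x).
  by apply: measurable_sum.
have mser := measurable_ser mF F0.
have [intser _] := Rintegral_dominated mP mser Fcvg intS PS.
have FS x : `|ser F x| <= ser a x.
  have [N FN] := F0 x; rewrite (serE FN); exact: PS.
split => //.
  apply: le_trans SC; apply: le_RintegralT => //; exact: intR_norm.
move=> h M mh hM.
have mPh m : measurable_fun setT (fun x => (\sum_(k < m) F k x) * h x).
  exact: measurable_funM.
have Ph x : (\sum_(k < m) F k x) * h x @[m --> \oo] --> ser F x * h x.
  by apply: cvgMl; exact: Fcvg.
have Pbd m x : `|(\sum_(k < m) F k x) * h x| <= M * ser a x.
  by rewrite normrM mulrC ler_pM.
have [_] := Rintegral_dominated mPh (measurable_funM mser mh) Ph (intRZ M intS) Pbd.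
apply: cvg_trans; apply: near_eq_cvg; apply: nearW => m.
rewrite -Rintegral_sum => [|k _]; last exact: intR_bdM hM.
by apply: eq_Rintegral => x _; rewrite mulr_suml.
Qed.

End monotone_limits.

(** * Construction of the smooth part and its estimates *)

Section smoothing.
Variables (R : realType) (n : nat) (A : set 'rV[R]_n).
Local Notation V := 'rV[R]_n.
Local Notation mu := (@Leb R n).
Local Notation intV f := (@intR _ _ _ mu f).
Local Notation rad := (rad R).
Implicit Types (f : V -> R).

Lemma partial_near_cst f (c r : R) i x : 0 < r ->
  (forall y, `|x - y| < r -> f y = c) -> partial i f x = 0.
Proof.
move=> r0 fc; rewrite /partial -(partial_cst c i x) /partial.
apply: near_eq_derive; apply/nbhs_ballP; exists r => // y.
by rewrite ballE; exact: fc.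
Qed.

Lemma partial_inner f r i x : (forall y, f y != 0 -> inner A r y) ->
  partial i f x != 0 -> inner A r x.
Proof.
move=> fr /partial_supp; rewrite closureEbigcap => /(_ (inner A r)); apply.
by split; [exact: closed_inner|exact: fr].
Qed.

(** Errors of size [delta * rad k.+1] thus add up to at most [delta]. *)
Lemma sum_rad m : \sum_(k < m) rad k.+1 = 1 - rad m.
Proof.
elim: m => [|m IH]; first by rewrite big_ord0 /rad expr0 subrr.
by rewrite big_ord_recr/= IH (radS R m); ring.
Qed.

Hypotheses (oA : open A) (bA : bounded_set A) (n0 : (0 < n)%N).
Variables (U : V -> R) (t delta : R).
Hypotheses (intU : intV U) (UA : forall x, ~ A x -> U x = 0) (delta0 : 0 < delta).
Hypothesis tv : forall phi, TV_test A phi -> \int[mu]_x (U x * div phi x) <= t.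

Variable theta : nat -> V -> R.
Hypotheses (theta1 : forall k, C1 (theta k)) (theta0 : forall k x, 0 <= theta k x).
Hypothesis theta_le1 : forall N x, \sum_(k < N) theta k x <= 1.
Hypothesis theta_supp : forall k x, theta k x != 0 -> inner A (3 / 4 * rad k) x.
Hypothesis theta_far : forall k x, (0 < k)%N -> inner A (5 / 2 * rad k) x -> theta k x = 0.
Hypothesis theta_sum : forall N x, inner A (5 / 4 * rad N) x ->
  \sum_(k < N.+1) theta k x = 1.

Let f k x : R := U x * theta k x.
Let h k i x : R := U x * partial i (theta k) x.

Variables (e : nat -> R) (rho : nat -> V -> R).
Hypotheses (krho : forall k, kernel (e k) (rho k)) (e_le : forall k, e k <= rad k / 4).
Hypothesis f_close : forall k, \int[mu]_x `|conv (f k) (rho k) x - f k x| <= delta * rad k.+1.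
Hypothesis h_close : forall k i,
  \int[mu]_x `|conv (h k i) (rho k) x - h k i x| <= delta * rad k.+1.

Let w k := conv (f k) (rho k).
(** An exhaustion of [A]. On [core N] all pieces of index above [N] vanish together with their
    derivatives, so every series is a finite sum there; the factor [4] leaves ample room for the
    shifts below. *)
Let core N := inner A (4 * rad N).

Let theta_Cc1 k : Cc1 (theta k).
Proof.
split => //; apply: (csupp_bsupp (A := A)).
apply: (csupp_inner bA _ (theta_supp (k := k))).
by rewrite mulr_gt0// rad_gt0.
Qed.

Let theta_bd k x : `|theta k x| <= 1.
Proof.
rewrite ger0_norm//; apply: le_trans (theta_le1 k.+1 x).
by rewrite big_ord_recr/= lerDr sumr_ge0.
Qed.

Let intf k : intV (f k).
Proof. exact: intR_bdM intU (Cc1_measurable (theta_Cc1 k)) (theta_bd k). Qed.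

Let inth k i : intV (h k i).
Proof.
have [M dM] := Cc1_partial_bounded i (theta_Cc1 k).
exact: intR_bdM intU (partial_measurable i (theta_Cc1 k)) dM.
Qed.

Let rho_Cc1 k : Cc1 (rho k). Proof. by have [] := krho k. Qed.

Let w1 k : C1 (w k). Proof. exact: C1_conv. Qed.

Let intw k : intV (w k). Proof. by have [] := conv_L1 (krho k) (intf k). Qed.

(** The kernel radius is at most [rad k / 4], so [3/4 - 1/4] remains. In the same way
    [11/4 = 5/2 + 1/4] in [w_far], and [3 = 11/4 + 1/4] in [partial_far], where vanishing is needed
    on a neighbourhood. *)
Let w_supp k x : w k x != 0 -> inner A (2^-1 * rad k) x.
Proof.
move=> /(kernel_supp (krho k))[y [fy xy]].
have /theta_supp Iy : theta k y != 0.
  by apply: contra_neq fy; rewrite /f => ->; rewrite mulr0.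
apply: (inner_le _ (inner_shift (s := rad k / 4) Iy _)).
  by have := rad_gt0 R k; lra.
by rewrite distrC ltW// (lt_le_trans xy).
Qed.

Let w_Cc1 k : Cc1 (w k).
Proof.
split => //; apply: (csupp_bsupp (A := A)).
apply: (csupp_inner bA _ (w_supp (k := k))).
by rewrite mulr_gt0// rad_gt0.
Qed.

Let theta_far' k x : (0 < k)%N -> inner A (11 / 4 * rad k) x -> theta k x = 0.
Proof. by move=> k0 Ix; apply: theta_far => //; apply: inner_lin Ix; lra. Qed.

Let w_far k x : (0 < k)%N -> inner A (11 / 4 * rad k) x -> w k x = 0.
Proof.
move=> k0 Ix; apply/eqP/negPn/negP => /(kernel_supp (krho k))[y [/negP + xy]].
apply; rewrite /f theta_far ?mulr0//.
apply: (inner_le _ (inner_shift (s := rad k / 4) Ix _)).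
  by have := rad_gt0 R k; lra.
by rewrite ltW// (lt_le_trans xy).
Qed.

Let partial_far F k i x : (forall y, inner A (11 / 4 * rad k) y -> F y = 0) ->
  inner A (3 * rad k) x -> partial i F x = 0.
Proof.
move=> F0 Ix; apply: (@partial_near_cst _ 0 (rad k / 4)).
  by rewrite divr_gt0// rad_gt0.
move=> y xy; apply: F0; apply: (inner_le _ (inner_shift (s := rad k / 4) Ix _)).
  by have := rad_gt0 R k; lra.
exact: ltW.
Qed.

Let core_far N k x : (N < k)%N -> core N x -> inner A (3 * rad k) x.
Proof.
move=> Nk; apply: inner_le.
have := rad_le R Nk; have := radS R N; have := rad_gt0 R k; lra.
Qed.

Let core_far' N k x : (N < k)%N -> core N x -> inner A (11 / 4 * rad k) x.
Proof. by move=> Nk /(core_far Nk); apply: inner_lin; lra. Qed.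

Let core_exists x : A x -> exists N, core N x.
Proof.
move=> Ax; have [r r0 Ir] := open_inner oA Ax.
have [|N Nr] := @rad_lt R (r / 4); first by rewrite divr_gt0.
by exists N; apply: inner_le Ir; lra.
Qed.

Let f_out k x : ~ A x -> f k x = 0. Proof. by move=> /UA; rewrite /f => ->; rewrite mul0r. Qed.

Let w_out k x : ~ A x -> w k x = 0.
Proof.
move=> nA; apply/eqP/negPn/negP => /w_supp /inner_sub/= /(_ _)/nA; apply.
by rewrite mulr_gt0// rad_gt0.
Qed.

Let dw_out k i x : ~ A x -> partial i (w k) x = 0.
Proof.
move=> nA; apply/eqP/negPn/negP => /(partial_inner (w_supp (k := k))).
by move=> /inner_sub/= /(_ _)/nA; apply; rewrite mulr_gt0// rad_gt0.
Qed.

Let w_core N k x : (N < k)%N -> core N x -> w k x = 0.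
Proof.
by move=> Nk cx; apply: w_far; [exact: leq_ltn_trans Nk|exact: core_far' cx].
Qed.

Let dw_core N k i x : (N < k)%N -> core N x -> partial i (w k) x = 0.
Proof.
move=> Nk cx; apply: (@partial_far _ k); last exact: core_far cx.
by move=> y; apply: w_far; exact: leq_ltn_trans Nk.
Qed.

Let f_core N k x : (N < k)%N -> core N x -> f k x = 0.
Proof.
move=> Nk cx; rewrite /f theta_far' ?mulr0//; last exact: core_far' cx.
exact: leq_ltn_trans Nk.
Qed.

(** Near [x] the partial sum of the partition is constantly [1]. This cancellation disposes of the
    terms [h k i], which are not small individually. *)
Let dtheta_core N i x : core N x -> \sum_(k < N.+1) partial i (theta k) x = 0.
Proof.
move=> cx; rewrite -(partial_sum (index_enum 'I_N.+1) (F := fun k : 'I_N.+1 => theta k)) //.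
apply: (@partial_near_cst _ 1 (rad N)); first exact: rad_gt0.
move=> y xy; apply: theta_sum.
apply: (inner_le _ (inner_shift (s := rad N) cx _)); last exact: ltW.
by have := rad_gt0 R N; lra.
Qed.

Let d k x : R := f k x - w k x.

Let d_van x : exists N, forall k, (N <= k)%N -> d k x = 0.
Proof.
have [/core_exists[N cx]|nA] := pselect (A x).
  by exists N.+1 => k Nk; rewrite /d (f_core Nk cx) (w_core Nk cx) subrr.
by exists 0%N => k _; rewrite /d f_out// w_out// subrr.
Qed.

(** [G i] is the candidate for the derivative of the smooth part, and [z] for the difference between
    [U] and the smooth part. The kernels were chosen so that the errors [d k] are summable in [L1];
    hence [z] comes first and the smooth part is defined as [U - z]. *)
Let G i := ser (fun k => partial i (w k)).
Let z := ser d.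

Let z_L1 : [/\ intV z, \int[mu]_x `|z x| <= delta &
  forall (g : V -> R) (M : R), measurable_fun setT g -> (forall x, `|g x| <= M) ->
    (\sum_(k < m) \int[mu]_x (d k x * g x)) @[m --> \oo] --> \int[mu]_x (z x * g x)].
Proof.
apply: (@ser_L1 _ _ _ _ _ (fun k => delta * rad k.+1)) => //.
- by move=> k; exact: intRB.
- move=> k; under eq_Rintegral do rewrite distrC; exact: f_close.
- move=> m; rewrite -mulr_sumr sum_rad ler_piMr// ?(ltW delta0)//.
  by rewrite lerBlDr lerDl ltW// rad_gt0.
Qed.

Let smooth_part N x : core N x -> U x - z x = \sum_(k < N.+1) w k x.
Proof.
move=> cx; rewrite /z (@serE _ _ _ _ N.+1) => [|k Nk]; last first.
  by rewrite /d (f_core Nk cx) (w_core Nk cx) subrr.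
rewrite sumrB /f -mulr_sumr theta_sum; first by ring.
by apply: inner_lin cx; lra.
Qed.

Let smooth_part_out x : ~ A x -> U x - z x = 0.
Proof.
move=> nA; rewrite /z (@serE _ _ _ _ 0%N) ?big_ord0 ?UA ?subrr// => k _.
by rewrite /d f_out// w_out// subrr.
Qed.

Let G_core N i x : core N x -> G i x = \sum_(k < N.+1) partial i (w k) x.
Proof. by move=> cx; rewrite /G (@serE _ _ _ _ N.+1) => // k Nk; exact: dw_core cx. Qed.

Let G_out i x : ~ A x -> G i x = 0.
Proof. by move=> nA; rewrite /G (@serE _ _ _ _ 0%N) ?big_ord0// => k _; exact: dw_out. Qed.



Let eta k (psi : V -> R) x : R := psi x - conv psi (rho k) x.

Let eta1 k psi : Cc1 psi -> C1 (eta k psi).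
Proof. by move=> p1; apply: C1B; [case: p1|apply: C1_conv => //; exact: intV_Cc1]. Qed.

(* Since the kernel is even, the mollification passes from [U theta_k] to [psi];
   the test function becomes [theta_k (psi - psi * rho_k)], supported inside [A]. *)
Let conv_defect k psi i : Cc1 psi ->
  \int[mu]_x (d k x * partial i psi x) =
  \int[mu]_x (U x * partial i (fun y => theta k y * eta k psi y) x) +
  \int[mu]_x ((conv (h k i) (rho k) x - h k i x) * psi x).
Proof.
move=> p1; have intp := intV_Cc1 p1; have intdp := intV_partial i p1.
have [M pM] := Cc1_bounded p1; have [N dpN] := Cc1_partial_bounded i p1.
have mp := Cc1_measurable p1; have mdp := partial_measurable i p1.
have [intcp _] := conv_L1 (krho k) intp; have [intcdp _] := conv_L1 (krho k) intdp.
have [intch _] := conv_L1 (krho k) (inth k i).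
have mcp := intR_measurable intcp; have mcdp := intR_measurable intcdp.
have cpM x : `|conv psi (rho k) x| <= M by exact: (conv_le (krho k)).
have cdpN x : `|conv (partial i psi) (rho k) x| <= N by exact: (conv_le (krho k)).
have I1 := intR_bdM (intf k) mdp dpN.
have I2 := intR_bdM (intf k) mcdp cdpN.
have I3 := intR_bdM (inth k i) mp pM.
have I4 := intR_bdM (inth k i) mcp cpM.
have I5 := intR_bdM (intw k) mdp dpN.
have I6 := intR_bdM intch mp pM.
under eq_Rintegral do rewrite mulrBl.
rewrite (RintegralB measurableT I1 I5) (conv_adjoint (krho k) (intf k) intdp).
under [X in _ = _ + X]eq_Rintegral do rewrite mulrBl.
rewrite (RintegralB measurableT I6 I3) (conv_adjoint (krho k) (inth k i) intp).
have -> : \int[mu]_x (U x * partial i (fun y => theta k y * eta k psi y) x) =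
    \int[mu]_x ((f k x * partial i psi x - f k x * conv (partial i psi) (rho k) x) +
      (h k i x * psi x - h k i x * conv psi (rho k) x)).
  apply: eq_Rintegral => x _; rewrite partialM//; last exact: eta1.
  rewrite /eta partialB//; [|by case: p1|exact: C1_conv].
  by rewrite conv_partial// /f /h; ring.
rewrite (RintegralD measurableT (intRB I1 I2) (intRB I3 I4)).
rewrite (RintegralB measurableT I1 I2) (RintegralB measurableT I3 I4).
by rewrite -[X in _ = _ + X]opprB addrK.
Qed.

Let Phi m (phi : V -> V) x : V :=
  \row_i \sum_(k < m) theta k x * eta k (Defs.comp phi i) x.

(** The estimate is made for partial sums, whose transposed field is supported in
    [inner A (3/4 rad m)] and hence admissible in [A]; it does not depend on [m], so it survives in
    the limit. The factor [2] bounds a component of [phi - phi * rho_k], weighted by the [theta_k]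
    with sum at most one; each of the [n] components adds at most [delta] of commutator error. *)
Let z_TV phi : TV_test setT phi ->
  \int[mu]_x (z x * div phi x) <= n%:R * 2 * t + n%:R * delta.
Proof.
move=> tphi; have phi1 i := TV_test_Cc1 i tphi.
have [cd [K dK]] := divE phi1.
have [_ _ /(_ (div phi) K)] := z_L1.
move=> /(_ (continuous_measurable_rV cd) dK) zlim.
rewrite -(cvg_lim _ zlim)//; apply: limr_le; first exact: cvgP zlim.
apply: nearW => m.
have PhiE i : Defs.comp (Phi m phi) i =
    fun x => \sum_(k < m) theta k x * eta k (Defs.comp phi i) x.
  by apply/funext => x; rewrite /Defs.comp mxE.
have Phi1 i : C1 (Defs.comp (Phi m phi) i).
  by rewrite PhiE; apply: C1_sum => k; apply: C1M => //; exact: eta1.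
have intdk k i : intV (fun x => d k x * partial i (Defs.comp phi i) x).
  have [N HN] := Cc1_partial_bounded i (phi1 i).
  by apply: (intR_bdM _ _ HN); [exact: intRB|exact: partial_measurable].
have intUt k i : intV (fun x => U x * partial i (fun y => theta k y *
    eta k (Defs.comp phi i) y) x).
  have c1 := Cc1M (theta_Cc1 k) (eta1 k (phi1 i)).
  have [N HN] := Cc1_partial_bounded i c1.
  by apply: (intR_bdM intU _ HN); exact: partial_measurable.
have -> : \sum_(k < m) \int[mu]_x (d k x * div phi x) =
    \int[mu]_x (U x * div (Phi m phi) x) +
    \sum_(k < m) \sum_(i < n)
      \int[mu]_x ((conv (h k i) (rho k) x - h k i x) * Defs.comp phi i x).
  have -> : \int[mu]_x (U x * div (Phi m phi) x) = \sum_(k < m) \sum_(i < n)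
      \int[mu]_x (U x * partial i (fun y => theta k y * eta k (Defs.comp phi i) y) x).
    rewrite exchange_big/=; transitivity (\int[mu]_x \sum_(i < n) \sum_(k < m)
        (U x * partial i (fun y => theta k y * eta k (Defs.comp phi i) y) x)).
      apply: eq_Rintegral => x _; rewrite mulr_sumr; apply: eq_bigr => i _.
      rewrite PhiE partial_sum ?mulr_sumr// => k.
      by apply: C1M => //; exact: eta1.
    rewrite Rintegral_sum => [|i _]; last exact: intR_sum.
    by apply: eq_bigr => i _; rewrite Rintegral_sum.
  rewrite -big_split/=; apply: eq_bigr => k _.
  rewrite -big_split/= /div; under eq_Rintegral do rewrite mulr_sumr.
  by rewrite Rintegral_sum//; apply: eq_bigr => i _; exact: conv_defect.
apply: lerD.
  apply: (TV_scaled_test n0 intU _ tv Phi1) => //.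
    apply: (csupp_inner bA (r := 3 / 4 * rad m)) => [|x].
      by rewrite mulr_gt0// rad_gt0.
    apply: contra_neqP => nI; apply/rowP => i; rewrite !mxE big1// => k _.
    have [->|/theta_supp Ik] := eqVneq (theta k x) 0; first by rewrite mul0r.
    by case: nI; apply: inner_rad_le Ik; [exact: ltnW|lra].
  move=> i x; rewrite PhiE; apply: (le_trans (ler_norm_sum _ _ _)).
  apply: (@le_trans _ _ ((\sum_(k < m) theta k x) * 2)); last first.
    by rewrite -[leRHS]mul1r ler_wpM2r.
  rewrite mulr_suml; apply: ler_sum => k _; rewrite normrM ger0_norm//.
  rewrite ler_wpM2l//; apply: (le_trans (ler_normB _ _)).
  have -> : 2 = 1 + 1 :> R by [].
  apply: lerD; first exact: TV_test_le1 tphi.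
  apply: (conv_le (krho k)) => [|y]; first exact: intV_Cc1.
  exact: TV_test_le1 tphi.
apply: (@le_trans _ _ (\sum_(k < m) n%:R * (delta * rad k.+1))).
  apply: ler_sum => k _.
  apply: (@le_trans _ _ (\sum_(i < n) delta * rad k.+1)).
    apply: ler_sum => i _; apply: (le_trans (ler_norm _)).
    apply: le_trans (h_close k i); rewrite -[leRHS]mul1r.
    apply: Rintegral_bd_le => [||x]; last exact: TV_test_le1 tphi.
      by apply: intRB => //; have [] := conv_L1 (krho k) (inth k i).
    exact: Cc1_measurable.
  by rewrite sumr_const card_ord mulr_natl.
rewrite -mulr_sumr ler_wpM2l// -mulr_sumr sum_rad ler_piMr// ?(ltW delta0)//.
by rewrite lerBlDr lerDl ltW// rad_gt0.
Qed.
(** Here [sigma] is merely integrable and bounded: the derivative falls on [conv sigma (rho k)],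
    which is [C1]. Of the three terms the first is a divergence tested against [U], the second is a
    commutator error, and the last is not small but cancels in the sum over [k]. *)
Let grad_pairing k i (sigma : V -> R) : intV sigma -> (forall x, `|sigma x| <= 1) ->
  \int[mu]_x (partial i (w k) x * sigma x) =
  \int[mu]_x (U x * partial i (fun y => -1 * (theta k y * conv sigma (rho k) y)) x) +
  \int[mu]_x ((conv (h k i) (rho k) x - h k i x) * sigma x) +
  \int[mu]_x (h k i x * sigma x).
Proof.
move=> ints s1; have ms := intR_measurable ints.
have r1 := rho_Cc1 k; have [N drN] := Cc1_partial_bounded i r1.
have [intch _] := conv_L1 (krho k) (inth k i).
have [intcs _] := conv_L1 (krho k) ints; have mcs := intR_measurable intcs.
have cs1 : C1 (conv sigma (rho k)) by exact: C1_conv.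
have csb x : `|conv sigma (rho k) x| <= 1 by exact: (conv_le (krho k)).
have [M dM] := Cc1_partial_bounded i (Cc1M (theta_Cc1 k) cs1).
have mdt := partial_measurable i (Cc1M (theta_Cc1 k) cs1).
have I1 : intV (fun x => U x * partial i (fun y => theta k y * conv sigma (rho k) y) x).
  exact: intR_bdM dM.
have I2 := intR_bdM (inth k i) mcs csb.
have I3 := intR_bdM intch ms s1.
have I4 := intR_bdM (inth k i) ms s1.
have -> : partial i (w k) = conv (f k) (partial i (rho k)).
  by apply/funext => x; rewrite partial_conv.
rewrite (conv_adjoint_partial i (krho k) (intf k) ints).
have -> : \int[mu]_y (f k y * conv sigma (partial i (rho k)) y) =
    \int[mu]_x (U x * partial i (fun y => theta k y * conv sigma (rho k) y) x -
      h k i x * conv sigma (rho k) x).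
  apply: eq_Rintegral => x _; rewrite partialM// partial_conv// /f /h; ring.
rewrite (RintegralB measurableT I1 I2) -(conv_adjoint (krho k) (inth k i) ints).
under [X in _ = _ + X + _]eq_Rintegral do rewrite mulrBl.
rewrite (RintegralB measurableT I3 I4) -addrA subrK.
have -> : \int[mu]_x (U x * partial i (fun y => -1 * (theta k y * conv sigma (rho k) y)) x) =
    \int[mu]_x (-1 * (U x * partial i (fun y => theta k y * conv sigma (rho k) y) x)).
  apply: eq_Rintegral => x _; rewrite partialZ; last exact: C1M.
  exact: mulrCA.
by rewrite RintegralZl// mulN1r opprB addrC.
Qed.

(** With the sign of the sum for [sigma] this becomes an [L1] bound on [core N]. The field used
    against [U] has the single component [i], of modulus at most the sum of the [theta_k], hence at
    most one. *)
Let grad_bound N i (sigma : V -> R) : measurable_fun setT sigma ->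
  (forall x, `|sigma x| <= 1) -> (forall x, sigma x != 0 -> core N x) ->
  \int[mu]_x ((\sum_(k < N.+1) partial i (w k) x) * sigma x) <= n%:R * t + delta.
Proof.
move=> ms s1 sc.
have ints : intV sigma.
  apply: (intV_bsupp ms _ s1); apply: (csupp_bsupp (A := A)).
  by apply: (csupp_inner bA _ sc); rewrite mulr_gt0// rad_gt0.
pose c k y := -1 * (theta k y * conv sigma (rho k) y).
have cs1 k : C1 (conv sigma (rho k)) by exact: C1_conv.
have c1 k : C1 (c k) by apply: C1Z; exact: C1M.
pose Psi x : V := \row_j if j == i then \sum_(k < N.+1) c k x else 0.
have PsiE j : Defs.comp Psi j =
    if j == i then fun x => \sum_(k < N.+1) c k x else fun=> 0.
  by apply/funext => x; rewrite /Defs.comp mxE; case: ifP.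
have I1 k : intV (fun x => U x * partial i (c k) x).
  have cc : Cc1 (c k).
    rewrite (_ : c k = fun y => theta k y * (-1 * conv sigma (rho k) y)).
      by apply: Cc1M => //; exact: C1Z.
    by apply/funext => y; rewrite /c mulrCA.
  have [M dM] := Cc1_partial_bounded i cc.
  by apply: (intR_bdM intU _ dM); exact: partial_measurable.
have I2 k : intV (fun x => partial i (w k) x * sigma x).
  by apply: (intR_bdM _ ms s1); exact: intV_partial.
have I4 k : intV (fun x => h k i x * sigma x) by exact: (intR_bdM _ ms s1).
under eq_Rintegral do rewrite mulr_suml.
rewrite Rintegral_sum//.
under eq_bigr do rewrite grad_pairing//.
rewrite !big_split/= -[X in _ + X]Rintegral_sum//.
(* The support of [sigma] matters here: on [core N] the derivatives of the [theta k] add up to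
   zero. *)
have -> : \int[mu]_x (\sum_(k < N.+1) h k i x * sigma x) = 0.
  under eq_Rintegral => x _.
    rewrite -mulr_suml -mulr_sumr.
    rewrite (_ : _ * sigma x = 0); first over.
    have [->|/sc cx] := eqVneq (sigma x) 0; first by rewrite mulr0.
    by rewrite dtheta_core// mulr0 mul0r.
  by rewrite Rintegral_cst// mul0r.
rewrite addr0; apply: lerD.
  rewrite -Rintegral_sum => [|k _]; last exact: I1.
  have -> : \int[mu]_x (\sum_(k < N.+1) U x * partial i (c k) x) =
      \int[mu]_x (U x * div Psi x).
    apply: eq_Rintegral => x _; rewrite -mulr_sumr; congr (_ * _).
    rewrite /div (bigD1 i)//= PsiE eqxx partial_sum// [X in _ + X]big1 ?addr0// => j /negbTE ji.
    by rewrite PsiE ji partial_cst.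
  rewrite -(mulr1 n%:R); apply: (TV_scaled_test n0 intU _ tv) => //.
  - by move=> j; rewrite PsiE; case: ifP => _; [exact: C1_sum|exact: C1_cst].
  - apply: (csupp_inner bA (r := 3 / 4 * rad N)) => [|x].
      by rewrite mulr_gt0// rad_gt0.
    apply: contra_neqP => nI; apply/rowP => j; rewrite !mxE; case: ifP => // _.
    rewrite big1// => k _; rewrite /c.
    have [->|/theta_supp Ik] := eqVneq (theta k x) 0; first by rewrite mul0r mulr0.
    by case: nI; apply: inner_rad_le Ik; [rewrite -ltnS|lra].
  - move=> j x; rewrite PsiE; case: ifP => _; last by rewrite normr0.
    apply: (le_trans (ler_norm_sum _ _ _)); apply: le_trans (theta_le1 N.+1 x).
    apply: ler_sum => k _; rewrite /c mulN1r normrN normrM ger0_norm//.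
    by rewrite ler_piMr//; exact: (conv_le (krho k)).
apply: (@le_trans _ _ (\sum_(k < N.+1) delta * rad k.+1)).
  apply: ler_sum => k _; apply: (le_trans (ler_norm _)).
  apply: le_trans (h_close k i); rewrite -[leRHS]mul1r.
  apply: Rintegral_bd_le => //.
  by apply: intRB => //; have [] := conv_L1 (krho k) (inth k i).
rewrite -mulr_sumr sum_rad ler_piMr// ?(ltW delta0)//.
by rewrite lerBlDr lerDl ltW// rad_gt0.
Qed.

Let core_le N M x : (N <= M)%N -> core N x -> core M x.
Proof. by move=> NM; apply: inner_rad_le. Qed.

Let G_meas i : measurable_fun setT (G i).
Proof.
apply: measurable_ser => [k|x]; first exact: partial_measurable.
have [/core_exists[N cx]|nA] := pselect (A x).
  by exists N.+1 => k Nk; exact: dw_core cx.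
by exists 0%N => k _; exact: dw_out.
Qed.

(** Duality: [s N] is the sign of the finite sum on [core N] and zero elsewhere, so pairing with it
    produces the [L1] norm over [core N]. The bound is independent of [N], and the cores increase to
    [A]. *)
Let G_L1 i : intV (G i) /\ \int[mu]_x `|G i x| <= n%:R * t + delta.
Proof.
pose g N x : R := \1_(core N) x * `|G i x|.
have mcore N : measurable_fun setT (\1_(core N) : V -> R).
  by apply: measurable_indic; exact: measurable_inner.
have core1 N x : core N x -> \1_(core N) x = 1 :> R.
  by move=> cx; rewrite indicE mem_set.
have core0 N x : ~ core N x -> \1_(core N) x = 0 :> R.
  by move=> cx; rewrite indicE memNset.
pose s N x : R := \1_(core N) x * (if 0 <= \sum_(k < N.+1) partial i (w k) x then 1 else -1).
have gE N x : g N x = (\sum_(k < N.+1) partial i (w k) x) * s N x.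
  rewrite /g /s; have [cx|ncx] := pselect (core N x).
    rewrite core1// !mul1r (G_core i cx).
    by case: ger0P => _; rewrite ?mulr1 ?mulrN1.
  by rewrite core0// !mul0r mulr0.
have s_le N x : `|s N x| <= 1.
  rewrite /s normrM; have [cx|ncx] := pselect (core N x).
    by rewrite core1// normr1 mul1r; case: ifP; rewrite ?normrN1 ?normr1.
  by rewrite core0// normr0 mul0r.
have ms N : measurable_fun setT (s N).
  apply: measurable_funM => //; apply: measurable_fun_ifT => //.
  apply: measurable_fun_ler => //.
  by apply: measurable_sum => k; exact: partial_measurable.
have s_core N x : s N x != 0 -> core N x.
  apply: contra_neqP; rewrite /s => /core0 ->; exact: mul0r.
have intg N : intV (g N).
  rewrite (_ : g N = fun x => (\sum_(k < N.+1) partial i (w k) x) * s N x).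
    apply: (intR_bdM _ (ms N) (s_le N)); apply: intR_sum => k _.
    exact: intV_partial.
  by apply/funext => x.
have [intn Gle] : intV (fun x => `|G i x|) /\
    \int[mu]_x `|G i x| <= n%:R * t + delta.
  apply: (@intR_monotone _ _ _ _ g) => //.
  - by move=> N x; rewrite mulr_ge0// indicE.
  - move=> x; apply/nondecreasing_seqP => N; rewrite ler_wpM2r//.
    have [cx|ncx] := pselect (core N x); last by rewrite core0// indicE.
    by rewrite !core1//; exact: core_le cx.
  - move=> x; apply: cvg_near_cst.
    have [/core_exists[N cx]|nA] := pselect (A x).
      by exists N => // M /= NM; rewrite /g core1 ?mul1r//; exact: core_le cx.
    by apply: nearW => M; rewrite /g G_out// normr0 mulr0.
  - move=> N; under eq_Rintegral do rewrite gE.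
    by apply: grad_bound => //; exact: s_core.
split => //; apply: (@intR_le _ _ _ _ _ (fun x => `|G i x|)) => // x.
by rewrite normr_id.
Qed.

Let W x := U x - z x.

(** The support of [psi] lies in a single [core N], where [W] and [G i] are finite sums of mollified
    functions and of their derivatives; each summand is integrated by parts with [conv_ibp]. *)
Let W_weak i psi : C1 psi -> csupp_in A psi ->
  \int[mu]_x (W x * partial i psi x) = - \int[mu]_x (G i x * psi x).
Proof.
move=> p1 sp; have pc : Cc1 psi by split => //; exact: csupp_bsupp sp.
have [r r0 sr] := csupp_innerP oA sp.
have [|N Nr] := @rad_lt R (r / 4); first by rewrite divr_gt0.
have rc x : inner A r x -> core N x by apply: inner_le; lra.
have [M pM] := Cc1_bounded pc; have [K dK] := Cc1_partial_bounded i pc.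
have -> : \int[mu]_x (W x * partial i psi x) =
    \int[mu]_x (\sum_(k < N.+1) w k x * partial i psi x).
  apply: eq_Rintegral => x _; rewrite -mulr_suml.
  have [->|/partial_supp/sr/rc cx] := eqVneq (partial i psi x) 0; first by rewrite !mulr0.
  by rewrite /W (smooth_part cx).
have -> : \int[mu]_x (G i x * psi x) =
    \int[mu]_x (\sum_(k < N.+1) partial i (w k) x * psi x).
  apply: eq_Rintegral => x _; rewrite -mulr_suml.
  have [->|px] := eqVneq (psi x) 0; first by rewrite !mulr0.
  by rewrite (@G_core N)//; apply/rc/sr/subset_closure.
rewrite !Rintegral_sum => [|k _|k _].
- by rewrite -sumrN; apply: eq_bigr => k _; exact: conv_ibp.
- by apply: (intR_bdM _ _ pM); [exact: intV_partial|exact: Cc1_measurable].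
- by apply: (intR_bdM _ _ dK) => //; exact: partial_measurable.
Qed.

Lemma smoothing_of_kernels : exists (v : V -> R) (g : V -> V),
  [/\ [/\ intV v, forall x, ~ A x -> v x = 0, forall i, intV (Defs.comp g i) &
        forall i x, ~ A x -> Defs.comp g i x = 0],
    \int[mu]_x `|U x - v x| <= delta,
    forall i, \int[mu]_x `|Defs.comp g i x| <= n%:R * t + delta,
    forall phi, TV_test setT phi ->
      \int[mu]_x ((U x - v x) * div phi x) <= n%:R * 2 * t + n%:R * delta &
    forall i psi, C1 psi -> csupp_in A psi ->
      \int[mu]_x (v x * partial i psi x) = - \int[mu]_x (Defs.comp g i x * psi x)].
Proof.
have [intz zd _] := z_L1.
have gE i : Defs.comp (fun x => \row_i G i x) i = G i.
  by apply/funext => x; rewrite /Defs.comp mxE.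
have UW x : U x - W x = z x by rewrite /W opprB addrC subrK.
exists W, (fun x => \row_i G i x); split.
- split => [|x||i x]; [exact: intRB|exact: smooth_part_out| |].
    by move=> i; rewrite gE; have [] := G_L1 i.
  by rewrite gE; exact: G_out.
- by under eq_Rintegral do rewrite UW.
- by move=> i; rewrite gE; have [] := G_L1 i.
- by move=> phi tphi; under eq_Rintegral do rewrite UW; exact: z_TV.
- by move=> i psi p1 sp; rewrite gE; exact: W_weak.
Qed.

End smoothing.

Lemma smooth_decomposition (R : realType) n (A : set 'rV[R]_n) (U : 'rV[R]_n -> R)
  (t delta : R) : open A -> bounded_set A -> (0 < n)%N ->
  intR (@Leb R n) U -> (forall x, ~ A x -> U x = 0) -> 0 < delta ->
  (forall phi, TV_test A phi -> \int[@Leb R n]_x (U x * div phi x) <= t) ->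
  exists (v : 'rV[R]_n -> R) (g : 'rV[R]_n -> 'rV[R]_n),
  [/\ [/\ intR (@Leb R n) v, forall x, ~ A x -> v x = 0,
        forall i, intR (@Leb R n) (Defs.comp g i) &
        forall i x, ~ A x -> Defs.comp g i x = 0],
    \int[@Leb R n]_x `|U x - v x| <= delta,
    forall i, \int[@Leb R n]_x `|Defs.comp g i x| <= n%:R * t + delta,
    forall phi, TV_test setT phi ->
      \int[@Leb R n]_x ((U x - v x) * div phi x) <= n%:R * 2 * t + n%:R * delta &
    forall i psi, C1 psi -> csupp_in A psi ->
      \int[@Leb R n]_x (v x * partial i psi x) =
      - \int[@Leb R n]_x (Defs.comp g i x * psi x)].
Proof.
move=> oA bA n0 intU UA d0 tv; set mu := @Leb R n.
have [theta [th1 th0 thle thsupp [thfar thsum]]] := partition_exists bA.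
have thC k : Cc1 (theta k).
  split => //; apply: (csupp_bsupp (A := A)).
  by apply: (csupp_inner bA _ (thsupp k)); rewrite mulr_gt0// rad_gt0.
pose f k x : R := U x * theta k x.
pose h k i x : R := U x * partial i (theta k) x.
have intf k : intR mu (f k).
  have [M thM] := Cc1_bounded (thC k).
  exact: (intR_bdM intU (Cc1_measurable (thC k)) thM).
have inth k i : intR mu (h k i).
  have [M thM] := Cc1_partial_bounded i (thC k).
  exact: (intR_bdM intU (partial_measurable i (thC k)) thM).
have H k : exists p : R * ('rV[R]_n -> R), [/\ kernel p.1 p.2, p.1 <= rad R k / 4,
    \int[mu]_x `|conv (f k) p.2 x - f k x| <= delta * rad R k.+1 &
    forall i, \int[mu]_x `|conv (h k i) p.2 x - h k i x| <= delta * rad R k.+1].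
  have dk0 : 0 < delta * rad R k.+1 by rewrite mulr_gt0// rad_gt0.
  have [e1 [e10 H1]] := mollifiable_intV (intf k) dk0.
  have /choice[e2 /all_and2[e20 H2]] := fun i => mollifiable_intV (inth k i) dk0.
  (* One radius that serves [f k] and all the [h k i], and stays below [rad k / 4] for the
     supports. *)
  pose e := \big[Num.min/Num.min e1 (rad R k / 4)]_(i < n) e2 i.
  have e0 : 0 < e.
    rewrite /e; elim/big_ind : _ => //; first by rewrite lt_min e10 divr_gt0// rad_gt0.
    by move=> x y x0 y0; rewrite lt_min x0.
  have [rho [_ krho]] := @kernel_exists R n e e0.
  have eb : e <= Num.min e1 (rad R k / 4) by exact: bigmin_le_id.
  exists (e, rho); split => //=.
  - by rewrite (le_trans eb)// ge_min lexx orbT.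
  - by apply: H1 krho; rewrite (le_trans eb)// ge_min lexx.
  - by move=> i; apply: H2 krho; exact: bigmin_le.
have [p Hp] := choice H.
by apply: (@smoothing_of_kernels R n A oA bA n0 U t delta intU UA d0 tv theta
  th1 th0 thle thsupp thfar thsum (fst \o p) (snd \o p)) => k; have [] := Hp k.
Qed.

(** The operator stays the same; the constant [C * n] absorbs the factor [n] of [W11_TV]. *)
Lemma W11_BV_of_BV_BV (R : realType) n (A : set 'rV[R]_n) : (0 < n)%N -> open A ->
  bounded_set A -> BV_BV_extension_domain A -> W11_BV_extension_domain A.
Proof.
move=> n0 oA bA [E [C [C1 EC]]]; exists E, (C * n%:R); split.
  by rewrite (lt_le_trans C1)// ler_peMr ?ler1n// (le_trans _ (ltW C1)).
move=> u g Wug; have [Lu [Lg wg]] := Wug.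
have mA := measurable_open_rV oA.
have intU := (L1_intV _ mA).1 Lu.
have intG i := (L1_intV _ mA).1 (Lg i).
have [intS _ _] := grad_norm_intV intG.
have TVle := W11_TV oA bA Wug; move: TVle.
have -> : W11norm A u g = (L1norm A u +
   Iplus A (fun x => (Num.sqrt (\sum_(i < n) g x 0 i ^+ 2))%:E))%E by [].
rewrite IplusE//; last exact: intR_measurable intS.
rewrite EFin_Rintegral// -EFinM => TVle.
have BVu : BV A u by split => //; rewrite (le_lt_trans TVle)// ltry.
have [B1 [B2 B3]] := EC u BVu; split => //; split => //.
apply: (le_trans B3); rewrite /BVnorm L1normE// -EFinD.
apply: (le_trans (lee_wpmul2l _ (leeD2l _ TVle))).
  by rewrite lee_fin (le_trans _ (ltW C1)).
rewrite -EFinD -!EFinM lee_fin -mulrA ler_wpM2l ?(le_trans _ (ltW C1))//.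
rewrite mulrDr lerD2r ler_peMl ?ler1n//.
by apply: Rintegral_ge0.
Qed.

(** * Extension operators *)

(** [ae_eq] only sees at which points of [A] two functions differ, so pairs that differ at the same
    points can be exchanged without any question of measurability. *)
Lemma ae_eq_congr (R : realType) n (A : set 'rV[R]_n) (f g f' g' : 'rV[R]_n -> R) :
  (forall x, A x -> (f x == g x) = (f' x == g' x)) -> Defs.ae_eq A f g ->
  Defs.ae_eq A f' g'.
Proof.
rewrite /Defs.ae_eq => fg <-; congr iint; apply/funext => s; rewrite !patchE.
by case: ifPn => // /set_mem/fg ->.
Qed.

Lemma ae_eq_refl (R : realType) n (A : set 'rV[R]_n) (f : 'rV[R]_n -> R) : Defs.ae_eq A f f.
Proof.
have E : (fun x : 'rV[R]_n => (f x != f x)%:R : R) \_ A = fun=> 0.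
  by apply/funext => x; rewrite patchE eqxx; case: ifP.
by rewrite /Defs.ae_eq IplusE// E// integral_cst// mul0e.
Qed.

Lemma BV_BV_of_W11_BV (R : realType) n (A : set 'rV[R]_n) : (0 < n)%N -> open A ->
  bounded_set A -> W11_BV_extension_domain A -> BV_BV_extension_domain A.
Proof.
move=> n0 oA bA [E [C [C1 EC]]]; set mu := @Leb R n.
have C0 : 0 <= C by rewrite (le_trans _ (ltW C1)).
have mA := measurable_open_rV oA.
(* With [a] the [L1] norm and [t] the variation of [u], the estimates below give
   [(C (2 + n) + 1 + n) a + (C n^2 + 2 n) t]; [K] dominates both coefficients. *)
pose K : R := C * (2 + n%:R + n%:R * n%:R) + 1 + 3 * n%:R.
have K1 : 1 < K.
  rewrite /K -addrA -[ltLHS]add0r ltr_leD//; last by rewrite lerDl mulr_ge0.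
  by rewrite mulr_gt0 ?(lt_trans _ C1)// !ltr_wpDr// mulr_ge0.
suff H u : exists v : 'rV[R]_n -> R, BV A u -> BV setT v /\ Defs.ae_eq A v u /\
    (BVnorm setT v <= K%:E * BVnorm A u)%E.
  (* The operator is assembled function by function by choice. *)
  by have [E' E'P] := choice H; exists E', K.
have [[Lu TVu]|nBV] := pselect (BV A u); last by exists (fun=> 0).
pose U := u \_ A.
have intU : intR mu U := (L1_intV u mA).1 Lu.
have UA x : ~ A x -> U x = 0 by move=> nA; rewrite /U patchE memNset.
have uU x : A x -> U x = u x by move=> Ax; rewrite /U patchE mem_set.
pose a := \int[mu]_x `|U x|; pose t := fine (TV A u).
have a0 : 0 <= a by apply: Rintegral_ge0.
have TVE : TV A u = t%:E by rewrite fineK// ge0_fin_numE// TV_ge0.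
have t0 : 0 <= t by rewrite -lee_fin -TVE TV_ge0.
have tv phi : TV_test A phi -> \int[mu]_x (U x * div phi x) <= t.
  by move=> tphi; apply: (TV_leP _ intU).1 tphi; rewrite TVE.
have normE : BVnorm A u = (a + t)%:E by rewrite /BVnorm L1normE// TVE.
have [az|an0] := eqVneq a 0.
  exists U => _.
  have LU : L1norm setT U = 0%E by rewrite L1normE ?patch_setT// -/mu -/a az.
  have TU : (TV setT U <= 0)%E.
    apply/TV_leP; rewrite ?patch_setT// => phi tphi.
    have [cd [M dM]] := divE (fun i => TV_test_Cc1 i tphi).
    apply: (le_trans (ler_norm _)).
    have := Rintegral_bd_le intU (continuous_measurable_rV cd) dM.
    by rewrite -/mu -/a az mulr0.
  split; first by split; [apply/L1_intV; rewrite ?patch_setT|exact: le_lt_trans TU _].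
  split; last first.
    rewrite normE -EFinM /BVnorm LU add0e (le_trans TU)// lee_fin.
    by apply: mulr_ge0; [exact: le_trans ler01 (ltW K1)|exact: addr_ge0].
  by apply: (@ae_eq_congr _ _ _ u u) (ae_eq_refl A u) => x Ax; rewrite uU// eqxx.
have {an0}a0' : 0 < a by rewrite lt_neqAle eq_sym an0.
have [v [g [[intv vA intg gA] Uv_le g_le Uv_TV vg]]] :=
  smooth_decomposition oA bA n0 intU UA a0' tv.
have restr (F : 'rV[R]_n -> R) : (forall x, ~ A x -> F x = 0) -> F \_ A = F.
  by move=> F0; apply/funext => x; rewrite patchE; case: ifPn => // /negP;
     rewrite inE => /F0.
have vE : v \_ A = v by exact: restr.
have gE i : Defs.comp g i \_ A = Defs.comp g i by apply: restr; exact: gA.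
have Wv : W11 A v g.
  split; first by apply/(L1_intV _ mA); rewrite vE.
  split=> [i|psi /smooth_C1 p1 sp i]; first by apply/(L1_intV _ mA); rewrite gE.
  have pc : Cc1 psi by split => //; exact: csupp_bsupp sp.
  have [M pM] := Cc1_bounded pc; have [N dN] := Cc1_partial_bounded i pc.
  rewrite !IintE !patch_mulr ?vE ?gE; first by rewrite vg// EFinN oppeK.
    by apply: (intR_bdM _ _ pM) => //; exact: Cc1_measurable.
  by apply: (intR_bdM _ _ dN) => //; exact: partial_measurable.
have [[LE TVEv] [aeE EvC]] := EC v g Wv.
have intE : intR mu (E v) by move/(L1_intV _ measurableT): LE; rewrite patch_setT.
pose s := fine (TV setT (E v)).
have sE : TV setT (E v) = s%:E by rewrite fineK// ge0_fin_numE// TV_ge0.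
have intUv : intR mu (fun x => U x - v x) by exact: intRB.
(* [|v| <= |U| + |U - v|] accounts for [a + a]; the length of the gradient is at most the sum of its
   [n] components, each of integral at most [n t + a]. *)
have normv : (W11norm A v g <= (a + a + n%:R * (n%:R * t + a))%:E)%E.
  have [intS _ Sle] : [/\ intR mu _, _ & _] :=
    grad_norm_intV (fun i => eq_ind_r (intR mu) (intg i) (gE i)).
  rewrite /W11norm L1normE ?vE// IplusE//; last exact: intR_measurable intS.
  rewrite EFin_Rintegral// -EFinD lee_fin; apply: lerD.
    have intn := intR_norm intUv; have intU' := intR_norm intU.
    apply: (@le_trans _ _ (\int[mu]_x (`|U x| + `|U x - v x|))).
      apply: le_RintegralT => [||x]; [exact: intR_norm|exact: intRD|].
      have {1}-> : v x = U x - (U x - v x) by rewrite opprB addrC subrK.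
      exact: ler_normB.
    by rewrite (RintegralD measurableT intU' intn) lerD2l.
  apply: (@le_trans _ _ (\int[mu]_x (\sum_(i < n) `|Defs.comp g i x|))).
    apply: le_RintegralT => // [|x]; first by apply: intR_sum => i _; exact: intR_norm.
    by apply: (le_trans (Sle x)); apply: ler_sum => i _; rewrite gE.
  rewrite Rintegral_sum => [|i _]; last exact: intR_norm.
  apply: (@le_trans _ _ (\sum_(i < n) (n%:R * t + a))).
    by apply: ler_sum => i _; exact: g_le.
  by rewrite sumr_const card_ord [leRHS]mulr_natl.
pose b := \int[mu]_x `|E v x|.
have bs_le : b + s <= C * (a + a + n%:R * (n%:R * t + a)).
  rewrite -lee_fin EFinM; apply: le_trans (lee_wpmul2l _ normv); last by rewrite lee_fin.
  by apply: le_trans EvC; rewrite /BVnorm L1normE ?patch_setT// sE.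
pose w x := E v x + (U x - v x).
have intw : intR mu w by exact: intRD.
have Lw : L1norm setT w = (\int[mu]_x `|w x|)%:E by rewrite L1normE patch_setT.
have Lw_le : \int[mu]_x `|w x| <= b + a.
  have intn := intR_norm intUv; have intE' := intR_norm intE.
  apply: (@le_trans _ _ (\int[mu]_x (`|E v x| + `|U x - v x|))).
    apply: le_RintegralT => [||x]; [exact: intR_norm|exact: intRD|exact: ler_normD].
  by rewrite (RintegralD measurableT intE' intn) lerD2l.
have TVw : (TV setT w <= (s + (n%:R * 2 * t + n%:R * a))%:E)%E.
  apply/TV_leP; rewrite ?patch_setT// => phi tphi.
  under eq_Rintegral do rewrite mulrDl.
  rewrite (RintegralD measurableT (intV_divM tphi intE) (intV_divM tphi intUv)).
  apply: lerD; last exact: Uv_TV.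
  have [|+ _] := @TV_leP _ _ setT (E v) s; rewrite patch_setT//.
  by rewrite sE; apply.
exists w => _; split.
  split; first by apply/(L1_intV _ measurableT); rewrite patch_setT.
  exact: le_lt_trans TVw (ltry _).
split.
  (* On [A] one has [w - u = E v - v], so [w] agrees with [u] exactly where [E v] agrees with
     [v]. *)
  apply: ae_eq_congr aeE => x Ax; rewrite /w uU//.
  by rewrite -subr_eq0 -[RHS]subr_eq0; congr (_ == 0); ring.
rewrite normE -EFinM /BVnorm Lw; apply: (le_trans (leeD2l _ TVw)).
rewrite -EFinD lee_fin.
apply: (@le_trans _ _ (C * (a + a + n%:R * (n%:R * t + a)) + a + (n%:R * 2 * t + n%:R * a))).
  by move: bs_le Lw_le; lra.
have n00 : 0 <= n%:R :> R by [].
(* The difference between [K (a + t)] and the bound, arranged as a sum of products of nonnegative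
   factors. *)
rewrite -subr_ge0 (_ : _ - _ = C * (n%:R * n%:R) * a + C * (2 + n%:R) * t +
  (2 * n%:R * a + (1 + n%:R) * t)); last by rewrite /K; ring.
by rewrite !addr_ge0// !mulr_ge0// addr_ge0.
Qed.

Theorem theorem1p1 (R : realType) (n : nat) (Omega : set 'rV[R]_n) :
  (2 <= n)%N -> bounded_domain Omega ->
  (BV_BV_extension_domain Omega <-> W11_BV_extension_domain Omega).
Proof.
move=> n2 [oA [_ [_ bA]]]; have n0 : (0 < n)%N by exact: ltnW.
by split; [exact: W11_BV_of_BV_BV|exact: BV_BV_of_W11_BV].
Qed.
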